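(* Let $G$ be a connected $(4,2)$-choosable graph. Then either the core of $G$ is one of the following, where $s,t$ are positive integers: (i) $K_1$, (ii) $C_{2s}$, (iii) $\theta_{2,2s,2t}$, (iv) $\theta_{1,2s+1,2t+1}$, (v) $K_{2,4}$, (vi) a graph formed from $K_{3,3}-e$ by subdividing a single edge incident to a vertex of degree 2 an even number of times; or else (vii) $\mathcal{B}(G)=\{C_{2s},C_{2t}\}$, (viii) $\mathcal{B}(G)=\{\theta_{2,2,2},C_{2s}\}$, or (ix) $\mathcal{B}(G)=\{C_4,C_{2s},C_{2t}\}$, where the $C_4$ appears second on a path passing through all three blocks and the two cut-vertices in the $C_4$ are non-adjacent.
   Context: Graphs are finite and simple. A graph is $(4,2)$-choosable if for every assignment $L$ of a set $L(v)$ of exactly 4 colors to each vertex $v$, there is $\varphi$ with $\varphi(v)\subseteq L(v)$, $|\varphi(v)|=2$ for all $v$, and $\varphi(x)\cap\varphi(y)=\emptyset$ for all edges $xy$. The core of a connected graph is its maximum subgraph of minimum degree at least 2 (obtained by repeatedly deleting vertices of degree 1); for a tree it is $K_1$. $\mathcal{B}(G)$ denotes the multiset of blocks of $G$ that contain a cycle. $\theta_{a,b,c}$ is formed from three internally vertex-disjoint paths of lengths $a,b,c$ with common endpoints. $K_{3,3}-e$ is $K_{3,3}$ minus one edge. *)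

(* Defs.v *)
From mathcomp Require Import all_boot.

Set Implicit Arguments.
Unset Strict Implicit.
Unset Printing Implicit Defensive.

Record sgraph := SGraph {
  vertex :> finType;
  adj : rel vertex;
  adj_sym : symmetric adj;
  adj_irr : irreflexive adj }.
Arguments adj {_}.

Section SymmetricClosure.
Variables (T : finType) (r : rel T).

Definition sym_rel : rel T := [rel x y | (x != y) && (r x y || r y x)].

Fact sym_rel_sym : symmetric sym_rel.
Proof. by move=> x y; rewrite /sym_rel /= eq_sym orbC. Qed.

Fact sym_rel_irr : irreflexive sym_rel.
Proof. by move=> x; rewrite /sym_rel /= eqxx. Qed.

(* The simple graph on T whose edges are the pairs xy with x != y that are
   related by r in at least one direction. *)
Definition graph_of : sgraph := SGraph sym_rel_sym sym_rel_irr.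
End SymmetricClosure.

Definition iso (G H : sgraph) : Prop :=
  exists2 f : G -> H, bijective f & {mono f : x y / adj x y}.

Section InducedSubgraph.
Variables (G : sgraph) (S : {set G}).

Definition induced_adj : rel {x : G | x \in S} :=
  [rel x y | adj (val x) (val y)].

Fact induced_sym : symmetric induced_adj.
Proof. by move=> x y; apply: adj_sym. Qed.

Fact induced_irr : irreflexive induced_adj.
Proof. by move=> x; apply: adj_irr. Qed.

Definition induced : sgraph := SGraph induced_sym induced_irr.
End InducedSubgraph.

Definition degree (G : sgraph) (x : G) : nat := #|[set y | adj x y]|.

(* The empty graph does not count as connected. *)
Definition connected (G : sgraph) : bool :=
  (0 < #|G|) && [forall x : G, forall y : G, connect adj x y].

Definition choosable (a b : nat) (G : sgraph) : Prop :=
  forall (C : finType) (L : G -> {set C}), (forall v, #|L v| = a) ->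
  exists phi : G -> {set C},
    [/\ forall v, phi v \subset L v,
        forall v, #|phi v| = b
      & forall x y, adj x y -> [disjoint phi x & phi y]].

Definition min_degree2 (G : sgraph) : bool := [forall x : G, 2 <= degree x].

(* A maximum subgraph of minimum degree at least 2 is induced, so it is given
   by its vertex set; set0 satisfies the condition vacuously, and is the
   maximum precisely when G is a forest. *)
Definition two_core (G : sgraph) : {set G} :=
  [arg max_(S > set0 | min_degree2 (induced S)) #|S|].

(* When the two-core is empty (for connected G: when G is a tree), the core is
   an arbitrary single vertex. *)
Definition core_set (G : sgraph) : {set G} :=
  if two_core G == set0 then oapp set1 set0 [pick x : G] else two_core G.

Definition core (G : sgraph) : sgraph := induced (core_set G).

Definition cutvertex (G : sgraph) (v : G) : bool :=
  [exists x : G, exists y : G,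
    [&& x != v, y != v, connect adj x y
      & ~~ connect [rel a b | [&& a != v, b != v & adj a b]] x y]].

Definition nonseparable (G : sgraph) : bool :=
  connected G && [forall v : G, ~~ cutvertex v].

(* Maximal nonseparable subgraphs are induced, so blocks are vertex sets. *)
Definition block (G : sgraph) (B : {set G}) : bool :=
  maxset (fun A : {set G} => nonseparable (induced A)) B.

Definition has_cycle (G : sgraph) : Prop :=
  exists c : seq G, ucycle adj c /\ 2 < size c.

(* Bs lists, without repetition, the blocks of G that contain a cycle; the
   isomorphism types of its entries form the multiset of these blocks. *)
Definition cyclic_blocks (G : sgraph) (Bs : seq {set G}) : Prop :=
  uniq Bs /\ forall B, B \in Bs <-> block B /\ has_cycle (induced B).

(* The vertices of G that are cut-vertices of its core; a cut-vertex of G need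
   not be one, because of the trees attached to the core. *)
Definition core_cutvertices (G : sgraph) : {set G} :=
  [set val w | w : core G & cutvertex w].

Definition steps (T : Type) (s : seq T) : seq (T * T) := zip s (behead s).

(* A path passes through a block when it uses one of its edges; blocks being
   induced, this is a step of the path with both ends in the block. *)
Definition path_through (G : sgraph) (B1 B2 B3 : {set G}) : Prop :=
  exists (x : G) (p : seq G) (e1 e2 e3 : G * G),
    [/\ path adj x p, uniq (x :: p),
        subseq [:: e1; e2; e3] (steps (x :: p))
      & [/\ e1 \in setX B1 B1, e2 \in setX B2 B2 & e3 \in setX B3 B3]].

Definition complete_graph (n : nat) : sgraph :=
  graph_of (fun _ _ : 'I_n => true).

(* Meaningful for n >= 3. For n = 2 it is a single edge, which is neither the
   core of a graph nor a block containing a cycle. *)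
Definition cycle_graph (n : nat) : sgraph :=
  graph_of (fun i j : 'I_n => val j == i.+1 %% n).

Definition complete_bipartite (m n : nat) : sgraph :=
  graph_of (fun x y : 'I_m + 'I_n =>
    match x, y with inl _, inr _ => true | _, _ => false end).

(* The end vertices are inl false and inl true; a path of length k between
   them has k.-1 internal vertices. For positive a, b, c of which at most one
   is 1, this is the simple graph theta_{a,b,c}. *)
Definition theta (a b c : nat) : sgraph :=
  let V : finType := (bool + ('I_a.-1 + 'I_b.-1 + 'I_c.-1))%type in
  let whole (s : seq V) := inl false :: rcons s (inl true) in
  let pa := whole [seq inr (inl (inl i)) | i <- enum 'I_a.-1] in
  let pb := whole [seq inr (inl (inr i)) | i <- enum 'I_b.-1] in
  let pc := whole [seq inr (inr i) | i <- enum 'I_c.-1] in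
  graph_of (fun x y : V => (x, y) \in steps pa ++ steps pb ++ steps pc).

Definition delete_edge (G : sgraph) (u v : G) : sgraph :=
  graph_of (fun x y : G => adj x y && ([set x; y] != [set u; v])).

(* The edge uv subdivided k times: it is replaced by a path with k new
   internal vertices (and is put back when k = 0). *)
Definition subdivide (G : sgraph) (u v : G) (k : nat) : sgraph :=
  let V : finType := (G + 'I_k)%type in
  let new_path : seq V := inl u :: rcons (map inr (enum 'I_k)) (inl v) in
  graph_of (fun x y : V => ((x, y) \in steps new_path) ||
    match x, y with
    | inl x', inl y' => @adj (delete_edge u v) x' y'
    | _, _ => false
    end).

(* By symmetry it does not matter which edge of K_{3,3} is deleted. *)
Definition K33_minus_edge : sgraph :=
  @delete_edge (complete_bipartite 3 3) (inl ord0) (inr ord0).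

(* Main.v *)
(* Choosability is refuted by bad lists. A piece of the graph hanging at a vertex v
   can be given lists that, whatever the list of v is, make some pairs of its four
   colors unavailable at v; the unavailable pairs form a graph on the four colors.
   A cycle makes two pairs with a common color unavailable, and two cycles or a
   theta graph make three or four pairs unavailable. These families are stable
   under complementation, so they travel along any path on which the lists are
   equal. Likewise a path may be lengthened by two vertices that repeat a list.
   Hence finitely many short list assignments, each checked by computation, forbid
   infinite families of subgraphs. The two-core of a bipartite graph is finally
   rebuilt by adding ears, that is, paths with both ends on what is already built,
   or cycles attached to it by a path: starting from a theta graph or a cycle,
   every sequence of ears outside the nine families meets a forbidden subgraph. *)
Require Import Defs.
From mathcomp Require Import all_boot.
From mathcomp Require Import zify.

Set Implicit Arguments.
Unset Strict Implicit.
Unset Printing Implicit Defensive.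

(** A list of four colors has six pairs. Two pieces pending at a vertex refute choosability as soon
    as their families, after independent reorderings of the list, cover all six. [F4] is the
    complement of a copy of [FC], so these two cover; so do any two of [FQ], [FP], [F4]. But [FC]
    has two edges, too few for the three pairs that [FP] leaves out, and [FQ] leaves out two
    disjoint pairs, which is not a copy of [FC]. This is why a cycle may hang at a theta graph or at
    the opposite vertex of a 4-cycle, whereas three cycles hanging at one vertex are impossible.
    Path lengths matter only through parity: equal lists on all vertices show that the graph is
    bipartite, so the colors of the branch vertices fix the parity of every path, and each pattern
    needs only its shortest representative of each parity. The remaining burden is disjointness of
    many vertex sequences. It is handled by multiplicities: a sequence is duplicate-free if no
    element occurs in it more often than in a sequence known to be duplicate-free. *)

(** * Lists of four colors, their pairs, and families of pairs *)

Definition pd (p q : nat * nat) : bool :=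
  [&& p.1 != q.1, p.1 != q.2, p.2 != q.1 & p.2 != q.2].

(** Each pair appears in one order only, the order of the list; this halves the search at every
    vertex. *)
Definition opts (l : seq nat) : seq (nat * nat) :=
  if l is [:: a; b; c; d]
  then [:: (a, b); (a, c); (a, d); (b, c); (b, d); (c, d)] else [::].

Definition isopt (l : seq nat) (p : nat * nat) : bool :=
  [&& p.1 != p.2, p.1 \in l & p.2 \in l].

Definition good4 (l : seq nat) : bool := (size l == 4) && uniq l.

Lemma good4P l : good4 l ->
  exists a b c d, l = [:: a; b; c; d] /\ uniq [:: a; b; c; d].
Proof.
case: l => [|a [|b [|c [|d [|e l]]]]] //; rewrite /good4 => /andP[] // _ U.
by exists a, b, c, d.
Qed.

Lemma opts_isopt l p : good4 l -> p \in opts l -> isopt l p.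
Proof.
move=> /good4P[a [b [c [d [-> ]]]]]; rewrite /isopt /=.
rewrite !inE !negb_or => /and4P[/and3P[ab ac ad] /andP[bc bd] cd _].
by do 5?[case/orP]; move=> /eqP-> /=; rewrite ?eqxx ?ab ?ac ?ad ?bc ?bd ?cd ?orbT.
Qed.

Lemma isopt_opts l p : good4 l -> isopt l p ->
  p \in opts l \/ (p.2, p.1) \in opts l.
Proof.
case: p => c d /good4P[x1 [x2 [x3 [x4 [-> _]]]]] /and3P[/= cd cl dl].
apply/orP; move: cl dl cd; rewrite !inE !xpair_eqE.
by move=> /or4P[]/eqP-> /or4P[]/eqP->; rewrite ?eqxx ?orbT.
Qed.

(** Colors become natural numbers, so that list assignments are concrete data open to computation.
    Only finitely many colors occur, hence ['I_N] with [N] above all of them can serve as the color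
    type. *)
Lemma choosable_nat (G : sgraph) : choosable 4 2 G ->
  forall l : G -> seq nat, (forall v, good4 (l v)) ->
  exists phi : G -> nat * nat, (forall v, phi v \in opts (l v)) /\
    forall x y, adj x y -> pd (phi x) (phi y).
Proof.
move=> ch l lg; pose N := (\max_v \max_(i <- l v) i).+1.
have ltN v i : i \in l v -> i < N.
  move=> il; rewrite ltnS; apply: leq_trans (leq_bigmax v).
  by rewrite (big_rem i il) /= leq_maxl.
have [|phi [sub card dis]] := ch 'I_N (fun v => [set i | val i \in l v]).
  move=> v; have /andP[/eqP s4 u4] := lg v.
  rewrite -s4 cardE -(size_map val); apply: perm_size; apply: uniq_perm => //.
    by rewrite map_inj_uniq ?enum_uniq //; apply: val_inj.
  move=> i; apply/mapP/idP => [[j]|il]; first by rewrite mem_enum inE => ? ->.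
  by exists (Ordinal (ltN _ _ il)); rewrite // mem_enum inE.
pose has_c v i := [exists c in phi v, val c == i].
have ex v : exists p, (p \in opts (l v)) && (has_c v p.1 && has_c v p.2).
  have /eqP/cards2P[c [d [cd E]]] := card v.
  have hc : has_c v (val c) by apply/existsP; exists c; rewrite E !inE !eqxx.
  have hd : has_c v (val d) by apply/existsP; exists d; rewrite E !inE !eqxx orbT.
  have cl : val c \in l v by have /subsetP/(_ c) := sub v; rewrite E !inE eqxx; apply.
  have dl : val d \in l v.
    by have /subsetP/(_ d) := sub v; rewrite E !inE eqxx orbT; apply.
  have [|po|po] := @isopt_opts (l v) (val c, val d) (lg v).
  - by rewrite /isopt /= cl dl andbT andbT.
  - by exists (val c, val d); rewrite po hc.
  - by exists (val d, val c); rewrite po hc hd.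
exists (fun v => xchoose (ex v)); split=> [v|x y xy].
  by have /andP[] := xchooseP (ex v).
have := xchooseP (ex x); have := xchooseP (ex y).
move: (xchoose (ex x)) (xchoose (ex y)) => p q /= /and3P[_ q1 q2] /and3P[_ p1 p2].
have neq i j : has_c x i -> has_c y j -> i != j.
  case/existsP=> c /andP[cx /eqP<-] /existsP[d /andP[dy /eqP<-]].
  apply/eqP => /val_inj E; move: (dis x y xy); rewrite disjoint_sym.
  by move/pred0P/(_ c); rewrite /= cx E dy.
by rewrite /pd !neq.
Qed.

(* F is a graph on the indices 0, ..., 3 of the colors of a list l; a pair of
   colors of l is treated as the corresponding edge. *)
Definition fam (F : seq (nat * nat)) (l : seq nat) (p : nat * nat) : bool :=
  ((index p.1 l, index p.2 l) \in F) || ((index p.2 l, index p.1 l) \in F).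

(** Reordering [l] by [s] renames the vertices of [F]: the position of a color in the new list is
    the position in [s] of its old index. *)
Lemma fam_perm F l (s : seq nat) p : good4 l -> perm_eq s (iota 0 4) ->
  isopt l p -> fam F [seq nth 0 l i | i <- s] p =
  fam F s (index p.1 l, index p.2 l).
Proof.
move=> /andP[/eqP s4 ul] ps /and3P[_ p1 p2].
suff E a : a \in l -> index a [seq nth 0 l i | i <- s] = index (index a l) s.
  by rewrite /fam /= !E.
move=> al; rewrite -{1}(nth_index 0 al).
have il : index a l < 4 by rewrite -s4 index_mem.
have sub j : j \in s -> j < 4 by rewrite (perm_mem ps) mem_iota.
elim: s sub {ps} => //= j s IH sub.
rewrite nth_uniq ?s4 ?il ?sub ?mem_head //; case: ifP => // _.
by rewrite IH // => k ks; apply: sub; rewrite inE ks orbT.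
Qed.

Lemma good4_perm l (s : seq nat) : good4 l -> perm_eq s (iota 0 4) ->
  good4 [seq nth 0 l i | i <- s] /\ [seq nth 0 l i | i <- s] =i l.
Proof.
move=> /andP[/eqP s4 ul] ps.
have pl : perm_eq [seq nth 0 l i | i <- s] l.
  by rewrite -{2}(mkseq_nth 0 l) s4; apply: perm_map.
split; last exact: perm_mem.
by rewrite /good4 (perm_size pl) s4 eqxx (perm_uniq pl).
Qed.

(** * Gadgets: pieces of the graph with chosen lists *)

Section Gadgets.
Variable G : sgraph.
Implicit Types (vs A : seq G) (bl : G -> seq nat) (phi : G -> nat * nat).

(** Only the internal vertices are stored in [p]: an empty [p] is an edge, and [lk x p x] closes a
    cycle. *)
Definition lk (x : G) p y := path adj x (rcons p y).

(* The vertices in A can be given lists such that every coloring of the graph on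
   vs ++ A satisfies P, which constrains the colors on vs. *)
Definition gad vs A bl (P : (G -> nat * nat) -> Prop) : Prop :=
  exists l : G -> seq nat, (forall x, x \in A -> good4 (l x)) /\
    forall phi, (forall x, x \in A -> phi x \in opts (l x)) ->
      (forall x, x \in vs -> isopt (bl x) (phi x)) ->
      (forall x y, x \in vs ++ A -> y \in vs ++ A -> adj x y ->
         pd (phi x) (phi y)) -> P phi.

(** Disjoint pieces over the same boundary get their lists independently, since each of them uses
    only the edges within its own vertices and the boundary. *)
Lemma gadI vs A1 A2 bl P1 P2 : (forall x, x \in A1 -> x \notin A2) ->
  gad vs A1 bl P1 -> gad vs A2 bl P2 ->
  gad vs (A1 ++ A2) bl (fun phi => P1 phi /\ P2 phi).
Proof.
move=> dis [l1 [g1 H1]] [l2 [g2 H2]].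
exists (fun x => if x \in A1 then l1 x else l2 x); split.
  by move=> x; rewrite mem_cat; case: ifP => [/g1|_ /g2].
move=> phi o i c; split; [apply: H1|apply: H2] => //.
- by move=> x x1; have := o x; rewrite mem_cat x1; apply.
- move=> x y; rewrite !mem_cat => xi yi; apply: c; rewrite !mem_cat.
    by case/orP: xi => ->; rewrite ?orbT.
  by case/orP: yi => ->; rewrite ?orbT.
- move=> x x2; have := o x; rewrite mem_cat x2 orbT => /(_ isT).
  by case: ifP => // /dis; rewrite x2.
move=> x y; rewrite !mem_cat => xi yi; apply: c; rewrite !mem_cat.
  by case/orP: xi => ->; rewrite ?orbT.
by case/orP: yi => ->; rewrite ?orbT.
Qed.

(** A piece may be enlarged because the added vertices can take any list, here [iota 0 4]; the
    boundary lists count only through membership. *)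
Lemma gadW vs vs' A A' bl bl' P P' : {subset vs <= vs'} -> {subset A <= A'} ->
  (forall x, x \in vs -> bl x =i bl' x) ->
  (forall phi, (forall x, x \in vs' -> isopt (bl' x) (phi x)) ->
    P phi -> P' phi) -> gad vs A bl P -> gad vs' A' bl' P'.
Proof.
move=> sv sA eb PP [l [g H]].
exists (fun x => if x \in A then l x else iota 0 4); split.
  by move=> x _; case: ifP => [/g|].
move=> phi o i c; apply: PP => //; apply: H => [x xA|x xv|x y xi yi].
- by have := o _ (sA _ xA); rewrite xA.
- by have := i _ (sv _ xv); rewrite /isopt !eb.
have S z : z \in vs ++ A -> z \in vs' ++ A'.
  by rewrite !mem_cat => /orP[/sv|/sA] ->; rewrite ?orbT.
by apply: c; apply: S.
Qed.

(** Boundary vertices become internal by giving them the lists that [bl] assumed; their pairs then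
    come from [opts], in list order. *)
Lemma gad_hide vs ws A bl P : (forall x, x \in ws -> x \notin A) ->
  (forall x, x \in ws -> good4 (bl x)) ->
  gad (vs ++ ws) A bl P ->
  gad vs (ws ++ A) bl (fun phi => P phi /\ forall x, x \in ws -> phi x \in opts (bl x)).
Proof.
move=> dis gb [l [g H]].
exists (fun x => if x \in ws then bl x else l x); split.
  by move=> x; rewrite mem_cat; case: ifP => [/gb|_ /g].
move=> phi o i c.
have ow x : x \in ws -> phi x \in opts (bl x).
  by move=> xw; have := o x; rewrite mem_cat xw; apply.
split=> //; apply: H => [x xA|x|x y xi yi].
- have := o x; rewrite mem_cat xA orbT => /(_ isT).
  by case: ifP => // /dis; rewrite xA.
- by rewrite mem_cat => /orP[/i//|xw]; apply: opts_isopt; [apply: gb|apply: ow].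
by apply: c; rewrite catA.
Qed.

(** With no boundary left, the lists extend to the whole graph and choosability supplies a coloring.
    An unsatisfiable [P] is therefore a refutation. *)
Lemma gad_choosable A bl P : choosable 4 2 G -> gad [::] A bl P -> exists phi, P phi.
Proof.
move=> /choosable_nat ch [l [g H]].
have [v|phi [o c]] := ch (fun x => if x \in A then l x else iota 0 4).
  by case: ifP => [/g|].
exists phi; apply: H => // [x xA|x y _ _]; last exact: c.
by have := o x; rewrite xA.
Qed.

(* Whatever the list at v, suitable lists on A exclude the pairs in F at v. *)
Definition pend (v : G) A F := forall l0, good4 l0 ->
  gad [:: v] A (fun _ => l0) (fun phi => ~~ fam F l0 (phi v)).

(** Decides that [F'] lies in the copy of [F] obtained by reordering the indices by [s]. *)
Definition famW F F' (s : seq nat) : bool :=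
  perm_eq s (iota 0 4) &&
  all (fun i => all (fun j => fam F' (iota 0 4) (i, j) ==> fam F s (i, j))
    (iota 0 4)) (iota 0 4).

Lemma index4 l a : good4 l -> a \in l -> index a l \in iota 0 4.
Proof. by move=> /andP[/eqP s4 _] al; rewrite mem_iota /= -s4 index_mem. Qed.

Lemma fam_iota F l p : good4 l -> isopt l p ->
  fam F l p = fam F (iota 0 4) (index p.1 l, index p.2 l).
Proof.
move=> gl pl; rewrite -(@fam_perm F l (iota 0 4) p gl) //.
by case/andP: gl => /eqP s4 _; rewrite -{1}(mkseq_nth 0 l) s4.
Qed.

(** [pend] speaks of every list at [v], so the list can be reordered by [s] before the piece is
    used. *)
Lemma pendW v A F F' s : famW F F' s -> pend v A F -> pend v A F'.
Proof.
move=> /andP[ps /allP al] pe l0 g0.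
have [g1 e1] := good4_perm g0 ps.
apply: (gadW _ _ _ _ (pe _ g1)) => // phi i; apply: contra.
have {i}:= i v (mem_head _ _) => pv.
rewrite fam_perm // fam_iota //.
have /and3P[_ p1 p2] := pv.
by move/allP: (al _ (index4 g0 p1)) => /(_ _ (index4 g0 p2)) /implyP.
Qed.

(* The reordering s of F contains the complement of every pair in F. *)
Definition famC F (s : seq nat) : bool :=
  perm_eq s (iota 0 4) &&
  all (fun i => all (fun j => all (fun i' => all (fun j' =>
    [&& i' != j', pd (i, j) (i', j') & fam F (iota 0 4) (i, j)] ==> fam F s (i', j'))
    (iota 0 4)) (iota 0 4)) (iota 0 4)) (iota 0 4).

Lemma pd_index l p q : {subset [:: p.1; p.2; q.1; q.2] <= l} -> pd p q ->
  pd (index p.1 l, index p.2 l) (index q.1 l, index q.2 l).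
Proof.
move=> sub /and4P[a b c d]; apply/and4P=> /=.
have inj x y : x \in l -> y \in l -> x != y -> index x l != index y l.
  by move=> xl yl; apply: contra_neq; apply: (index_inj 0).
by split; apply: inj => //; apply: sub; rewrite !inE eqxx ?orbT.
Qed.

(* Complementation: along an edge whose ends have the same list, the two
   chosen pairs are complementary. *)
Lemma pend_step v w A F s : famC F s -> adj v w -> w \notin A ->
  pend w A F -> pend v (w :: A) F.
Proof.
move=> /andP[ps al] vw wA pe l0 g0.
have [g1 e1] := good4_perm g0 ps.
(* The piece at [w] is applied to [l0] reordered by [s], so that it forbids at [w] the complements
   of the pairs in [F]. *)
have [l [g H]] : gad [:: v; w] A (fun _ => l0)
    (fun phi => ~~ fam F [seq nth 0 l0 i | i <- s] (phi w)).
  apply: (gadW _ _ _ _ (pe _ g1)) => //.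
  by move=> x; rewrite !inE orbC => ->.
exists (fun x => if x == w then l0 else l x); split.
  by move=> x; rewrite inE; case: eqP => //= _ /g.
move=> phi o i c.
have ow : phi w \in opts l0 by have := o w (mem_head _ _); rewrite eqxx.
have iw := opts_isopt g0 ow; have iv := i v (mem_head _ _).
have pvw : pd (phi v) (phi w) by apply: c; rewrite // !inE eqxx ?orbT.
have : ~~ fam F [seq nth 0 l0 i | i <- s] (phi w).
  apply: H => [x xA|x|x y xi yi].
  - have := o x; rewrite inE xA orbT => /(_ isT).
    by case: eqP xA wA => // -> ->.
  - by rewrite !inE => /orP[]/eqP->.
  by apply: c.
apply: contra; rewrite fam_perm // fam_iota // => fv.
have /and3P[_ v1 v2] := iv; have /and3P[w12 w1 w2] := iw.
move/allP: al => /(_ _ (index4 g0 v1)) /allP /(_ _ (index4 g0 v2)).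
move/allP => /(_ _ (index4 g0 w1)) /allP /(_ _ (index4 g0 w2)) /implyP; apply.
rewrite fv andbT pd_index //; last first.
  by move=> x; rewrite !inE => /or4P[]/eqP->.
by rewrite andbT; apply: contra_neq w12; apply: (index_inj 0).
Qed.

Lemma pend_path v c A F s : famC F s -> path adj v c -> uniq (c ++ A) ->
  pend (last v c) A F -> pend v (c ++ A) F.
Proof.
move=> fC; elim: c v => //= w c IH v /andP[vw pc] /andP[wA u] /(IH _ pc u).
exact: (pend_step fC vw wA).
Qed.

(** Summarizes a path by the relation it leaves between the pairs at its ends; the internal vertices
    need no names in the search. *)
Fixpoint okpath (cs : seq (seq nat)) (a b : nat * nat) : bool :=
  if cs is c :: cs' then has (fun q => pd a q && okpath cs' q b) (opts c)
  else pd a b.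

(** Among four colors the only pair disjoint from [b] is its complement, so [a] and [c] agree up to
    order. The order is unknown, which is why the conclusion compares [pd a] with [pd c]. *)
Lemma opts_compl l a b c : good4 l -> isopt l a -> isopt l b -> isopt l c ->
  pd a b -> pd b c -> forall q, pd a q = pd c q.
Proof.
case: a b c => [a1 a2] [b1 b2] [c1 c2] /good4P[x1 [x2 [x3 [x4 [-> U]]]]].
move=> /and3P[/= a12 ia1 ia2] /and3P[/= b12 ib1 ib2] /and3P[/= c12 ic1 ic2] ab bc q.
suff /orP[/andP[/eqP-> /eqP->]//|/andP[/eqP-> /eqP->]] :
   (a1 == c1) && (a2 == c2) || (a1 == c2) && (a2 == c1).
  by rewrite /pd /= andbA [RHS]andbA andbC -!andbA; do 4!bool_congr.
(* The colors of [a] and [b] are four distinct members of a list of four, hence exhaust it. *)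
have sz : size [:: a1; a2; b1; b2] <= size [:: x1; x2; x3; x4] by [].
have ss : {subset [:: a1; a2; b1; b2] <= [:: x1; x2; x3; x4]}.
  by apply/allP; rewrite /= ia1 ia2 ib1 ib2.
have ua : uniq [:: a1; a2; b1; b2].
  by case/and4P: ab => /= A B C D; rewrite /= !inE !negb_or a12 A B C D b12.
have E := uniq_min_size ua ss sz.
have {}E z : z \in [:: x1; x2; x3; x4] -> z \in [:: a1; a2; b1; b2].
  by rewrite E.2.
case/and4P: bc => /= A B C D.
have := E _ ic1; have := E _ ic2; rewrite !inE.
rewrite ![c1 == b1]eq_sym ![c2 == b1]eq_sym ![c1 == b2]eq_sym ![c2 == b2]eq_sym.
rewrite (negPf A) (negPf B) (negPf C) (negPf D) !orbF.
by move=> /orP[]/eqP e2 /orP[]/eqP e1; move: c12; rewrite e1 e2 ?eqxx ?orbT.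
Qed.

End Gadgets.

Lemma okpath_seq ls a qs b : path pd a (rcons qs b) ->
  all2 (fun q l => q \in opts l) qs ls -> okpath ls a b.
Proof.
elim: qs ls a => [|q qs IH] [|l ls] a //=; first by rewrite andbT.
move=> /andP[aq pq] /andP[ql al]; apply/hasP; exists q => //.
by rewrite aq IH.
Qed.

Lemma okpath_eq cs a c b : (forall q, pd a q = pd c q) ->
  okpath cs a b = okpath cs c b.
Proof.
by move=> E; case: cs => [|l cs] /=; [apply: E|apply: eq_has => q; rewrite E].
Qed.

(** After two vertices that repeat the list of the starting vertex the pair is that of the start
    again, so such vertices are removed two at a time. *)
Lemma okpath_fold n l cs a b : good4 l -> isopt l a -> ~~ odd n ->
  okpath (nseq n l ++ cs) a b -> okpath cs a b.
Proof.
move=> gl; have [k] := ubnP n; elim: k n a => // k IH [|[|n]] a //= nk ia.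
rewrite negbK => on /hasP[q ql /andP[aq /hasP[r rl /andP[qr ok]]]].
rewrite (@okpath_eq _ a r); first by apply: IH ok => //; [apply: ltnW|apply: opts_isopt].
exact: opts_compl gl ia (opts_isopt gl ql) (opts_isopt gl rl) aq qr.
Qed.

(** Constraints refer to branch vertices by index. An [econ] is a path, given by its two ends and
    the lists along it; an [mcon] is a pending piece, given by its vertex, an order of the list
    there, and the forbidden family. *)
Definition econ := (nat * nat * seq (seq nat))%type.
Definition mcon := (nat * seq nat * seq (nat * nat))%type.

Definition esat (asg : seq (nat * nat)) (e : econ) : bool :=
  okpath e.2 (nth (0, 0) asg e.1.1) (nth (0, 0) asg e.1.2).

Definition msat (asg : seq (nat * nat)) (m : mcon) : bool :=
  ~~ fam m.2 m.1.2 (nth (0, 0) asg m.1.1).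

(** Backtracking over the branch vertices. A constraint is tested as soon as the last of its
    vertices has a pair, so failing branches are cut early. *)
Fixpoint colorings (es : seq econ) (ms : seq mcon) (bl : seq (seq nat))
    (asg : seq (nat * nat)) : bool :=
  if bl is l :: bl' then
    has (fun p => let asg' := rcons asg p in let k := size asg in
      [&& all (fun e => (maxn e.1.1 e.1.2 == k) ==> esat asg' e) es,
          all (fun m => (m.1.1 == k) ==> msat asg' m) ms & colorings es ms bl' asg'])
      (opts l)
  else true.

(** The search misses no coloring. This direction alone is required: a failed search then excludes
    every coloring. *)
Lemma colorings_sound es ms bl asg asg' :
  (forall e, e \in es -> esat (asg ++ asg') e) ->
  (forall m, m \in ms -> msat (asg ++ asg') m) ->
  all2 (fun p l => p \in opts l) asg' bl -> colorings es ms bl asg.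
Proof.
move=> He Hm; elim: bl asg asg' He Hm => [|l bl IH] asg [|p asg'] //= He Hm.
move=> /andP[pl al]; apply/hasP; exists p => //=.
(* The constraints tested at this stage mention only indices up to [size asg], where the prefix
   agrees with the full assignment. *)
have nthE i : i <= size asg ->
    nth (0, 0) (rcons asg p) i = nth (0, 0) (asg ++ p :: asg') i.
  by move=> ia; rewrite -cat_rcons [RHS]nth_cat size_rcons ltnS ia.
apply/and3P; split; last by apply: (IH _ asg'); rewrite ?cat_rcons.
  apply/allP => e /He; rewrite /esat => H; apply/implyP => /eqP ek.
  by rewrite !nthE // -ek ?leq_maxl ?leq_maxr.
apply/allP => m /Hm; rewrite /msat => H; apply/implyP => /eqP ek.
by rewrite nthE // ek.
Qed.

Definition opts12 (l : seq nat) : seq (nat * nat) :=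
  opts l ++ [seq (p.2, p.1) | p <- opts l].

Lemma isopt_opts12 l p : good4 l -> isopt l p -> p \in opts12 l.
Proof.
move=> gl /(isopt_opts gl)[]; rewrite mem_cat => pl; first by rewrite pl.
by apply/orP; right; apply/mapP; exists (p.2, p.1); rewrite // -surjective_pairing.
Qed.

(* Forbidden families for a list v0, ..., v3, given by index pairs. Seen as
   graphs on the indices they are a path with two edges, a 4-cycle, a path with
   three edges, and the complement of a path with two edges. Each of them is
   isomorphic to its image under complementation of pairs. *)
Definition FC := [:: (0,1); (0,2)].
Definition FQ := [:: (0,2); (0,3); (1,2); (1,3)].
Definition FP := [:: (0,1); (0,3); (1,2)].
Definition F4 := [:: (0,1); (1,2); (1,3); (2,3)].

(** * Patterns made of branch vertices, paths and pending pieces *)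

Section Patterns.
Variable G : sgraph.
Hypothesis G_ch : choosable 4 2 G.

Definition nthf (bs : seq G) (bl : seq (seq nat)) (x : G) := nth [::] bl (index x bs).

(** The surplus vertices are an even number by parity; placed next to [x] with the list of [x], they
    are removed by [okpath_fold]. *)
Lemma edge_gad (x : G) p y cs bl : lk x p y -> uniq p -> y \notin p ->
  size cs <= size p -> odd (size p) = odd (size cs) -> all good4 cs ->
  good4 (bl x) ->
  gad [:: x; y] p bl (fun phi => okpath cs (phi x) (phi y)).
Proof.
move=> xpy up yp sc oc gc gx.
pose ls := nseq (size p - size cs) (bl x) ++ cs.
have sls : size ls = size p by rewrite size_cat size_nseq subnK.
exists (fun z => nth [::] ls (index z p)); split.
  move=> z zp; have zi : index z p < size ls by rewrite sls index_mem.
  have : all good4 ls by rewrite all_cat gc all_nseq gx orbT.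
  by move/all_nthP; apply.
move=> phi o i c.
have ix : isopt (bl x) (phi x) by apply: i; rewrite mem_head.
suff ok : okpath ls (phi x) (phi y).
  by apply: okpath_fold ok; rewrite ?oddB ?oc ?addbb.
apply: (@okpath_seq _ _ (map phi p)).
  rewrite -map_rcons path_map.
  have sub : {subset x :: rcons p y <= [:: x; y] ++ p}.
    by move=> z; rewrite !(inE, mem_rcons, mem_cat) orbA.
  have cc : {in [in [:: x; y] ++ p] &, subrel adj (relpre phi pd)}.
    by move=> u v uS vS; apply: c.
  by apply: (sub_in_path cc _ xpy); apply/allP.
have {}o : forall z, z \in p -> phi z \in opts (nth [::] ls (index z p)) by [].
rewrite all2E size_map sls eqxx /=; apply/(all_nthP ((0,0),[::])) => k.
rewrite size_zip size_map sls minnn => kp.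
rewrite nth_zip ?size_map //= (nth_map x) //.
by have := o _ (mem_nth x kp); rewrite index_uniq.
Qed.

Variable x0 : G.

Definition edge_fits (p : seq G) n := (n <= size p) && (odd (size p) == odd n).

(* A graph made of branch vertices bs with lists bl, of paths between them and of
   pending pieces. A path may be longer than the list cs prescribed for it, since
   two further vertices with equal lists force nothing. *)
Inductive pats (bs : seq G) (bl : seq (seq nat)) :
    seq G -> seq econ -> seq mcon -> Prop :=
| pats_nil : pats bs bl [::] [::] [::]
| pats_edge i j p cs A es ms : [&& i < size bs, j < size bs & all good4 cs] ->
    edge_fits p (size cs) -> lk (nth x0 bs i) p (nth x0 bs j) ->
    pats bs bl A es ms -> pats bs bl (p ++ A) ((i, j, cs) :: es) ms
| pats_mark i l F B A es ms : [&& i < size bs, good4 l & perm_eq l (nth [::] bl i)] ->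
    pend (nth x0 bs i) B F ->
    pats bs bl A es ms -> pats bs bl (B ++ A) es ((i, l, F) :: ms).

Definition all_sat bs (es : seq econ) (ms : seq mcon) (phi : G -> nat * nat) : Prop :=
  (forall e, e \in es -> esat (map phi bs) e) /\
  (forall m, m \in ms -> msat (map phi bs) m).

Lemma uniq_cat3 (bs p A : seq G) : uniq (bs ++ p ++ A) ->
  [/\ uniq (bs ++ A), uniq (bs ++ p), forall x, x \in p -> x \notin A &
      forall x, x \in bs -> x \notin p].
Proof.
move=> U; split.
- by apply: subseq_uniq U; apply: cat_subseq => //; apply: suffix_subseq.
- by apply: subseq_uniq U; apply: cat_subseq => //; apply: prefix_subseq.
- move: U; rewrite catA cat_uniq => /and3P[_ /hasPn H _] x xp.
  by apply: contraL xp => /H; rewrite mem_cat negb_or => /andP[].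
move: U; rewrite cat_uniq => /and3P[_ /hasPn H _] x xb.
by apply: contraL xb => xp; apply: H; rewrite mem_cat xp.
Qed.

Lemma pats_gad bs bl A es ms : pats bs bl A es ms -> uniq (bs ++ A) ->
  size bl = size bs -> all good4 bl ->
  gad bs A (nthf bs bl) (all_sat bs es ms).
Proof.
move=> P U sbl /all_nthP gbl; have ub : uniq bs by move: U; rewrite cat_uniq => /andP[].
have bsE i : i < size bs -> nthf bs bl (nth x0 bs i) = nth [::] bl i.
  by move=> ib; rewrite /nthf index_uniq.
elim: P U => [|i j p cs {}A {}es {}ms /and3P[ib jb gc] /andP[sc /eqP oc] pp _ IH U
    |i l F B {}A {}es {}ms /and3P[ib gl pl] pe _ IH U].
- move=> _; exists (fun _ => iota 0 4); split=> // phi _ _ _; split.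
- have [/IH{}IH up dis dbs] := uniq_cat3 U.
  have : gad bs p (nthf bs bl)
     (fun phi => okpath cs (phi (nth x0 bs i)) (phi (nth x0 bs j))).
    apply: (gadW _ _ _ _ (edge_gad (bl := nthf bs bl) pp _ _ sc oc gc _)) => //.
    + by move=> z; rewrite !inE => /orP[]/eqP->; apply: mem_nth.
    + by move: up; rewrite cat_uniq => /and3P[].
    + by apply: dbs; apply: mem_nth.
    + by rewrite bsE // gbl // sbl.
  move=> /(gadI dis)/(_ IH); apply: gadW => // phi _ [ok [He Hm]]; split=> // e.
  by rewrite inE => /orP[/eqP->|/He//]; rewrite /esat /= !(nth_map x0).
have [/IH{}IH up dis dbs] := uniq_cat3 U.
have : gad bs B (nthf bs bl) (fun phi => ~~ fam F l (phi (nth x0 bs i))).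
  apply: gadW (pe l gl) => //.
  + by move=> z; rewrite !inE => /eqP->; apply: mem_nth.
  + by move=> z; rewrite inE => /eqP-> y; rewrite bsE // (perm_mem pl).
move=> /(gadI dis)/(_ IH); apply: gadW => // phi _ [ok [He Hm]]; split=> // e.
by rewrite inE => /orP[/eqP->|/Hm//]; rewrite /msat /= !(nth_map x0).
Qed.

(** Hiding the branch vertices as well leaves a piece without boundary, whose coloring the search
    would have to find. *)
Lemma pats_false bs bl A es ms : pats bs bl A es ms -> uniq (bs ++ A) ->
  size bl = size bs -> all good4 bl -> ~~ colorings es ms bl [::] -> False.
Proof.
move=> P U sbl gbl; move/negP; apply.
have /and3P[ub /hasPn dis _] : [&& uniq bs, ~~ has [in bs] A & uniq A].
  by rewrite -cat_uniq.
have gb x : x \in bs -> good4 (nthf bs bl x).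
  by move=> xb; move/all_nthP: gbl; apply; rewrite sbl index_mem.
have := pats_gad P U sbl gbl; rewrite -[bs in gad bs]cat0s => H.
have /(gad_choosable G_ch)[phi [[He Hm] o]] := gad_hide (fun x xb => contraL (dis x) xb) gb H.
apply: (@colorings_sound _ _ _ [::] (map phi bs)) => //.
rewrite all2E size_map sbl eqxx; apply/(all_nthP ((0,0),[::])) => k.
rewrite size_zip size_map sbl minnn => kb.
rewrite nth_zip ?size_map //= (nth_map x0) //.
by have := o _ (mem_nth x0 kb); rewrite /nthf index_uniq.
Qed.

(* Renaming colors turns lists that work for the list 0123 at v into lists
   that work for any given list at v. *)
Lemma pend_rename (v : G) A F : v \notin A ->
  gad [:: v] A (fun _ => iota 0 4) (fun phi => ~~ fam F (iota 0 4) (phi v)) ->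
  pend v A F.
Proof.
move=> vA' [l [g H]] l0 g0.
pose m := \max_(i <- l0) i.
have /andP[/eqP s4 u4] := g0.
have ltl n : n \in l0 -> n <= m.
  by move=> nl; rewrite /m (big_rem n nl) /= leq_maxl.
(* The colors 0 to 3 go to [l0]; all others are shifted beyond its maximum [m], so no two colors
   collide, and [t] undoes the renaming. *)
pose r n := if n < 4 then nth 0 l0 n else n + m.
pose t n := if n \in l0 then index n l0 else n - m.
have rK : cancel r t.
  move=> n; rewrite /r /t; case: ltnP => n4; first by rewrite mem_nth ?s4 // index_uniq ?s4.
  case: ifP => [/ltl|]; last by rewrite addnK.
  by rewrite -{2}[m]add0n leq_add2r leqNgt (leq_trans _ n4).
have r_inj := can_inj rK.
have l0E : l0 = map r (iota 0 4).
  by rewrite -[LHS](mkseq_nth 0) s4.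
pose rr p : nat * nat := (r p.1, r p.2).
have oE k : opts (map r k) = map rr (opts k).
  by case: k => [|a [|b [|c [|d [|e k]]]]].
have pdE p q : pd (rr p) (rr q) = pd p q by rewrite /pd /= !(inj_eq r_inj).
exists (map r \o l); split.
  move=> x /g /andP[/eqP sx ux]; rewrite /good4 size_map sx eqxx /=.
  by rewrite map_inj_uniq.
move=> phi o i c.
have inv x : x \in v :: A -> exists p, phi x = rr p /\
    if x \in A then p \in opts (l x) else isopt (iota 0 4) p.
  rewrite inE; case: (boolP (x \in A)) => [xA _|_].
    by have := o x xA; rewrite oE => /mapP[p pl ->]; exists p.
  rewrite orbF => /eqP->; have /and3P[] := i v (mem_head _ _).
  rewrite l0E => pn /mapP[a ai Ea] /mapP[b bi Eb]; exists (a, b).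
  rewrite /rr /= -Ea -Eb -surjective_pairing; split=> //.
  by rewrite /isopt ai bi /= andbT; apply: contra pn => /eqP /= E; rewrite Ea Eb E.
pose psi x := (t (phi x).1, t (phi x).2).
have psiE x : x \in v :: A -> phi x = rr (psi x) /\
    if x \in A then psi x \in opts (l x) else isopt (iota 0 4) (psi x).
  move=> /inv[p [E H0]]; suff -> : psi x = p by [].
  by rewrite /psi E /rr /= !rK -surjective_pairing.
have vA : v \in v :: A by apply: mem_head.
rewrite (psiE v vA).1; suff : ~~ fam F (iota 0 4) (psi v).
  by rewrite /fam /rr /= !(fun a => etrans (congr1 (index (r a)) l0E) (index_map r_inj _ a)).
apply: H => [x xA|x|x y xi yi xy].
- by have [_] := psiE x (mem_behead (s := v :: A) xA); rewrite xA.
- by rewrite inE => /eqP->; have [_] := psiE v vA; rewrite (negPf vA').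
by have := c x y xi yi xy; rewrite (psiE x xi).1 (psiE y yi).1 pdE.
Qed.
(** With the pair of the root fixed the search starts at index 1, so the constraints that involve
    index 0 alone are tested separately. *)
Definition root_colorings es ms bl p :=
  [&& all (fun e : econ => (maxn e.1.1 e.1.2 == 0) ==> esat [:: p] e) es,
      all (fun m : mcon => (m.1.1 == 0) ==> msat [:: p] m) ms & colorings es ms bl [:: p]].

(** A pair is forbidden at the root when it does not extend to the pattern. The pair is an arbitrary
    one at [v], hence both orders are searched, by [opts12]; the root list can be [iota 0 4] thanks
    to [pend_rename]. *)
Lemma pats_pend v bs bl A es ms F :
  pats (v :: bs) (iota 0 4 :: bl) A es ms -> uniq (v :: bs ++ A) ->
  size bl = size bs -> all good4 bl ->
  all (fun p => fam F (iota 0 4) p ==> ~~ root_colorings es ms bl p) (opts12 (iota 0 4)) ->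
  pend v (bs ++ A) F.
Proof.
move=> P U sbl gbl /allP al.
have [vA /and3P[ub /hasPn dis _]] :
    v \notin bs ++ A /\ [&& uniq bs, ~~ has [in bs] A & uniq A].
  by rewrite -cat_uniq; case/andP: U.
apply: pend_rename => //.
have vb : v \notin bs by apply: contra vA; rewrite mem_cat => ->.
have P1 : gad (v :: bs) A (nthf (v :: bs) (iota 0 4 :: bl)) (all_sat (v :: bs) es ms).
  by apply: pats_gad; rewrite //= ?sbl.
have gb x : x \in bs -> good4 (nthf (v :: bs) (iota 0 4 :: bl) x).
  rewrite /nthf => xb; rewrite /= ifN; last by apply: contraNneq vb => ->.
  by move/all_nthP: gbl; apply; rewrite sbl index_mem.
have := gad_hide (vs := [:: v]) (fun x xb => contraL (dis x) xb) gb P1.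
apply: gadW => // [x|phi i [[He Hm] o]].
  by rewrite inE /nthf => /eqP-> /=; rewrite eqxx.
have iv := i v (mem_head _ _).
have := al _ (@isopt_opts12 (iota 0 4) (phi v) isT iv).
rewrite implybN => /implyP; apply; apply/and3P; split.
- apply/allP => -[[i' j'] cs] /He; rewrite /esat /= => H; apply/implyP.
  by rewrite -leqn0 geq_max !leqn0 => /andP[/eqP ei /eqP ej]; move: H; rewrite ei ej.
- apply/allP => -[[i' k] F'] /Hm; rewrite /msat /= => H; apply/implyP => /eqP ei.
  by move: H; rewrite ei.
apply: (@colorings_sound _ _ _ [:: phi v] (map phi bs)) => //.
rewrite all2E size_map sbl eqxx; apply/(all_nthP ((0,0),[::])) => k.
rewrite size_zip size_map sbl minnn => kb.
rewrite nth_zip ?size_map //= (nth_map x0) //.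
have := o _ (mem_nth x0 kb); rewrite /nthf /= ifN ?index_uniq //.
by apply: contraNneq vb => ->; apply: mem_nth.
Qed.
End Patterns.

Arguments pats_edge {G x0 bs bl i j p cs A es ms} & _ _ _ _.
Arguments pats_mark {G x0 bs bl i l F B A es ms} & _ _ _.

(** * The forbidden patterns, with their list assignments *)

Section ForbiddenPatterns.
Variable G : sgraph.
Hypothesis G_ch : choosable 4 2 G.

(* [arc i j cs] forces along a path from the i-th to the j-th branch vertex the
   lists cs; [mark i l] uses the family forbidden at the i-th branch vertex by
   what is pending there, read in the order l of its colors. *)
Local Notation arc i j cs := (pats_edge (i := i) (j := j) (cs := cs) isT).
Local Notation mark i l := (pats_mark (i := i) (l := l) isT).
(** The instance of [colorings] is a closed term, so [//] settles it by evaluation. *)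
Ltac refute P U := by apply: (pats_false G_ch P) => //; rewrite /= ?cats0 in U *.

(** In the names for theta graphs, digits are path lengths, one more than the number of prescribed
    lists. Through [edge_fits] each pattern also covers paths longer by an even amount. *)
Lemma no_theta333 (a b : G) (p1 p2 p3 : seq G) :
  lk a p1 b -> lk a p2 b -> lk a p3 b -> uniq ([:: a; b] ++ p1 ++ p2 ++ p3) ->
  edge_fits p1 2 -> edge_fits p2 2 -> edge_fits p3 2 -> False.
Proof.
move=> l1 l2 l3 U f1 f2 f3.
have P : pats a [:: a; b] [:: [:: 0; 1; 2; 3]; [:: 0; 1; 2; 3]] _ _ _ :=
  (arc 0 1 [:: [:: 1; 2; 3; 4]; [:: 0; 1; 3; 4]] f1 l1
  (arc 0 1 [:: [:: 0; 2; 3; 4]; [:: 1; 2; 3; 4]] f2 l2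
  (arc 0 1 [:: [:: 0; 1; 3; 4]; [:: 0; 2; 3; 4]] f3 l3 (pats_nil _ _ _)))).
refute P U.
Qed.

Lemma no_theta444 (a b : G) (p1 p2 p3 : seq G) :
  lk a p1 b -> lk a p2 b -> lk a p3 b -> uniq ([:: a; b] ++ p1 ++ p2 ++ p3) ->
  edge_fits p1 3 -> edge_fits p2 3 -> edge_fits p3 3 -> False.
Proof.
move=> l1 l2 l3 U f1 f2 f3.
have P : pats a [:: a; b] [:: [:: 0; 1; 2; 3]; [:: 0; 1; 2; 3]] _ _ _ :=
  (arc 0 1 [:: [:: 0; 1; 2; 3]; [:: 0; 1; 3; 4]; [:: 0; 2; 3; 4]] f1 l1
  (arc 0 1 [:: [:: 0; 1; 3; 4]; [:: 0; 1; 2; 4]; [:: 0; 1; 2; 3]] f2 l2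
  (arc 0 1 [:: [:: 0; 1; 2; 4]; [:: 0; 2; 3; 4]; [:: 0; 1; 2; 3]] f3 l3 (pats_nil _ _ _)))).
refute P U.
Qed.

Lemma no_theta2224 (a b : G) (p1 p2 p3 p4 : seq G) :
  lk a p1 b -> lk a p2 b -> lk a p3 b -> lk a p4 b ->
  uniq ([:: a; b] ++ p1 ++ p2 ++ p3 ++ p4) -> edge_fits p1 1 ->
  edge_fits p2 1 -> edge_fits p3 1 -> edge_fits p4 3 -> False.
Proof.
move=> l1 l2 l3 l4 U f1 f2 f3 f4.
have P : pats a [:: a; b] [:: [:: 0; 1; 2; 3]; [:: 2; 3; 4; 5]] _ _ _ :=
  (arc 0 1 [:: [:: 0; 1; 3; 5]] f1 l1
  (arc 0 1 [:: [:: 1; 2; 3; 4]] f2 l2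
  (arc 0 1 [:: [:: 0; 2; 3; 4]] f3 l3
  (arc 0 1 [:: [:: 1; 2; 3; 5]; [:: 0; 1; 3; 5]; [:: 0; 2; 3; 5]] f4 l4 (pats_nil _ _ _))))).
refute P U.
Qed.

(** A W has double links from [a] to [b] and from [a] to [c] and a single link from [b] to [c]. The
    letters are the parities of the lengths of these three links. *)
Lemma no_W_eee (a b c : G) (p1 p2 p3 p4 p5 : seq G) :
  lk a p1 b -> lk a p2 b -> lk a p3 c -> lk a p4 c -> lk b p5 c ->
  uniq ([:: a; b; c] ++ p1 ++ p2 ++ p3 ++ p4 ++ p5) -> edge_fits p1 1 ->
  edge_fits p2 1 -> edge_fits p3 1 -> edge_fits p4 1 -> edge_fits p5 1 -> False.
Proof.
move=> l1 l2 l3 l4 l5 U f1 f2 f3 f4 f5.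
have P : pats a [:: a; b; c]
  [:: [:: 0; 1; 2; 3]; [:: 0; 3; 4; 5]; [:: 1; 2; 4; 5]] _ _ _ :=
  (arc 0 1 [:: [:: 0; 2; 3; 5]] f1 l1
  (arc 0 1 [:: [:: 0; 1; 4; 5]] f2 l2
  (arc 0 2 [:: [:: 0; 2; 4; 5]] f3 l3
  (arc 0 2 [:: [:: 0; 1; 3; 5]] f4 l4
  (arc 1 2 [:: [:: 1; 2; 3; 4]] f5 l5 (pats_nil _ _ _)))))).
refute P U.
Qed.

Lemma no_W_eoo (a b c : G) (p1 p2 p3 p4 p5 : seq G) :
  lk a p1 b -> lk a p2 b -> lk a p3 c -> lk a p4 c -> lk b p5 c ->
  uniq ([:: a; b; c] ++ p1 ++ p2 ++ p3 ++ p4 ++ p5) -> edge_fits p1 1 ->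
  edge_fits p2 1 -> edge_fits p3 0 -> edge_fits p4 2 -> edge_fits p5 0 -> False.
Proof.
move=> l1 l2 l3 l4 l5 U f1 f2 f3 f4 f5.
have P : pats a [:: a; b; c]
  [:: [:: 0; 1; 2; 3]; [:: 0; 3; 4; 5]; [:: 0; 2; 3; 5]] _ _ _ :=
  (arc 0 1 [:: [:: 0; 1; 4; 5]] f1 l1
  (arc 0 1 [:: [:: 0; 2; 3; 4]] f2 l2
  (arc 0 2 [::] f3 l3
  (arc 0 2 [:: [:: 0; 1; 3; 4]; [:: 0; 2; 4; 5]] f4 l4
  (arc 1 2 [::] f5 l5 (pats_nil _ _ _)))))).
refute P U.
Qed.

Lemma no_W_ooe (a b c : G) (p1 p2 p3 p4 p5 : seq G) :
  lk a p1 b -> lk a p2 b -> lk a p3 c -> lk a p4 c -> lk b p5 c ->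
  uniq ([:: a; b; c] ++ p1 ++ p2 ++ p3 ++ p4 ++ p5) -> edge_fits p1 0 ->
  edge_fits p2 2 -> edge_fits p3 0 -> edge_fits p4 2 -> edge_fits p5 1 -> False.
Proof.
move=> l1 l2 l3 l4 l5 U f1 f2 f3 f4 f5.
have P : pats a [:: a; b; c]
  [:: [:: 0; 1; 2; 3]; [:: 1; 2; 3; 4]; [:: 0; 1; 3; 5]] _ _ _ :=
  (arc 0 1 [::] f1 l1
  (arc 0 1 [:: [:: 0; 1; 2; 3]; [:: 0; 1; 3; 4]] f2 l2
  (arc 0 2 [::] f3 l3
  (arc 0 2 [:: [:: 0; 1; 2; 4]; [:: 1; 3; 4; 5]] f4 l4
  (arc 1 2 [:: [:: 1; 2; 4; 5]] f5 l5 (pats_nil _ _ _)))))).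
refute P U.
Qed.

(** A cycle with further cycles hanging at two of its vertices. The digits count the internal
    vertices on the two sides; the sides 1 and 1, of a 4-cycle, are missing because they do
    occur. *)
Lemma no_cycle_FC02 (a b : G) (p1 p2 A1 A2 : seq G) :
  lk a p1 b -> lk a p2 b -> pend a A1 FC -> pend b A2 FC ->
  uniq ([:: a; b] ++ p1 ++ p2 ++ A1 ++ A2) -> edge_fits p1 0 ->
  edge_fits p2 2 -> False.
Proof.
move=> l1 l2 m1 m2 U f1 f2.
have P : pats a [:: a; b] [:: [:: 0; 1; 2; 3]; [:: 0; 1; 2; 3]] _ _ _ :=
  (arc 0 1 [::] f1 l1
  (arc 0 1 [:: [:: 0; 2; 3; 4]; [:: 1; 2; 3; 4]] f2 l2
  (mark 0 [:: 2; 1; 3; 0] m1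
  (mark 1 [:: 2; 0; 3; 1] m2 (pats_nil _ _ _))))).
refute P U.
Qed.

Lemma no_cycle_FC13 (a b : G) (p1 p2 A1 A2 : seq G) :
  lk a p1 b -> lk a p2 b -> pend a A1 FC -> pend b A2 FC ->
  uniq ([:: a; b] ++ p1 ++ p2 ++ A1 ++ A2) -> edge_fits p1 1 ->
  edge_fits p2 3 -> False.
Proof.
move=> l1 l2 m1 m2 U f1 f2.
have P : pats a [:: a; b] [:: [:: 0; 1; 2; 3]; [:: 0; 2; 3; 4]] _ _ _ :=
  (arc 0 1 [:: [:: 0; 2; 3; 4]] f1 l1
  (arc 0 1 [:: [:: 0; 1; 2; 3]; [:: 1; 2; 3; 4]; [:: 0; 1; 3; 4]] f2 l2
  (mark 0 [:: 2; 0; 1; 3] m1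
  (mark 1 [:: 3; 2; 4; 0] m2 (pats_nil _ _ _))))).
refute P U.
Qed.

Lemma no_K25 (a b : G) (p1 p2 p3 p4 p5 : seq G) :
  lk a p1 b -> lk a p2 b -> lk a p3 b -> lk a p4 b -> lk a p5 b ->
  uniq ([:: a; b] ++ p1 ++ p2 ++ p3 ++ p4 ++ p5) -> edge_fits p1 1 ->
  edge_fits p2 1 -> edge_fits p3 1 -> edge_fits p4 1 -> edge_fits p5 1 -> False.
Proof.
move=> l1 l2 l3 l4 l5 U f1 f2 f3 f4 f5.
have P : pats a [:: a; b] [:: [:: 0; 1; 2; 3]; [:: 0; 4; 5; 6]] _ _ _ :=
  (arc 0 1 [:: [:: 0; 3; 5; 6]] f1 l1
  (arc 0 1 [:: [:: 0; 2; 4; 5]] f2 l2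
  (arc 0 1 [:: [:: 0; 2; 4; 6]] f3 l3
  (arc 0 1 [:: [:: 0; 1; 3; 4]] f4 l4
  (arc 0 1 [:: [:: 0; 1; 5; 6]] f5 l5 (pats_nil _ _ _)))))).
refute P U.
Qed.

(** In all subdivisions of the complete graph on [a], [b], [c], [d], the paths [p1] and [p2] are
    opposite, as are [p3], [p6] and [p4], [p5]. *)
Lemma no_K4_222222 (a b c d : G) (p1 p2 p3 p4 p5 p6 : seq G) :
  lk a p1 b -> lk c p2 d -> lk a p3 c -> lk a p4 d -> lk b p5 c -> lk b p6 d ->
  uniq ([:: a; b; c; d] ++ p1 ++ p2 ++ p3 ++ p4 ++ p5 ++ p6) ->
  edge_fits p1 1 -> edge_fits p2 1 -> edge_fits p3 1 -> edge_fits p4 1 ->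
  edge_fits p5 1 -> edge_fits p6 1 -> False.
Proof.
move=> l1 l2 l3 l4 l5 l6 U f1 f2 f3 f4 f5 f6.
have P : pats a [:: a; b; c; d]
  [:: [:: 0; 1; 2; 3]; [:: 0; 1; 3; 4]; [:: 1; 2; 3; 4]; [:: 0; 2; 3; 4]] _ _ _ :=
  (arc 0 1 [:: [:: 0; 1; 3; 4]] f1 l1
  (arc 2 3 [:: [:: 0; 1; 3; 4]] f2 l2
  (arc 0 2 [:: [:: 0; 2; 3; 4]] f3 l3
  (arc 0 3 [:: [:: 0; 2; 3; 4]] f4 l4
  (arc 1 2 [:: [:: 0; 1; 2; 3]] f5 l5
  (arc 1 3 [:: [:: 1; 2; 3; 4]] f6 l6 (pats_nil _ _ _))))))).
refute P U.
Qed.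

(** The shortest member is the cube minus a vertex: [d] has the neighbors [a], [b], [c], which are
    joined pairwise by paths of length 2. *)
Lemma no_K4_cube (a b c d : G) (p1 p2 p3 p4 p5 p6 : seq G) :
  lk a p1 b -> lk c p2 d -> lk a p3 c -> lk a p4 d -> lk b p5 c -> lk b p6 d ->
  uniq ([:: a; b; c; d] ++ p1 ++ p2 ++ p3 ++ p4 ++ p5 ++ p6) ->
  edge_fits p1 1 -> edge_fits p2 0 -> edge_fits p3 1 -> edge_fits p4 0 ->
  edge_fits p5 1 -> edge_fits p6 0 -> False.
Proof.
move=> l1 l2 l3 l4 l5 l6 U f1 f2 f3 f4 f5 f6.
have P : pats a [:: a; b; c; d]
  [:: [:: 0; 1; 2; 3]; [:: 0; 1; 4; 6]; [:: 1; 2; 4; 5]; [:: 0; 1; 2; 4]] _ _ _ :=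
  (arc 0 1 [:: [:: 1; 2; 3; 6]] f1 l1
  (arc 2 3 [::] f2 l2
  (arc 0 2 [:: [:: 1; 3; 4; 5]] f3 l3
  (arc 0 3 [::] f4 l4
  (arc 1 2 [:: [:: 0; 1; 5; 6]] f5 l5
  (arc 1 3 [::] f6 l6 (pats_nil _ _ _))))))).
refute P U.
Qed.

Lemma no_K4_long_side (a b c d : G) (p1 p2 p3 p4 p5 p6 : seq G) :
  lk a p1 b -> lk c p2 d -> lk a p3 c -> lk a p4 d -> lk b p5 c -> lk b p6 d ->
  uniq ([:: a; b; c; d] ++ p1 ++ p2 ++ p3 ++ p4 ++ p5 ++ p6) ->
  edge_fits p1 1 -> edge_fits p2 1 -> edge_fits p3 2 -> edge_fits p4 0 ->
  edge_fits p5 0 -> edge_fits p6 0 -> False.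
Proof.
move=> l1 l2 l3 l4 l5 l6 U f1 f2 f3 f4 f5 f6.
have P : pats a [:: a; b; c; d]
  [:: [:: 0; 1; 2; 3]; [:: 0; 1; 3; 4]; [:: 0; 1; 2; 3]; [:: 0; 1; 3; 4]] _ _ _ :=
  (arc 0 1 [:: [:: 0; 1; 2; 4]] f1 l1
  (arc 2 3 [:: [:: 1; 2; 3; 4]] f2 l2
  (arc 0 2 [:: [:: 1; 2; 3; 4]; [:: 0; 1; 2; 4]] f3 l3
  (arc 0 3 [::] f4 l4
  (arc 1 2 [::] f5 l5
  (arc 1 3 [::] f6 l6 (pats_nil _ _ _))))))).
refute P U.
Qed.

(** An N is a cycle through [a], [b], [c], [d] in which the links [ab] and [cd] are doubled. The
    letters are the parities of the doubled links, the digit the length of the two single ones. *)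
Lemma no_N_ee1 (a b c d : G) (p1 p2 p3 p4 p5 p6 : seq G) :
  lk a p1 b -> lk a p2 b -> lk c p3 d -> lk c p4 d -> lk b p5 c -> lk d p6 a ->
  uniq ([:: a; b; c; d] ++ p1 ++ p2 ++ p3 ++ p4 ++ p5 ++ p6) ->
  edge_fits p1 1 -> edge_fits p2 1 -> edge_fits p3 1 -> edge_fits p4 1 ->
  edge_fits p5 0 -> edge_fits p6 0 -> False.
Proof.
move=> l1 l2 l3 l4 l5 l6 U f1 f2 f3 f4 f5 f6.
have P : pats a [:: a; b; c; d]
  [:: [:: 0; 1; 2; 3]; [:: 0; 2; 3; 4]; [:: 0; 1; 2; 3]; [:: 0; 2; 3; 4]] _ _ _ :=
  (arc 0 1 [:: [:: 1; 2; 3; 4]] f1 l1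
  (arc 0 1 [:: [:: 0; 1; 2; 4]] f2 l2
  (arc 2 3 [:: [:: 0; 1; 2; 4]] f3 l3
  (arc 2 3 [:: [:: 1; 2; 3; 4]] f4 l4
  (arc 1 2 [::] f5 l5
  (arc 3 0 [::] f6 l6 (pats_nil _ _ _))))))).
refute P U.
Qed.

Lemma no_N_ee2 (a b c d : G) (p1 p2 p3 p4 p5 p6 : seq G) :
  lk a p1 b -> lk a p2 b -> lk c p3 d -> lk c p4 d -> lk b p5 c -> lk d p6 a ->
  uniq ([:: a; b; c; d] ++ p1 ++ p2 ++ p3 ++ p4 ++ p5 ++ p6) ->
  edge_fits p1 1 -> edge_fits p2 1 -> edge_fits p3 1 -> edge_fits p4 1 ->
  edge_fits p5 1 -> edge_fits p6 1 -> False.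
Proof.
move=> l1 l2 l3 l4 l5 l6 U f1 f2 f3 f4 f5 f6.
have P : pats a [:: a; b; c; d]
  [:: [:: 0; 1; 2; 3]; [:: 1; 2; 4; 5]; [:: 0; 3; 4; 5]; [:: 0; 1; 2; 3]] _ _ _ :=
  (arc 0 1 [:: [:: 0; 1; 2; 4]] f1 l1
  (arc 0 1 [:: [:: 2; 3; 4; 5]] f2 l2
  (arc 2 3 [:: [:: 1; 2; 3; 4]] f3 l3
  (arc 2 3 [:: [:: 0; 2; 4; 5]] f4 l4
  (arc 1 2 [:: [:: 0; 1; 3; 5]] f5 l5
  (arc 3 0 [:: [:: 0; 1; 2; 3]] f6 l6 (pats_nil _ _ _))))))).
refute P U.
Qed.

Lemma no_N_eo (a b c d : G) (p1 p2 p3 p4 p5 p6 : seq G) :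
  lk a p1 b -> lk a p2 b -> lk c p3 d -> lk c p4 d -> lk b p5 c -> lk d p6 a ->
  uniq ([:: a; b; c; d] ++ p1 ++ p2 ++ p3 ++ p4 ++ p5 ++ p6) ->
  edge_fits p1 1 -> edge_fits p2 1 -> edge_fits p3 0 -> edge_fits p4 2 ->
  edge_fits p5 0 -> edge_fits p6 1 -> False.
Proof.
move=> l1 l2 l3 l4 l5 l6 U f1 f2 f3 f4 f5 f6.
have P : pats a [:: a; b; c; d]
  [:: [:: 0; 1; 2; 3]; [:: 1; 3; 4; 5]; [:: 0; 1; 3; 4]; [:: 0; 2; 3; 4]] _ _ _ :=
  (arc 0 1 [:: [:: 0; 1; 3; 5]] f1 l1
  (arc 0 1 [:: [:: 1; 2; 4; 5]] f2 l2
  (arc 2 3 [::] f3 l3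
  (arc 2 3 [:: [:: 0; 1; 4; 5]; [:: 2; 3; 4; 5]] f4 l4
  (arc 1 2 [::] f5 l5
  (arc 3 0 [:: [:: 0; 2; 3; 4]] f6 l6 (pats_nil _ _ _))))))).
refute P U.
Qed.

Lemma no_N_oo1 (a b c d : G) (p1 p2 p3 p4 p5 p6 : seq G) :
  lk a p1 b -> lk a p2 b -> lk c p3 d -> lk c p4 d -> lk b p5 c -> lk d p6 a ->
  uniq ([:: a; b; c; d] ++ p1 ++ p2 ++ p3 ++ p4 ++ p5 ++ p6) ->
  edge_fits p1 0 -> edge_fits p2 2 -> edge_fits p3 0 -> edge_fits p4 2 ->
  edge_fits p5 0 -> edge_fits p6 0 -> False.
Proof.
move=> l1 l2 l3 l4 l5 l6 U f1 f2 f3 f4 f5 f6.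
have P : pats a [:: a; b; c; d]
  [:: [:: 0; 1; 2; 3]; [:: 1; 2; 3; 5]; [:: 0; 1; 4; 5]; [:: 0; 1; 2; 4]] _ _ _ :=
  (arc 0 1 [::] f1 l1
  (arc 0 1 [:: [:: 0; 1; 3; 4]; [:: 1; 2; 4; 5]] f2 l2
  (arc 2 3 [::] f3 l3
  (arc 2 3 [:: [:: 0; 1; 3; 5]; [:: 1; 2; 3; 4]] f4 l4
  (arc 1 2 [::] f5 l5
  (arc 3 0 [::] f6 l6 (pats_nil _ _ _))))))).
refute P U.
Qed.

Lemma no_N_oo2 (a b c d : G) (p1 p2 p3 p4 p5 p6 : seq G) :
  lk a p1 b -> lk a p2 b -> lk c p3 d -> lk c p4 d -> lk b p5 c -> lk d p6 a ->
  uniq ([:: a; b; c; d] ++ p1 ++ p2 ++ p3 ++ p4 ++ p5 ++ p6) ->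
  edge_fits p1 0 -> edge_fits p2 2 -> edge_fits p3 0 -> edge_fits p4 2 ->
  edge_fits p5 1 -> edge_fits p6 1 -> False.
Proof.
move=> l1 l2 l3 l4 l5 l6 U f1 f2 f3 f4 f5 f6.
have P : pats a [:: a; b; c; d]
  [:: [:: 0; 1; 2; 3]; [:: 0; 1; 2; 3]; [:: 1; 2; 3; 4]; [:: 1; 2; 3; 4]] _ _ _ :=
  (arc 0 1 [::] f1 l1
  (arc 0 1 [:: [:: 0; 1; 2; 4]; [:: 0; 2; 3; 4]] f2 l2
  (arc 2 3 [::] f3 l3
  (arc 2 3 [:: [:: 0; 2; 3; 4]; [:: 0; 1; 2; 4]] f4 l4
  (arc 1 2 [:: [:: 0; 1; 2; 4]] f5 l5
  (arc 3 0 [:: [:: 0; 2; 3; 4]] f6 l6 (pats_nil _ _ _))))))).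
refute P U.
Qed.

Lemma no_K4_two_long (a b c d : G) (p1 p2 p3 p4 p5 p6 : seq G) :
  lk a p1 b -> lk c p2 d -> lk a p3 c -> lk a p4 d -> lk b p5 c -> lk b p6 d ->
  uniq ([:: a; b; c; d] ++ p1 ++ p2 ++ p3 ++ p4 ++ p5 ++ p6) ->
  edge_fits p1 3 -> edge_fits p2 3 -> edge_fits p3 0 -> edge_fits p4 0 ->
  edge_fits p5 0 -> edge_fits p6 0 -> False.
Proof.
move=> l1 l2 l3 l4 l5 l6 U f1 f2 f3 f4 f5 f6.
have P : pats a [:: a; b; c; d]
  [:: [:: 0; 1; 2; 3]; [:: 0; 1; 3; 4]; [:: 0; 2; 3; 4]; [:: 0; 1; 3; 4]] _ _ _ :=
  (arc 0 1 [:: [:: 0; 1; 2; 3]; [:: 0; 2; 3; 4]; [:: 0; 1; 2; 4]] f1 l1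
  (arc 2 3 [:: [:: 0; 2; 3; 4]; [:: 0; 1; 2; 3]; [:: 0; 1; 2; 4]] f2 l2
  (arc 0 2 [::] f3 l3
  (arc 0 3 [::] f4 l4
  (arc 1 2 [::] f5 l5
  (arc 1 3 [::] f6 l6 (pats_nil _ _ _))))))).
refute P U.
Qed.

(** The first six paths form at their shortest the graph K_{3,3} minus an edge; the seventh doubles
    one of the two links of length 2. *)
Lemma no_K4_doubled (a b c d : G) (p1 p2 p3 p4 p5 p6 p7 : seq G) :
  lk a p1 b -> lk c p2 d -> lk a p3 c -> lk a p4 d -> lk b p5 c -> lk b p6 d ->
  lk a p7 b ->
  uniq ([:: a; b; c; d] ++ p1 ++ p2 ++ p3 ++ p4 ++ p5 ++ p6 ++ p7) ->
  edge_fits p1 1 -> edge_fits p2 1 -> edge_fits p3 0 -> edge_fits p4 0 ->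
  edge_fits p5 0 -> edge_fits p6 0 -> edge_fits p7 1 -> False.
Proof.
move=> l1 l2 l3 l4 l5 l6 l7 U f1 f2 f3 f4 f5 f6 f7.
have P : pats a [:: a; b; c; d]
  [:: [:: 0; 1; 2; 3]; [:: 1; 2; 4; 5]; [:: 1; 2; 3; 5]; [:: 0; 1; 2; 4]] _ _ _ :=
  (arc 0 1 [:: [:: 1; 2; 3; 4]] f1 l1
  (arc 2 3 [:: [:: 1; 3; 4; 5]] f2 l2
  (arc 0 2 [::] f3 l3
  (arc 0 3 [::] f4 l4
  (arc 1 2 [::] f5 l5
  (arc 1 3 [::] f6 l6
  (arc 0 1 [:: [:: 0; 1; 3; 5]] f7 l7 (pats_nil _ _ _)))))))).
refute P U.
Qed.

Lemma no_K33 (a b c d e f : G) (p1 p2 p3 p4 p5 p6 p7 p8 p9 : seq G) :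
  lk a p1 d -> lk a p2 e -> lk a p3 f -> lk b p4 d -> lk b p5 e -> lk b p6 f ->
  lk c p7 d -> lk c p8 e -> lk c p9 f ->
  uniq ([:: a; b; c; d; e; f] ++ p1 ++ p2 ++ p3 ++ p4 ++ p5 ++ p6 ++ p7 ++ p8 ++ p9) ->
  edge_fits p1 0 -> edge_fits p2 0 -> edge_fits p3 0 -> edge_fits p4 0 ->
  edge_fits p5 0 -> edge_fits p6 0 -> edge_fits p7 0 -> edge_fits p8 0 ->
  edge_fits p9 0 -> False.
Proof.
move=> l1 l2 l3 l4 l5 l6 l7 l8 l9 U f1 f2 f3 f4 f5 f6 f7 f8 f9.
have P : pats a [:: a; b; c; d; e; f]
  [:: [:: 0; 1; 2; 3]; [:: 0; 1; 4; 5]; [:: 1; 2; 4; 5]; [:: 1; 3; 4; 5]; [:: 0; 1; 2; 4]; [:: 0; 1; 2; 5]] _ _ _ :=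
  (arc 0 3 [::] f1 l1
  (arc 0 4 [::] f2 l2
  (arc 0 5 [::] f3 l3
  (arc 1 3 [::] f4 l4
  (arc 1 4 [::] f5 l5
  (arc 1 5 [::] f6 l6
  (arc 2 3 [::] f7 l7
  (arc 2 4 [::] f8 l8
  (arc 2 5 [::] f9 l9 (pats_nil _ _ _)))))))))).
refute P U.
Qed.

(** The suffix in this group tells where the further cycle hangs: at an end, inside a short path, or
    inside the long path, at its middle ([mid]) or at odd distance from both ends ([long]). *)
Lemma no_theta224_FC_end (a b : G) (p1 p2 p3 A1 : seq G) :
  lk a p1 b -> lk a p2 b -> lk a p3 b -> pend a A1 FC ->
  uniq ([:: a; b] ++ p1 ++ p2 ++ p3 ++ A1) -> edge_fits p1 1 ->
  edge_fits p2 1 -> edge_fits p3 3 -> False.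
Proof.
move=> l1 l2 l3 m1 U f1 f2 f3.
have P : pats a [:: a; b] [:: [:: 0; 1; 2; 3]; [:: 0; 1; 2; 4]] _ _ _ :=
  (arc 0 1 [:: [:: 0; 1; 2; 3]] f1 l1
  (arc 0 1 [:: [:: 0; 2; 3; 4]] f2 l2
  (arc 0 1 [:: [:: 1; 2; 3; 4]; [:: 0; 2; 3; 4]; [:: 0; 1; 2; 4]] f3 l3
  (mark 0 [:: 0; 1; 2; 3] m1 (pats_nil _ _ _))))).
refute P U.
Qed.

Lemma no_theta224_FC_short (a b c : G) (p1 p2 p3 p4 A1 : seq G) :
  lk a p1 b -> lk a p2 c -> lk b p3 c -> lk b p4 c -> pend a A1 FC ->
  uniq ([:: a; b; c] ++ p1 ++ p2 ++ p3 ++ p4 ++ A1) -> edge_fits p1 0 ->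
  edge_fits p2 0 -> edge_fits p3 1 -> edge_fits p4 3 -> False.
Proof.
move=> l1 l2 l3 l4 m1 U f1 f2 f3 f4.
have P : pats a [:: a; b; c]
  [:: [:: 0; 1; 2; 3]; [:: 0; 1; 2; 4]; [:: 0; 1; 2; 3]] _ _ _ :=
  (arc 0 1 [::] f1 l1
  (arc 0 2 [::] f2 l2
  (arc 1 2 [:: [:: 0; 1; 3; 4]] f3 l3
  (arc 1 2 [:: [:: 0; 1; 2; 4]; [:: 0; 1; 3; 4]; [:: 1; 2; 3; 4]] f4 l4
  (mark 0 [:: 3; 1; 2; 0] m1 (pats_nil _ _ _)))))).
refute P U.
Qed.

Lemma no_theta224_FC_mid (a b c : G) (p1 p2 p3 p4 A1 : seq G) :
  lk a p1 b -> lk a p2 c -> lk b p3 c -> lk b p4 c -> pend a A1 FC ->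
  uniq ([:: a; b; c] ++ p1 ++ p2 ++ p3 ++ p4 ++ A1) -> edge_fits p1 1 ->
  edge_fits p2 1 -> edge_fits p3 1 -> edge_fits p4 1 -> False.
Proof.
move=> l1 l2 l3 l4 m1 U f1 f2 f3 f4.
have P : pats a [:: a; b; c]
  [:: [:: 0; 1; 2; 3]; [:: 0; 2; 4; 5]; [:: 1; 3; 4; 5]] _ _ _ :=
  (arc 0 1 [:: [:: 0; 1; 2; 5]] f1 l1
  (arc 0 2 [:: [:: 0; 1; 3; 4]] f2 l2
  (arc 1 2 [:: [:: 0; 3; 4; 5]] f3 l3
  (arc 1 2 [:: [:: 1; 2; 4; 5]] f4 l4
  (mark 0 [:: 3; 0; 2; 1] m1 (pats_nil _ _ _)))))).
refute P U.
Qed.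

Lemma no_theta224_FC_long (a b c : G) (p1 p2 p3 p4 A1 : seq G) :
  lk a p1 b -> lk a p2 c -> lk b p3 c -> lk b p4 c -> pend a A1 FC ->
  uniq ([:: a; b; c] ++ p1 ++ p2 ++ p3 ++ p4 ++ A1) -> edge_fits p1 0 ->
  edge_fits p2 2 -> edge_fits p3 1 -> edge_fits p4 1 -> False.
Proof.
move=> l1 l2 l3 l4 m1 U f1 f2 f3 f4.
have P : pats a [:: a; b; c]
  [:: [:: 0; 1; 2; 3]; [:: 0; 1; 2; 4]; [:: 0; 1; 2; 3]] _ _ _ :=
  (arc 0 1 [::] f1 l1
  (arc 0 2 [:: [:: 0; 2; 3; 4]; [:: 0; 1; 3; 4]] f2 l2
  (arc 1 2 [:: [:: 0; 1; 2; 4]] f3 l3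
  (arc 1 2 [:: [:: 0; 2; 3; 4]] f4 l4
  (mark 0 [:: 3; 0; 1; 2] m1 (pats_nil _ _ _)))))).
refute P U.
Qed.

Lemma no_theta133_FC_end (a b : G) (p1 p2 p3 A1 : seq G) :
  lk a p1 b -> lk a p2 b -> lk a p3 b -> pend a A1 FC ->
  uniq ([:: a; b] ++ p1 ++ p2 ++ p3 ++ A1) -> edge_fits p1 0 ->
  edge_fits p2 2 -> edge_fits p3 2 -> False.
Proof.
move=> l1 l2 l3 m1 U f1 f2 f3.
have P : pats a [:: a; b] [:: [:: 0; 1; 2; 3]; [:: 0; 1; 2; 3]] _ _ _ :=
  (arc 0 1 [::] f1 l1
  (arc 0 1 [:: [:: 1; 2; 3; 4]; [:: 0; 2; 3; 4]] f2 l2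
  (arc 0 1 [:: [:: 0; 2; 3; 4]; [:: 0; 1; 2; 4]] f3 l3
  (mark 0 [:: 0; 1; 2; 3] m1 (pats_nil _ _ _))))).
refute P U.
Qed.

Lemma no_theta133_FC_inner (a b c : G) (p1 p2 p3 p4 A1 : seq G) :
  lk a p1 b -> lk a p2 c -> lk b p3 c -> lk b p4 c -> pend a A1 FC ->
  uniq ([:: a; b; c] ++ p1 ++ p2 ++ p3 ++ p4 ++ A1) -> edge_fits p1 0 ->
  edge_fits p2 1 -> edge_fits p3 0 -> edge_fits p4 2 -> False.
Proof.
move=> l1 l2 l3 l4 m1 U f1 f2 f3 f4.
have P : pats a [:: a; b; c]
  [:: [:: 0; 1; 2; 3]; [:: 0; 1; 2; 3]; [:: 0; 1; 3; 4]] _ _ _ :=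
  (arc 0 1 [::] f1 l1
  (arc 0 2 [:: [:: 1; 2; 3; 4]] f2 l2
  (arc 1 2 [::] f3 l3
  (arc 1 2 [:: [:: 1; 2; 3; 5]; [:: 0; 3; 4; 5]] f4 l4
  (mark 0 [:: 1; 0; 3; 2] m1 (pats_nil _ _ _)))))).
refute P U.
Qed.

Lemma no_theta222_FC_ends (a b : G) (p1 p2 p3 A1 A2 : seq G) :
  lk a p1 b -> lk a p2 b -> lk a p3 b -> pend a A1 FC -> pend b A2 FC ->
  uniq ([:: a; b] ++ p1 ++ p2 ++ p3 ++ A1 ++ A2) -> edge_fits p1 1 ->
  edge_fits p2 1 -> edge_fits p3 1 -> False.
Proof.
move=> l1 l2 l3 m1 m2 U f1 f2 f3.
have P : pats a [:: a; b] [:: [:: 0; 1; 2; 3]; [:: 0; 1; 3; 4]] _ _ _ :=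
  (arc 0 1 [:: [:: 0; 1; 2; 3]] f1 l1
  (arc 0 1 [:: [:: 0; 1; 2; 4]] f2 l2
  (arc 0 1 [:: [:: 0; 2; 3; 4]] f3 l3
  (mark 0 [:: 1; 0; 3; 2] m1
  (mark 1 [:: 0; 1; 3; 4] m2 (pats_nil _ _ _)))))).
refute P U.
Qed.

Lemma no_theta222_FC_mids (a b c d : G) (p1 p2 p3 p4 p5 A1 A2 : seq G) :
  lk a p1 c -> lk a p2 d -> lk b p3 c -> lk b p4 d -> lk c p5 d ->
  pend a A1 FC -> pend b A2 FC ->
  uniq ([:: a; b; c; d] ++ p1 ++ p2 ++ p3 ++ p4 ++ p5 ++ A1 ++ A2) ->
  edge_fits p1 0 -> edge_fits p2 0 -> edge_fits p3 0 -> edge_fits p4 0 ->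
  edge_fits p5 1 -> False.
Proof.
move=> l1 l2 l3 l4 l5 m1 m2 U f1 f2 f3 f4 f5.
have P : pats a [:: a; b; c; d]
  [:: [:: 0; 1; 2; 3]; [:: 0; 1; 3; 4]; [:: 1; 2; 3; 4]; [:: 0; 1; 2; 3]] _ _ _ :=
  (arc 0 2 [::] f1 l1
  (arc 0 3 [::] f2 l2
  (arc 1 2 [::] f3 l3
  (arc 1 3 [::] f4 l4
  (arc 2 3 [:: [:: 0; 2; 3; 4]] f5 l5
  (mark 0 [:: 0; 1; 3; 2] m1
  (mark 1 [:: 0; 3; 4; 1] m2 (pats_nil _ _ _)))))))).
refute P U.
Qed.

Lemma no_K24_FC_2side (a b : G) (p1 p2 p3 p4 A1 : seq G) :
  lk a p1 b -> lk a p2 b -> lk a p3 b -> lk a p4 b -> pend a A1 FC ->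
  uniq ([:: a; b] ++ p1 ++ p2 ++ p3 ++ p4 ++ A1) -> edge_fits p1 1 ->
  edge_fits p2 1 -> edge_fits p3 1 -> edge_fits p4 1 -> False.
Proof.
move=> l1 l2 l3 l4 m1 U f1 f2 f3 f4.
have P : pats a [:: a; b] [:: [:: 0; 1; 2; 3]; [:: 0; 2; 4; 5]] _ _ _ :=
  (arc 0 1 [:: [:: 0; 1; 4; 5]] f1 l1
  (arc 0 1 [:: [:: 2; 3; 4; 5]] f2 l2
  (arc 0 1 [:: [:: 1; 2; 4; 5]] f3 l3
  (arc 0 1 [:: [:: 0; 1; 2; 3]] f4 l4
  (mark 0 [:: 0; 2; 3; 1] m1 (pats_nil _ _ _)))))).
refute P U.
Qed.

Lemma no_K24_FC_4side (a b c : G) (p1 p2 p3 p4 p5 A1 : seq G) :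
  lk a p1 b -> lk a p2 c -> lk b p3 c -> lk b p4 c -> lk b p5 c ->
  pend a A1 FC -> uniq ([:: a; b; c] ++ p1 ++ p2 ++ p3 ++ p4 ++ p5 ++ A1) ->
  edge_fits p1 0 -> edge_fits p2 0 -> edge_fits p3 1 -> edge_fits p4 1 ->
  edge_fits p5 1 -> False.
Proof.
move=> l1 l2 l3 l4 l5 m1 U f1 f2 f3 f4 f5.
have P : pats a [:: a; b; c]
  [:: [:: 0; 1; 2; 3]; [:: 0; 2; 3; 4]; [:: 1; 2; 3; 5]] _ _ _ :=
  (arc 0 1 [::] f1 l1
  (arc 0 2 [::] f2 l2
  (arc 1 2 [:: [:: 1; 3; 4; 5]] f3 l3
  (arc 1 2 [:: [:: 0; 2; 4; 5]] f4 l4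
  (arc 1 2 [:: [:: 0; 1; 3; 5]] f5 l5
  (mark 0 [:: 0; 1; 3; 2] m1 (pats_nil _ _ _))))))).
refute P U.
Qed.
End ForbiddenPatterns.

Lemma choosable_bipartite (G : sgraph) : choosable 4 2 G ->
  exists col : G -> bool, forall x y, adj x y -> col x != col y.
Proof.
move=> /choosable_nat/(_ (fun _ => iota 0 4))[//|phi [o c]].
(* Ends of an edge have complementary pairs, so exactly one of them contains the color 0; by the
   order used in [opts] it is then the first component. *)
exists (fun x => (phi x).1 == 0) => x y /c.
have := o x; have := o y; rewrite !inE.
by do 5?[case/orP]; move=> /eqP->; do 5?[case/orP]; move=> /eqP->.
Qed.


(** * Duplicate-freeness by multiplicities *)

Section Sequences.
Variable T : eqType.
Implicit Types (s : seq T).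

Lemma uniq_count s : (forall a, count_mem a s <= 1) -> uniq s.
Proof.
elim: s => //= x s IH le; rewrite IH ?andbT => [|a].
  by rewrite -has_pred1 has_count; have := le x; rewrite eqxx; case: count.
by have := le a; apply: leq_trans; apply: leq_addl.
Qed.

(** The basis of [ucnt]: rearranging, reversing and dropping vertices all become linear inequalities
    between multiplicities. *)
Lemma uniq_le s1 s2 : uniq s2 ->
  (forall a, count_mem a s1 <= count_mem a s2) -> uniq s1.
Proof.
move=> u2 le; apply: uniq_count => a; apply: leq_trans (le a) _.
by rewrite count_uniq_mem //; case: (_ \in _).
Qed.

Lemma count_rcons s x a : count_mem a (rcons s x) = count_mem a s + (x == a).
Proof. by rewrite -cats1 count_cat /= addn0. Qed.

Lemma count_belast s x a :
  count_mem a (belast x s) + (last x s == a) = (x == a) + count_mem a s.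
Proof. by rewrite -count_rcons -lastI. Qed.

Lemma subset_count (s1 s2 : seq T) :
  (forall a, count_mem a s1 <= count_mem a s2) -> {subset s1 <= s2}.
Proof.
move=> le a; rewrite -!has_pred1 !has_count => h; exact: leq_trans h (le a).
Qed.

Lemma count1_mem x s : (x \in s) = (0 < count_mem x s).
Proof. by rewrite -has_count has_pred1. Qed.
End Sequences.

Definition cntE := (count_cat, count_rev, count_rcons).

(** Multiplicities are generalized to natural number variables before [lia] is called. *)
Ltac cnt := rewrite /=; do ?rewrite cntE /=;
  repeat match goal with
  | |- context [nat_of_bool ?b] => move: (nat_of_bool b)
  | |- context [count ?a ?s] => move: (count a s)
  end; clear; intros; lia.
Ltac ucnt U := rewrite -?cons_uniq; apply: (uniq_le U) => ?; cnt.
Ltac scnt := apply: subset_count => ?; cnt.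

(* The sizes are generalized because they may occur with convertible but not
   identical type arguments, which lia does not identify. *)
Ltac slia := rewrite /edge_fits /=; do ?rewrite (size_rev, size_cat, size_rcons) /=;
  repeat match goal with
  | H : is_true (lk _ _ _) |- _ => clear H
  | H : is_true (uniq _) |- _ => clear H
  | H : pend _ _ _ |- _ => clear H
  end;
  repeat match goal with H : context [@size _ _] |- _ => revert H end;
  repeat match goal with |- context [@size _ ?p] => move: (size p) => ? end;
  intros; lia.

(** * Paths, lollipops, and the pairs they forbid *)

Section Links.
Variable G : sgraph.
Implicit Types (x y z : G) (p q c d A : seq G).

Lemma lk_cat x p z q y : lk x (p ++ z :: q) y = lk x p z && lk z q y.
Proof.
by rewrite /lk rcons_cat cat_path /= [path adj x (rcons p z)]rcons_path andbA.
Qed.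

Lemma lk_last x p y : lk x p y = path adj x p && adj (last x p) y.
Proof. by rewrite /lk rcons_path. Qed.

Lemma lk_path_cat x c p y : lk x (c ++ p) y = path adj x c && lk (last x c) p y.
Proof. by rewrite /lk rcons_cat cat_path. Qed.

Lemma lk_nil x y : lk x [::] y = adj x y.
Proof. by rewrite /lk /= andbT. Qed.

Lemma lk_rev x p y : lk x p y = lk y (rev p) x.
Proof.
rewrite /lk -rev_cons -[y in RHS](last_rcons x p y) -[x :: p](belast_rcons x p y).
by rewrite rev_path; apply: eq_path => u v; apply: adj_sym.
Qed.

Lemma rev_conn v c : path adj v c ->
  path adj (last v c) (rev (belast v c)) /\ last (last v c) (rev (belast v c)) = v.
Proof.
split; first by rewrite rev_path (eq_path (e' := adj)) // => u w; apply: adj_sym.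
by case: c {H} => //= a c; rewrite rev_cons last_rcons.
Qed.

(* A lollipop: a path from v, possibly trivial, that ends on a cycle. *)
Definition lol v c d :=
  [/\ path adj v c, lk (last v c) d (last v c), 1 < size d & uniq (v :: c ++ d)].

Lemma lol_reach v c d e : lol v c d -> e \in c ++ d -> exists k r,
  [/\ lk v k e, uniq (v :: rcons k e) & perm_eq (c ++ d) (k ++ e :: r)].
Proof.
case=> pc ld sd u; rewrite mem_cat => /orP[]ein; case/splitPr: ein pc ld u => [c1 c2] + + u.
  rewrite cat_path /= => /and3P[p1 p2 _] _.
  exists c1, (c2 ++ d); rewrite lk_last p1 p2; split=> //; last by rewrite -catA.
  by ucnt u.
rewrite lk_cat => pc /andP[l1 _].
exists (c ++ c1), c2; rewrite lk_path_cat pc l1; split=> //; last by rewrite -catA.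
by ucnt u.
Qed.

Lemma pend_sub v A A' F : {subset A <= A'} -> pend v A F -> pend v A' F.
Proof. by move=> sA pe l0 g0; apply: gadW (pe l0 g0). Qed.

End Links.

Section Bipartite.
Variable G : sgraph.
Hypothesis G_ch : choosable 4 2 G.
Variable col : G -> bool.
Hypothesis colE : forall x y, adj x y -> col x != col y.
Implicit Types (x y z : G) (p q c d A B : seq G).

Lemma lk_odd x p y : lk x p y -> odd (size p) = (col x == col y).
Proof.
rewrite /lk; elim: p x => [|a p IH] x /=.
  by rewrite andbT => /colE; case: (col x) (col y) => [] [].
by move=> /andP[/colE xa /IH ->]; move: xa; case: (col x) (col y) (col a) => [] [] [].
Qed.

Lemma lol_pend v c d : lol v c d -> pend v (c ++ d) FC.
Proof.
(* This order carries the pairs 01, 02 of [FC] to 31, 32, the complements of 02 and 01; hence [FC]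
   travels along the stem. *)
case=> pc ld sd u; apply: (@pend_path _ _ _ _ _ [:: 3; 1; 2; 0]) => //.
  by case/andP: u.
have od := lk_odd ld; rewrite eqxx in od.
(* By bipartiteness the number of internal vertices is odd; being more than 1, it is at least 3. *)
have f : edge_fits d 3 by rewrite /edge_fits; lia.
have {}u : uniq (last v c :: d).
  by apply: (uniq_le u) => a; have := count_belast c v a; cnt.
move: (last v c) u ld => w u ld.
have P : pats w [:: w] [:: iota 0 4] (d ++ [::]) _ [::] :=
  pats_edge (i := 0) (j := 0)
    (cs := [:: [:: 0; 1; 2; 3]; [:: 1; 2; 3; 4]; [:: 0; 1; 2; 4]])
    isT f ld (pats_nil _ _ _).
rewrite -(cats0 d); apply: (pats_pend (bs := [::]) P) => //.
by rewrite /= cats0.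
Qed.

(** For a cycle alone only the two pairs of [FC] are used; a further cycle hanging opposite to [u]
    on a 4-cycle raises this to the four pairs of [FQ]. *)
Lemma chain_pend u v a b A : lk u [:: a] v -> lk u [:: b] v -> pend v A FC ->
  uniq (u :: v :: a :: b :: A) -> pend u (v :: a :: b :: A) FQ.
Proof.
move=> l1 l2 pA U.
have P : pats u [:: u; v] [:: iota 0 4; [:: 0; 1; 3; 4]]
    ([:: a] ++ [:: b] ++ A ++ [::]) _ [:: _] :=
  pats_edge (i := 0) (j := 1) (cs := [:: [:: 0; 1; 3; 4]]) isT isT l1
  (pats_edge (i := 0) (j := 1) (cs := [:: [:: 0; 1; 2; 4]]) isT isT l2
  (pats_mark (i := 1) (l := [:: 3; 0; 1; 4]) isT pA (pats_nil _ _ _))).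
apply: pend_sub (pats_pend (bs := [:: v]) (F := FQ) P _ _ _ _) => //.
  by move=> z; rewrite !(inE, mem_cat) orbF.
by rewrite /= cats0.
Qed.

Lemma theta_end_pend x y (a b c : G) : lk x [:: a] y -> lk x [:: b] y -> lk x [:: c] y ->
  uniq [:: x; y; a; b; c] -> pend x [:: y; a; b; c] FP.
Proof.
move=> l1 l2 l3 U.
have P : pats x [:: x; y] [:: iota 0 4; [:: 2; 3; 4; 5]]
    ([:: a] ++ [:: b] ++ [:: c] ++ [::]) _ [::] :=
  pats_edge (i := 0) (j := 1) (cs := [:: [:: 0; 3; 4; 5]]) isT isT l1
  (pats_edge (i := 0) (j := 1) (cs := [:: [:: 1; 2; 4; 5]]) isT isT l2
  (pats_edge (i := 0) (j := 1) (cs := [:: [:: 0; 1; 2; 3]]) isT isT l3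
  (pats_nil _ _ _))).
exact: (pats_pend (bs := [:: y]) (F := FP) P).
Qed.

Lemma theta_mid_pend x y (a b c : G) : lk x [:: a] y -> lk x [:: b] y -> lk x [:: c] y ->
  uniq [:: x; y; a; b; c] -> pend a [:: x; y; b; c] FP.
Proof.
move=> l1 l2 l3 U; have /and3P[xa ay _] : lk x [:: a] y by [].
have ax : lk a [::] x by rewrite lk_nil adj_sym.
have {}ay : lk a [::] y by rewrite lk_nil.
have P : pats x [:: a; x; y] [:: iota 0 4; [:: 2; 3; 4; 5]; [:: 0; 1; 2; 3]]
    ([::] ++ [::] ++ [:: b] ++ [:: c] ++ [::]) _ [::] :=
  pats_edge (i := 0) (j := 1) (cs := [::]) isT isT ax
  (pats_edge (i := 0) (j := 2) (cs := [::]) isT isT ay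
  (pats_edge (i := 1) (j := 2) (cs := [:: [:: 1; 3; 4; 5]]) isT isT l2
  (pats_edge (i := 1) (j := 2) (cs := [:: [:: 0; 2; 4; 5]]) isT isT l3
  (pats_nil _ _ _)))).
have {}U : uniq [:: a; x; y; b; c] by ucnt U.
(* The computed family is the path 0-2-3-1, which the given order turns into [FP], the path
   3-0-1-2. *)
apply: (@pendW _ _ _ [:: (0, 2); (1, 3); (2, 3)] _ [:: 3; 2; 0; 1]) => //.
by apply: (pats_pend (bs := [:: x; y]) P).
Qed.

(** The two copies of [FC] are centered at the colors 1 and 3; together they make up [F4]. *)
Lemma star_pend v A B : pend v A FC -> pend v B FC -> uniq (v :: A ++ B) ->
  pend v (A ++ B) F4.
Proof.
move=> pA pB U.
have P : pats v [:: v] [:: iota 0 4] (A ++ B ++ [::]) [::] _ :=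
  pats_mark (i := 0) (l := [:: 1; 0; 2; 3]) isT pA
  (pats_mark (i := 0) (l := [:: 3; 1; 2; 0]) isT pB (pats_nil _ _ _)).
rewrite -(cats0 B); apply: (pats_pend (bs := [::]) (F := F4) P) => //.
by rewrite /= cats0.
Qed.

(** With no path in the pattern, the search fails precisely when [F] and the copy of [F'] given by
    [s] cover all six pairs. *)
Lemma pend2_false v A B F F' s : pend v A F -> pend v B F' -> uniq (v :: A ++ B) ->
  good4 s && perm_eq s (iota 0 4) ->
  ~~ colorings [::] [:: (0, iota 0 4, F); (0, s, F')] [:: iota 0 4] [::] -> False.
Proof.
move=> pA pB U gs.
have P : pats v [:: v] [:: iota 0 4] (A ++ B ++ [::]) [::] _ :=
  pats_mark (i := 0) (l := iota 0 4) isT pA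
  (pats_mark (i := 0) (l := s) gs pB (pats_nil _ _ _)).
by apply: (pats_false G_ch P) => //; rewrite /= cats0.
Qed.

(** What pieces richer than a single cycle forbid. Each family contains a copy of [FC], and any two
    of them can be placed so as to cover all pairs, so a vertex carries at most one big piece. *)
Definition big v A : Prop := [\/ pend v A FQ, pend v A FP | pend v A F4].

Lemma big_mono v A A' : {subset A <= A'} -> big v A -> big v A'.
Proof.
by move=> s; case=> /(pend_sub s) ?; [apply: Or31|apply: Or32|apply: Or33].
Qed.

Lemma big_FC v A : big v A -> pend v A FC.
Proof.
case; [apply: (@pendW _ _ _ _ _ [:: 1; 2; 0; 3])|apply: (@pendW _ _ _ _ _ [:: 2; 0; 1; 3])
  |apply: (@pendW _ _ _ _ _ [:: 2; 0; 1; 3])] => //.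
Qed.

Lemma big_path v c A : path adj v c -> uniq (c ++ A) -> big (last v c) A ->
  big v (c ++ A).
Proof.
move=> pc U; case=> b; [apply: Or31|apply: Or32|apply: Or33].
- exact: (@pend_path _ _ _ _ _ [:: 1; 0; 2; 3]).
- exact: (@pend_path _ _ _ _ _ [:: 2; 3; 0; 1]).
- exact: (@pend_path _ _ _ _ _ [:: 1; 0; 2; 3]).
Qed.

Lemma big2_false v A B : big v A -> big v B -> uniq (v :: A ++ B) -> False.
Proof.
case=> pA [] pB U.
- exact: (pend2_false (s := [:: 1; 2; 0; 3]) pA pB U).
- exact: (pend2_false (s := [:: 2; 1; 0; 3]) pA pB U).
- exact: (pend2_false (s := [:: 1; 0; 2; 3]) pA pB U).
- exact: (pend2_false (s := [:: 1; 2; 0; 3]) pA pB U).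
- exact: (pend2_false (s := [:: 3; 2; 0; 1]) pA pB U).
- exact: (pend2_false (s := [:: 0; 2; 1; 3]) pA pB U).
- exact: (pend2_false (s := [:: 1; 0; 2; 3]) pA pB U).
- exact: (pend2_false (s := [:: 0; 2; 1; 3]) pA pB U).
- exact: (pend2_false (s := [:: 1; 2; 0; 3]) pA pB U).
Qed.

(** [F4] leaves out two pairs with a common color, a copy of [FC]. *)
Lemma F4_FC_false v A B : pend v A F4 -> pend v B FC -> uniq (v :: A ++ B) -> False.
Proof. by move=> pA pB U; apply: (pend2_false (s := [:: 0; 2; 3; 1]) pA pB U). Qed.

Lemma cycle_FC_sizes u v p q A B : lk u p v -> lk u q v -> pend u A FC ->
  pend v B FC -> uniq (u :: v :: p ++ q ++ A ++ B) -> 0 < size p + size q ->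
  size p = 1 /\ size q = 1.
Proof.
move=> l1 l2 pA pB U s0.
have o1 := lk_odd l1; have o2 := lk_odd l2; rewrite -o1 in o2.
case: (boolP ((size p == 1) && (size q == 1))) => [/andP[/eqP-> /eqP->]//|ns].
have U2 : uniq ([:: u; v] ++ q ++ p ++ A ++ B) by ucnt U.
exfalso; case: (boolP (odd (size p))) => op.
  have [s3|s3] : 3 <= size p \/ 3 <= size q by lia.
    by apply: (no_cycle_FC13 G_ch l2 l1 pA pB) => //; slia.
  by apply: (no_cycle_FC13 G_ch l1 l2 pA pB) => //; slia.
have [s3|s3] : 2 <= size p \/ 2 <= size q by lia.
  by apply: (no_cycle_FC02 G_ch l2 l1 pA pB) => //; slia.
by apply: (no_cycle_FC02 G_ch l1 l2 pA pB) => //; slia.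
Qed.

(** The last condition lets at most one of the three paths be an edge, as the graph is simple. *)
Definition theta_in x y p q r :=
  [/\ lk x p y, lk x q y, lk x r y, uniq (x :: y :: p ++ q ++ r) &
     [&& 0 < size p + size q, 0 < size p + size r & 0 < size q + size r]].

Lemma theta_in_rev x y p q r : theta_in x y p q r ->
  theta_in y x (rev p) (rev q) (rev r).
Proof.
case=> l1 l2 l3 U s; split; rewrite -?lk_rev //; first by ucnt U.
by rewrite !size_rev.
Qed.

Lemma theta_in_swap12 x y p q r : theta_in x y p q r -> theta_in x y q p r.
Proof. by case=> l1 l2 l3 U s; split=> //; [ucnt U|lia]. Qed.

Lemma theta_in_swap23 x y p q r : theta_in x y p q r -> theta_in x y p r q.
Proof. by case=> l1 l2 l3 U s; split=> //; [ucnt U|lia]. Qed.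

(** The three lengths have equal parity, and if none were as short as possible, a pattern with
    lengths 4 or with lengths 3 would appear. *)
Lemma theta_in_sizes x y p q r : theta_in x y p q r ->
  [/\ odd (size p) = odd (size q), odd (size p) = odd (size r) &
    if odd (size p) then [|| size p == 1, size q == 1 | size r == 1]
    else [|| size p == 0, size q == 0 | size r == 0]].
Proof.
case=> l1 l2 l3 U s.
have o1 := lk_odd l1; have := lk_odd l2; have := lk_odd l3; rewrite -o1 => o3 o2.
split=> //; rewrite -[X in is_true X]negbK; apply/negP.
case: (boolP (odd (size p))) => op ns.
  by apply: (no_theta444 G_ch l1 l2 l3 U); slia.
by apply: (no_theta333 G_ch l1 l2 l3 U); slia.
Qed.

End Bipartite.

Lemma stepsP (T : eqType) (s : seq T) u v :
  reflect (exists s1 s2, s = s1 ++ u :: v :: s2) ((u, v) \in steps s).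
Proof.
elim: s => [|a s IH] /=.
  by apply: (iffP idP) => [|[[|? ?] [? ?]]]; rewrite /steps.
case: s IH => [|b s] IH.
  by apply: (iffP idP) => [|[[|? [|? ?]] [? ?]]]; rewrite /steps.
rewrite /steps /= inE -/(steps (b :: s)) xpair_eqE; apply: (iffP idP).
  by case/orP=> [/andP[/eqP-> /eqP->]|/IH[s1 [s2 ->]]]; [exists [::], s|exists (a :: s1), s2].
move=> [[|c s1] [s2 /= [-> E]]].
  by rewrite E !eqxx.
by apply/orP; right; apply/IH; exists s1, s2.
Qed.

Ltac leaf lem U := by apply: lem; rewrite -?lk_rev //; solve [ucnt U | slia].

(** * Open ears on a theta graph *)

Section ThetaExtensions.
Variable G : sgraph.
Hypothesis G_ch : choosable 4 2 G.
Variable col : G -> bool.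
Hypothesis colE : forall x y, adj x y -> col x != col y.
Implicit Types (x y z : G) (p q c d A B : seq G).

Let lk_odd := lk_odd colE.

Lemma lkV x p y : lk x p y -> lk y (rev p) x.
Proof. by rewrite lk_rev. Qed.

(** The parities of the two double links fix that of the fifth path. Of the four cases, two are
    exchanged by swapping [y] and [z], which leaves the three computed patterns. *)
Lemma no_W x y z p1 p2 p3 p4 p5 : lk x p1 y -> lk x p2 y -> lk x p3 z -> lk x p4 z ->
  lk y p5 z -> uniq (x :: y :: z :: p1 ++ p2 ++ p3 ++ p4 ++ p5) ->
  0 < size p1 + size p2 -> 0 < size p3 + size p4 -> False.
Proof.
move=> l1 l2 l3 l4 l5 U s12 s34.
have [o2 o4 o5] : [/\ odd (size p2) = odd (size p1), odd (size p4) = odd (size p3) &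
    odd (size p5) = (odd (size p1) == odd (size p3))].
  rewrite (lk_odd l1) (lk_odd l2) (lk_odd l3) (lk_odd l4) (lk_odd l5).
  by case: (col x) (col y) (col z) => [] [] [].
case O1: (odd (size p1)) in o2 o5; case O3: (odd (size p3)) in o4 o5.
- leaf (no_W_eee G_ch l1 l2 l3 l4 l5) U.
- have [s|s] : 2 <= size p3 \/ 2 <= size p4 by slia.
    leaf (no_W_eoo G_ch l1 l2 l4 l3 l5) U.
  leaf (no_W_eoo G_ch l1 l2 l3 l4 l5) U.
- have [s|s] : 2 <= size p1 \/ 2 <= size p2 by slia.
    leaf (no_W_eoo G_ch l3 l4 l2 l1 (lkV l5)) U.
  leaf (no_W_eoo G_ch l3 l4 l1 l2 (lkV l5)) U.
have [s|s] : 2 <= size p1 \/ 2 <= size p2 by slia.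
  have [t|t] : 2 <= size p3 \/ 2 <= size p4 by slia.
    leaf (no_W_ooe G_ch l2 l1 l4 l3 l5) U.
  leaf (no_W_ooe G_ch l2 l1 l3 l4 l5) U.
have [t|t] : 2 <= size p3 \/ 2 <= size p4 by slia.
  leaf (no_W_ooe G_ch l1 l2 l4 l3 l5) U.
leaf (no_W_ooe G_ch l1 l2 l3 l4 l5) U.
Qed.

(** Three parities determine the others. The eight cases reduce to five patterns by turning the
    cycle around or exchanging its doubled links. *)
Lemma no_N (a b c d : G) p1 p2 p3 p4 p5 p6 : lk a p1 b -> lk a p2 b -> lk c p3 d -> lk c p4 d ->
  lk b p5 c -> lk d p6 a -> uniq (a :: b :: c :: d :: p1 ++ p2 ++ p3 ++ p4 ++ p5 ++ p6) ->
  0 < size p1 + size p2 -> 0 < size p3 + size p4 -> False.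
Proof.
wlog [s12 s34] : p1 p2 p3 p4 / size p1 <= size p2 /\ size p3 <= size p4.
  move=> H l1 l2 l3 l4 l5 l6 U s12 s34.
  have [a1|a1] := leqP (size p1) (size p2); have [a2|a2] := leqP (size p3) (size p4).
  - exact: (H p1 p2 p3 p4).
  - by apply: (H p1 p2 p4 p3) => //; [rewrite a1 (ltnW a2)|ucnt U|rewrite addnC].
  - by apply: (H p2 p1 p3 p4) => //; [rewrite a2 (ltnW a1)|ucnt U|rewrite addnC].
  - by apply: (H p2 p1 p4 p3) => //; [rewrite (ltnW a1) (ltnW a2)|ucnt U|rewrite addnC|rewrite addnC].
move=> l1 l2 l3 l4 l5 l6 U t12 t34.
have [o2 o4 o6] : [/\ odd (size p2) = odd (size p1), odd (size p4) = odd (size p3) &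
    odd (size p6) = (odd (size p5) == (odd (size p1) == odd (size p3)))].
  rewrite (lk_odd l1) (lk_odd l2) (lk_odd l3) (lk_odd l4) (lk_odd l5) (lk_odd l6).
  by case: (col a) (col b) (col c) (col d) => [] [] [] [].
case O1: (odd (size p1)) in o2 o6; case O3: (odd (size p3)) in o4 o6;
  case O5: (odd (size p5)) in o6.
- leaf (no_N_ee2 G_ch l1 l2 l3 l4 l5 l6) U.
- leaf (no_N_ee1 G_ch l1 l2 l3 l4 l5 l6) U.
- leaf (no_N_eo G_ch (lkV l1) (lkV l2) (lkV l3) (lkV l4) (lkV l6) (lkV l5)) U.
- leaf (no_N_eo G_ch l1 l2 l3 l4 l5 l6) U.
- leaf (no_N_eo G_ch l3 l4 l1 l2 l6 l5) U.
- leaf (no_N_eo G_ch (lkV l3) (lkV l4) (lkV l1) (lkV l2) (lkV l5) (lkV l6)) U.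
- leaf (no_N_oo2 G_ch l1 l2 l3 l4 l5 l6) U.
- leaf (no_N_oo1 G_ch l1 l2 l3 l4 l5 l6) U.
Qed.

Definition K24_in x y (a b c d : G) :=
  [/\ lk x [:: a] y, lk x [:: b] y, lk x [:: c] y, lk x [:: d] y &
      uniq [:: x; y; a; b; c; d]].

(** K_{3,3} minus an edge has the sides [a1, a2, a0] and [b1, b2, w], where [a0] and [w] are not
    adjacent; [p] is [w] together with the vertices that subdivide an edge at [w]. *)
Definition VI_in (a1 a2 b1 b2 a0 : G) p :=
  [/\ [/\ adj a1 b1, adj a1 b2, adj a2 b1 & adj a2 b2],
      lk b1 [:: a0] b2, lk a1 p a2 & uniq (a1 :: a2 :: b1 :: b2 :: a0 :: p)].

Lemma size1 (T : Type) (s : seq T) : size s = 1 -> exists a, s = [:: a].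
Proof. by case: s => [|a [|]] // _; exists a. Qed.

(** For even lengths, a path longer than 2 gives [no_theta2224]. For odd lengths at most one path is
    an edge, and the other three give [no_theta333]. *)
Lemma theta4 x y p q r m : lk x p y -> lk x q y -> lk x r y -> lk x m y ->
  uniq (x :: y :: p ++ q ++ r ++ m) ->
  [&& 0 < size p + size q, 0 < size p + size r, 0 < size q + size r,
     0 < size p + size m, 0 < size q + size m & 0 < size r + size m] ->
  [/\ size p = 1, size q = 1, size r = 1 & size m = 1].
Proof.
move=> l1 l2 l3 l4 U s.
have [o2 o3 o4] : [/\ odd (size q) = odd (size p), odd (size r) = odd (size p) &
   odd (size m) = odd (size p)].
  by rewrite (lk_odd l1) (lk_odd l2) (lk_odd l3) (lk_odd l4).
case: (boolP [&& size p == 1, size q == 1, size r == 1 & size m == 1]).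
  by case/and4P=> /eqP-> /eqP-> /eqP-> /eqP->.
move=> ns; exfalso; case O: (odd (size p)) in o2 o3 o4.
  have [z|z|z|z] : [\/ 3 <= size p, 3 <= size q, 3 <= size r | 3 <= size m].
    case: (leqP 3 (size p)) => z1; first by apply: Or41.
    case: (leqP 3 (size q)) => z2; first by apply: Or42.
    case: (leqP 3 (size r)) => z3; first by apply: Or43.
    by apply: Or44; slia.
  - leaf (no_theta2224 G_ch l2 l3 l4 l1) U.
  - leaf (no_theta2224 G_ch l1 l3 l4 l2) U.
  - leaf (no_theta2224 G_ch l1 l2 l4 l3) U.
  - leaf (no_theta2224 G_ch l1 l2 l3 l4) U.
have [z|z] := posnP (size p); first by leaf (no_theta333 G_ch l2 l3 l4) U.
have [w|w] := posnP (size q); first by leaf (no_theta333 G_ch l1 l3 l4) U.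
have [t|t] := posnP (size r); first by leaf (no_theta333 G_ch l1 l2 l4) U.
leaf (no_theta333 G_ch l1 l2 l3) U.
Qed.


Definition edge_of x p y u v :=
  ((u, v) \in steps (x :: rcons p y)) || ((v, u) \in steps (x :: rcons p y)).

Lemma edge_ofC x p y u v : edge_of x p y u v = edge_of x p y v u.
Proof. by rewrite /edge_of orbC. Qed.

Lemma edge_of_rev x p y u v : edge_of y (rev p) x u v = edge_of x p y u v.
Proof.
have R w : y :: rcons (rev p) w = rev (w :: rcons p y) by rewrite rev_cons rev_rcons.
have S s (a b : G) : ((a, b) \in steps (rev s)) = ((b, a) \in steps s).
  apply/stepsP/stepsP => -[s1 [s2 E]]; exists (rev s2), (rev s1).
    by rewrite -(revK s) E rev_cat !rev_cons !cat_rcons.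
  by rewrite E rev_cat !rev_cons !cat_rcons.
by rewrite /edge_of R !S orbC.
Qed.

Lemma edge_of_nil x z p y : edge_of x (z :: p) y x z.
Proof. by rewrite /edge_of /steps /= inE eqxx. Qed.

(** Four edges form a 4-cycle on the branch vertices; of the two opposite links, the one of length 2
    supplies [a0] and the other one is [p]. *)
Lemma K4_VI (a b c d : G) p1 p2 p3 p4 p5 p6 :
  lk a p1 b -> lk c p2 d -> lk a p3 c -> lk a p4 d -> lk b p5 c -> lk b p6 d ->
  uniq (a :: b :: c :: d :: p1 ++ p2 ++ p3 ++ p4 ++ p5 ++ p6) ->
  [&& size p3 == 0, size p4 == 0, size p5 == 0 & size p6 == 0] ->
  (size p1 == 1) || (size p2 == 1) ->
  exists a1 a2 b1 b2 a0 p, VI_in a1 a2 b1 b2 a0 p.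
Proof.
move=> l1 l2 l3 l4 l5 l6 + /and4P[/nilP E3 /nilP E4 /nilP E5 /nilP E6].
rewrite {}E3 {}E4 {}E5 {}E6 !lk_nil !cats0 in l3 l4 l5 l6 * => U.
case/orP=> /eqP/size1[a0 E]; rewrite {}E in l1 l2 U.
  exists c, d, a, b, a0, p2; split=> //; last by ucnt U.
  by rewrite ![_ c _]adj_sym ![_ d _]adj_sym.
by exists a, b, c, d, a0, p1; split=> //; ucnt U.
Qed.

(** The colors of the branch vertices fix all parities. If all agree, every link is even; if they
    split three to one, the cube pattern applies. The three splits two to two give the three
    alternatives. *)
Lemma K4 (a b c d : G) p1 p2 p3 p4 p5 p6 :
  lk a p1 b -> lk c p2 d -> lk a p3 c -> lk a p4 d -> lk b p5 c -> lk b p6 d ->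
  uniq (a :: b :: c :: d :: p1 ++ p2 ++ p3 ++ p4 ++ p5 ++ p6) ->
  [\/ [&& size p3 == 0, size p4 == 0, size p5 == 0 & size p6 == 0] &&
        ((size p1 == 1) || (size p2 == 1)),
      [&& size p1 == 0, size p4 == 0, size p5 == 0 & size p2 == 0] &&
        ((size p3 == 1) || (size p6 == 1))
    | [&& size p1 == 0, size p3 == 0, size p6 == 0 & size p2 == 0] &&
        ((size p4 == 1) || (size p5 == 1))].
Proof.
(* One split two to two: the even links [p1] and [p2] are opposite. The four odd links must be edges
   by [no_K4_long_side], and one even link has length 2 by [no_K4_two_long]. *)
have half : forall (a b c d : G) p1 p2 p3 p4 p5 p6,
  lk a p1 b -> lk c p2 d -> lk a p3 c -> lk a p4 d -> lk b p5 c -> lk b p6 d ->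
  uniq (a :: b :: c :: d :: p1 ++ p2 ++ p3 ++ p4 ++ p5 ++ p6) ->
  [&& odd (size p1), odd (size p2), ~~ odd (size p3), ~~ odd (size p4),
      ~~ odd (size p5) & ~~ odd (size p6)] ->
  [&& size p3 == 0, size p4 == 0, size p5 == 0 & size p6 == 0] &&
    ((size p1 == 1) || (size p2 == 1)).
  move=> {p1 p2 p3 p4 p5 p6} {}a {}b {}c {}d p1 p2 p3 p4 p5 p6.
  move=> l1 l2 l3 l4 l5 l6 U /and5P[o1 o2 o3 o4 /andP[o5 o6]].
  have [z3|z3] := posnP (size p3); last by exfalso; leaf (no_K4_long_side G_ch l1 l2 l3 l4 l5 l6) U.
  have [z4|z4] := posnP (size p4).
    have [z5|z5] := posnP (size p5).
      have [z6|z6] := posnP (size p6).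
        rewrite /= -[X in is_true X]negbK; apply/negP => ns.
        leaf (no_K4_two_long G_ch l1 l2 l3 l4 l5 l6) U.
      by exfalso; leaf (no_K4_long_side G_ch (lkV l1) (lkV l2) l6 l5 l4 l3) U.
    by exfalso; leaf (no_K4_long_side G_ch (lkV l1) l2 l5 l6 l3 l4) U.
  by exfalso; leaf (no_K4_long_side G_ch l1 (lkV l2) l4 l3 l6 l5) U.
move=> l1 l2 l3 l4 l5 l6 U.
have : [/\ odd (size p1) = (col a == col b), odd (size p2) = (col c == col d),
   odd (size p3) = (col a == col c), odd (size p4) = (col a == col d) &
   odd (size p5) = (col b == col c) /\ odd (size p6) = (col b == col d)].
  by rewrite -(lk_odd l1) -(lk_odd l2) -(lk_odd l3) -(lk_odd l4) -(lk_odd l5) -(lk_odd l6).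
case: (col a); case: (col b); case: (col c); case: (col d); case=> /= o1 o2 o3 o4 [o5 o6].
all: try by exfalso; leaf (no_K4_222222 G_ch l1 l2 l3 l4 l5 l6) U.
all: try by exfalso; leaf (no_K4_cube G_ch l1 l2 l3 l4 l5 l6) U.
all: try by exfalso; leaf (no_K4_cube G_ch l1 (lkV l2) l4 l3 l6 l5) U.
all: try by exfalso; leaf (no_K4_cube G_ch l3 (lkV l6) l4 l1 l2 (lkV l5)) U.
all: try by exfalso; leaf (no_K4_cube G_ch l5 (lkV l4) l6 (lkV l1) l2 (lkV l3)) U.
all: first
 [ by apply: Or31; apply: (half _ _ _ _ _ _ _ _ _ _ l1 l2 l3 l4 l5 l6) => //; slia
 | by apply: Or32; rewrite -(size_rev p5);
     apply: (half _ _ _ _ _ _ _ _ _ _ l3 l6 l1 l4 (lkV l5) l2); [ucnt U | slia]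
 | by apply: Or33; rewrite -(size_rev p6) -(size_rev p2);
     apply: (half _ _ _ _ _ _ _ _ _ _ l4 l5 l1 l3 (lkV l6) (lkV l2)); [ucnt U | slia]].
Qed.

Lemma K4_ex_VI (a b c d : G) p1 p2 p3 p4 p5 p6 :
  lk a p1 b -> lk c p2 d -> lk a p3 c -> lk a p4 d -> lk b p5 c -> lk b p6 d ->
  uniq (a :: b :: c :: d :: p1 ++ p2 ++ p3 ++ p4 ++ p5 ++ p6) ->
  exists a1 a2 b1 b2 a0 p, VI_in a1 a2 b1 b2 a0 p.
Proof.
move=> l1 l2 l3 l4 l5 l6 U.
case: (K4 l1 l2 l3 l4 l5 l6 U) => /andP[z o].
- exact: (K4_VI l1 l2 l3 l4 l5 l6 U).
- apply: (K4_VI l3 l6 l1 l4 (lkV l5) l2) => //; first by ucnt U.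
  by rewrite size_rev.
apply: (K4_VI l4 l5 l1 l3 (lkV l6) (lkV l2)) => //; first by ucnt U.
by rewrite !size_rev.
Qed.

Definition K24_or_VI : Prop :=
  (exists x y (a b c d : G), K24_in x y a b c d) \/
  (exists a1 a2 b1 b2 a0 p, VI_in a1 a2 b1 b2 a0 p).

Definition theta_edge x y p q r u v :=
  [|| edge_of x p y u v, edge_of x q y u v | edge_of x r y u v].

Lemma theta_ear_ends x y p q r m : theta_in x y p q r -> lk x m y ->
  uniq (x :: y :: p ++ q ++ r ++ m) ->
  (m = [::] -> ~~ theta_edge x y p q r x y) -> K24_or_VI.
Proof.
case=> l1 l2 l3 _ s lm U nd.
have [] := theta4 l1 l2 l3 lm U.
  case: m lm U nd => [|z m]; last by move=> *; slia.
  move=> _ _ /(_ erefl); have N w : size w = 0 -> edge_of x w y x y.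
    by move=> /size0nil->; rewrite /edge_of /steps /= inE eqxx.
  rewrite /theta_edge => /norP[n1 /norP[n2 n3]].
  have g w : ~~ edge_of x w y x y -> 0 < size w.
    by rewrite lt0n; apply: contra => /eqP/N.
  by move: (g _ n1) (g _ n2) (g _ n3); slia.
move=> /size1[a Ea] /size1[b Eb] /size1[c Ec] /size1[d Ed].
by left; exists x, y, a, b, c, d; split; rewrite -?Ea -?Eb -?Ec -?Ed //; subst.
Qed.

(** The ear doubles the link from [x] to [z], and [q], [r] double the one from [x] to [y]: this is a
    W. *)
Lemma theta_ear_end_inner x y p q r z m : theta_in x y p q r -> z \in p -> lk x m z ->
  uniq (x :: y :: p ++ q ++ r ++ m) ->
  (m = [::] -> ~~ theta_edge x y p q r x z) -> False.
Proof.
case=> + l2 l3 _ s zp lm + nd; case/splitPr: zp s nd => p1 p2 s nd.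
rewrite lk_cat => /andP[l1 l1'] U.
apply: (no_W lm l1 l2 l3 l1'); [ucnt U | | slia].
case: m p1 nd {l1 lm U s} => // -[] // nd.
by move: (nd erefl); rewrite /theta_edge edge_of_nil.
Qed.

(** The link from [z] to [w] is doubled by the ear, the one from [x] to [y] by [q] and [r]: this is
    an N. *)
Lemma theta_ear_same x y p q r z w m : theta_in x y p q r -> z \in p -> w \in p ->
  z != w -> lk z m w -> uniq (x :: y :: p ++ q ++ r ++ m) ->
  (m = [::] -> ~~ theta_edge x y p q r z w) -> False.
Proof.
have half : forall z w p1 p2 p3 m, lk z m w ->
    theta_in x y (p1 ++ z :: p2 ++ w :: p3) q r ->
    uniq (x :: y :: (p1 ++ z :: p2 ++ w :: p3) ++ q ++ r ++ m) ->
    (m = [::] -> ~~ theta_edge x y (p1 ++ z :: p2 ++ w :: p3) q r z w) -> False.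
  move=> {p m} {}z {}w p1 p2 p3 m lm; rewrite /theta_in !lk_cat.
  case=> /and3P[l1 l2 l3] lq lr _ /and3P[_ _ sqr] U nd.
  apply: (no_N lm l2 (lkV lq) (lkV lr) l3 l1); [ucnt U | | slia].
  case: m p2 nd {l1 l2 l3 lm U} => // -[] // nd; move: (nd erefl).
  rewrite /theta_edge => /norP[/negP[]].
  by rewrite /edge_of; apply/orP; left; apply/stepsP; exists (x :: p1), (rcons p3 y); rewrite rcons_cat.
move=> T zp wp zw lm U nd; case/splitPr: zp wp T U nd => p1 p2.
rewrite mem_cat inE eq_sym (negPf zw) => /orP[]w12; case/splitPr: w12 => s1 s2 T U nd.
  rewrite -(catA s1) cat_cons in T U nd.
  apply: (half w z s1 s2 p2 (rev m)) => //; [exact: lkV|ucnt U|].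
  move=> /(congr1 size); rewrite size_rev => /size0nil/nd.
  by rewrite /theta_edge ![edge_of _ _ _ z w]edge_ofC.
exact: (half z w p1 s1 s2 m).
Qed.

(** The result is a subdivision of the complete graph on [x], [y], [z], [w]. *)
Lemma theta_ear_inner x y p q r z w m : theta_in x y p q r -> z \in p -> w \in q ->
  lk z m w -> uniq (x :: y :: p ++ q ++ r ++ m) -> K24_or_VI.
Proof.
case=> + + lr _ _ zp wq lm; case/splitPr: zp => p1 p2; case/splitPr: wq => q1 q2.
rewrite !lk_cat => /andP[l1 l2] /andP[l3 l4] U; right.
by apply: (K4_ex_VI lr lm l1 l3 (lkV l2) (lkV l4)); ucnt U.
Qed.

Lemma theta_edge_swap12 x y p q r u v : theta_edge x y q p r u v = theta_edge x y p q r u v.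
Proof. by rewrite /theta_edge orbCA. Qed.

Lemma theta_edge_swap23 x y p q r u v : theta_edge x y p r q u v = theta_edge x y p q r u v.
Proof. by rewrite /theta_edge; congr (_ || _); rewrite orbC. Qed.

Lemma theta_edge_rev x y p q r u v :
  theta_edge y x (rev p) (rev q) (rev r) u v = theta_edge x y p q r u v.
Proof. by rewrite /theta_edge !edge_of_rev. Qed.

Lemma theta_edgeC x y p q r u v : theta_edge x y p q r u v = theta_edge x y p q r v u.
Proof. by rewrite /theta_edge ![edge_of _ _ _ u v]edge_ofC. Qed.

Lemma rev_nil (T : Type) (s : seq T) : rev s = [::] -> s = [::].
Proof. by move=> E; rewrite -(revK s) E. Qed.

Lemma theta_ear_from_end x y p q r e m : theta_in x y p q r ->
  e \in y :: p ++ q ++ r -> lk x m e -> uniq (x :: y :: p ++ q ++ r ++ m) ->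
  (m = [::] -> ~~ theta_edge x y p q r x e) -> K24_or_VI.
Proof.
move=> T; rewrite inE !mem_cat => /or4P[/eqP->|ep|eq|er] lm U nd.
- exact: (theta_ear_ends T lm U nd).
- by case: (theta_ear_end_inner T ep lm U nd).
- case: (theta_ear_end_inner (theta_in_swap12 T) eq lm); first by ucnt U.
  by rewrite theta_edge_swap12.
case: (theta_ear_end_inner (theta_in_swap12 (theta_in_swap23 T)) er lm); first by ucnt U.
by rewrite theta_edge_swap12 theta_edge_swap23.
Qed.

Lemma theta_ear_from_inner x y p q r e f m : theta_in x y p q r ->
  e \in p -> f \in x :: y :: p ++ q ++ r -> e != f -> lk e m f ->
  uniq (x :: y :: p ++ q ++ r ++ m) ->
  (m = [::] -> ~~ theta_edge x y p q r e f) -> K24_or_VI.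
Proof.
move=> T ep; rewrite !inE !mem_cat => /or4P[/eqP->|/eqP->|fp|/orP[fq|fr]] ef lm U nd.
- case: (theta_ear_end_inner T ep (lkV lm)); first by ucnt U.
  by move=> /rev_nil/nd; rewrite theta_edgeC.
- case: (theta_ear_end_inner (theta_in_rev T) _ (lkV lm)); first by rewrite mem_rev.
    by ucnt U.
  by move=> /rev_nil/nd; rewrite theta_edge_rev theta_edgeC.
- by case: (theta_ear_same T ep fp ef lm U nd).
- exact: (theta_ear_inner T ep fq lm U).
by apply: (theta_ear_inner (theta_in_swap23 T) ep fr lm); ucnt U.
Qed.

Lemma theta_ear x y p q r e f m : theta_in x y p q r ->
  e \in x :: y :: p ++ q ++ r -> f \in x :: y :: p ++ q ++ r -> e != f -> lk e m f ->
  uniq (x :: y :: p ++ q ++ r ++ m) ->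
  (m = [::] -> ~~ theta_edge x y p q r e f) -> K24_or_VI.
Proof.
move=> T; rewrite {1}inE => /orP[/eqP->|].
  rewrite inE => /orP[/eqP->|]; first by rewrite eqxx.
  by move=> fi _ lm U nd; apply: (theta_ear_from_end T fi lm U nd).
rewrite {1}inE => /orP[/eqP->|].
  move=> fi yf lm U nd; apply: (theta_ear_from_end (theta_in_rev T) _ lm).
  - by move: fi yf; rewrite !inE !mem_cat !mem_rev => /or3P[->|/eqP->|->]; rewrite ?eqxx ?orbT.
  - by ucnt U.
  by rewrite theta_edge_rev.
rewrite !mem_cat => /or3P[] ei fi ef lm U nd.
- exact: (theta_ear_from_inner T ei fi ef lm U nd).
- apply: (theta_ear_from_inner (theta_in_swap12 T) ei _ ef lm); last by rewrite theta_edge_swap12.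
    by move: fi; rewrite !inE !mem_cat => /or4P[->|->|->|/orP[->|->]]; rewrite ?orbT.
  by ucnt U.
apply: (theta_ear_from_inner (theta_in_swap12 (theta_in_swap23 T)) ei _ ef lm).
- by move: fi; rewrite !inE !mem_cat => /or4P[->|->|->|/orP[->|->]]; rewrite ?orbT.
- by ucnt U.
by rewrite theta_edge_swap12 theta_edge_swap23.
Qed.

End ThetaExtensions.

(** * Nothing can be added to K_{2,4} or to case (vi), and only theta_{2,2,2} carries a further
    cycle *)

Section DenseCores.
Variable G : sgraph.
Hypothesis G_ch : choosable 4 2 G.
Variable col : G -> bool.
Hypothesis colE : forall x y, adj x y -> col x != col y.
Implicit Types (x y z : G) (p q A B : seq G).

Let lk_odd := lk_odd colE.

Lemma theta_FC_end x y p q r A : theta_in x y p q r -> pend x A FC ->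
  uniq (x :: y :: p ++ q ++ r ++ A) -> [&& size p == 1, size q == 1 & size r == 1].
Proof.
move=> T pA U; have [o2 o3 _] := theta_in_sizes G_ch colE T.
case: T => l1 l2 l3 _ s; rewrite -[X in is_true X]negbK; apply/negP => ns.
case O: (odd (size p)) in o2 o3.
  have [z|z|z] : [\/ 3 <= size p, 3 <= size q | 3 <= size r].
    case: (leqP 3 (size p)) => z1; first by apply: Or31.
    case: (leqP 3 (size q)) => z2; first by apply: Or32.
    by apply: Or33; slia.
  - leaf (no_theta224_FC_end G_ch l2 l3 l1 pA) U.
  - leaf (no_theta224_FC_end G_ch l1 l3 l2 pA) U.
  - leaf (no_theta224_FC_end G_ch l1 l2 l3 pA) U.
have [z|z] := posnP (size p); first by leaf (no_theta133_FC_end G_ch l1 l2 l3 pA) U.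
have [t|t] := posnP (size q); first by leaf (no_theta133_FC_end G_ch l2 l1 l3 pA) U.
leaf (no_theta133_FC_end G_ch l3 l1 l2 pA) U.
Qed.

Lemma theta_FC_inner x y p q r v A : theta_in x y p q r -> v \in p -> pend v A FC ->
  uniq (x :: y :: p ++ q ++ r ++ A) -> [&& size p == 1, size q == 1 & size r == 1].
Proof.
move=> T vp pA; have [] := theta_in_sizes G_ch colE T.
case: T => + l2 l3 _ s; case/splitPr: vp s => p1 p2 s.
rewrite lk_cat => /andP[/lkV l1 l1'] o2 o3 _ U.
rewrite -[X in is_true X]negbK; apply/negP => ns.
rewrite !size_cat /= in s o2 o3 ns.
(* The parities of the two parts into which [v] cuts its path decide which position of the computed
   patterns applies. *)
case O: (odd (size p1 + (size p2).+1)) in o2 o3;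
  rewrite addnS /= oddD in O; case O1: (odd (size p1)) in O;
  case O2: (odd (size p2)) in O => // {O}.
- leaf (no_theta224_FC_mid G_ch l1 l1' l2 l3 pA) U.
- have [z1|z1] := posnP (size p1); last by leaf (no_theta224_FC_long G_ch l1' l1 (lkV l2) (lkV l3) pA) U.
  have [z2|z2] := posnP (size p2); last by leaf (no_theta224_FC_long G_ch l1 l1' l2 l3 pA) U.
  have [z|z] : 3 <= size q \/ 3 <= size r by slia.
    leaf (no_theta224_FC_short G_ch l1 l1' l3 l2 pA) U.
  leaf (no_theta224_FC_short G_ch l1 l1' l2 l3 pA) U.
- have [z|z] : 2 <= size q \/ 2 <= size r by slia.
    leaf (no_theta133_FC_inner G_ch l1' l1 (lkV l3) (lkV l2) pA) U.
  leaf (no_theta133_FC_inner G_ch l1' l1 (lkV l2) (lkV l3) pA) U.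
have [z|z] : 2 <= size q \/ 2 <= size r by slia.
  leaf (no_theta133_FC_inner G_ch l1 l1' l3 l2 pA) U.
leaf (no_theta133_FC_inner G_ch l1 l1' l2 l3 pA) U.
Qed.

Lemma theta_FC x y p q r v A : theta_in x y p q r ->
  v \in x :: y :: p ++ q ++ r -> pend v A FC -> uniq (x :: y :: p ++ q ++ r ++ A) ->
  [&& size p == 1, size q == 1 & size r == 1].
Proof.
move=> T; rewrite !inE !mem_cat => /or4P[/eqP->|/eqP->|vp|/orP[vq|vr]] pA U.
- exact: (theta_FC_end T pA U).
- by have := theta_FC_end (theta_in_rev T) pA; rewrite !size_rev; apply; ucnt U.
- exact: (theta_FC_inner T vp pA U).
- have := theta_FC_inner (theta_in_swap12 T) vq pA; rewrite andbCA; apply; ucnt U.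
have := theta_FC_inner (theta_in_swap12 (theta_in_swap23 T)) vr pA.
by rewrite andbCA [_ && (size r == 1)]andbC; apply; ucnt U.
Qed.

(** Up to symmetry [v] is an end or a middle vertex, and [FP] is forbidden at both. *)
Lemma theta222_big x y (a b c v : G) : lk x [:: a] y -> lk x [:: b] y -> lk x [:: c] y ->
  uniq [:: x; y; a; b; c] -> v \in [:: x; y; a; b; c] ->
  big v [seq z <- [:: x; y; a; b; c] | z != v].
Proof.
move=> l1 l2 l3 U vi; apply: Or32.
have sub A : v \notin A -> {subset A <= [:: x; y; a; b; c]} ->
    {subset A <= [seq z <- [:: x; y; a; b; c] | z != v]}.
  by move=> vA s z zA; rewrite mem_filter s // andbT; apply: contraNneq vA => <-.
have E w A : pend w A FP -> perm_eq (w :: A) [:: x; y; a; b; c] -> v = w ->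
    pend v [seq z <- [:: x; y; a; b; c] | z != v] FP.
  move=> pe pm ->; apply: pend_sub pe => z zA; rewrite mem_filter -(perm_mem pm) inE zA orbT andbT.
  by apply: contraTneq zA => ->; move: U; rewrite -(perm_uniq pm) => /andP[].
have P s : (forall z, count_mem z s = count_mem z [:: x; y; a; b; c]) -> perm_eq s [:: x; y; a; b; c].
  by move=> H; apply/allP => z _ /=; rewrite H.
move: vi; rewrite !inE => /or4P[/eqP|/eqP|/eqP|/orP[/eqP|/eqP]].
- by apply: E (theta_end_pend l1 l2 l3 U) _; apply: P => z; cnt.
- by apply: E (theta_end_pend (lkV l1) (lkV l2) (lkV l3) _) _; [ucnt U|apply: P => z; cnt].
- by apply: E (theta_mid_pend l1 l2 l3 U) _; apply: P => z; cnt.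
- by apply: E (theta_mid_pend l2 l1 l3 _) _; [ucnt U|apply: P => z; cnt].
- by apply: E (theta_mid_pend l3 l1 l2 _) _; [ucnt U|apply: P => z; cnt].
Qed.

Lemma K24_in_rev x y (a b c d : G) : K24_in x y a b c d -> K24_in y x a b c d.
Proof.
case=> /lkV l1 /lkV l2 /lkV l3 /lkV l4 U; split=> //; ucnt U.
Qed.

Lemma K24_pick x y (a b c d z : G) : K24_in x y a b c d -> z \in [:: a; b; c; d] ->
  exists b' c' d', K24_in x y z b' c' d' /\ perm_eq [:: a; b; c; d] [:: z; b'; c'; d'].
Proof.
have P (s t : seq G) : (forall z, count_mem z s = count_mem z t) -> perm_eq s t.
  by move=> H; apply/allP => u _ /=; rewrite H.
case=> l1 l2 l3 l4 U; rewrite !inE => /or4P[] /eqP->.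
- by exists b, c, d.
- by exists a, c, d; split; [split=> //; ucnt U|apply: P => u; cnt].
- by exists a, b, d; split; [split=> //; ucnt U|apply: P => u; cnt].
- by exists a, b, c; split; [split=> //; ucnt U|apply: P => u; cnt].
Qed.

Lemma K24_pick2 x y (a b c d z w : G) : K24_in x y a b c d -> z \in [:: a; b; c; d] ->
  w \in [:: a; b; c; d] -> z != w ->
  exists c' d', K24_in x y z w c' d' /\ perm_eq [:: a; b; c; d] [:: z; w; c'; d'].
Proof.
have P (s t : seq G) : (forall z, count_mem z s = count_mem z t) -> perm_eq s t.
  by move=> H; apply/allP => u _ /=; rewrite H.
move=> K zi wi zw; have [b' [c' [d' [[l1 l2 l3 l4 U] pm]]]] := K24_pick K zi.
move: wi; rewrite (perm_mem pm) !inE eq_sym (negPf zw) /=.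
case/or3P=> /eqP->.
- by exists c', d'.
- by exists b', d'; split; [split=> //; ucnt U|apply: perm_trans pm (P _ _ _) => u; cnt].
- by exists b', c'; split; [split=> //; ucnt U|apply: perm_trans pm (P _ _ _) => u; cnt].
Qed.

Definition K24_edge x y (a b c d u v : G) :=
  (u \in [:: x; y]) && (v \in [:: a; b; c; d]) ||
  (v \in [:: x; y]) && (u \in [:: a; b; c; d]).

Lemma K24_FC x y (a b c d v : G) A : K24_in x y a b c d ->
  v \in [:: x; y; a; b; c; d] -> pend v A FC ->
  uniq ([:: x; y; a; b; c; d] ++ A) -> False.
Proof.
move=> K; rewrite inE => /orP[/eqP->|].
  case: K => l1 l2 l3 l4 U pA {}U.
  leaf (no_K24_FC_2side G_ch l1 l2 l3 l4 pA) U.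
rewrite inE => /orP[/eqP->|vi pA U].
  case: K => l1 l2 l3 l4 U pA {}U.
  leaf (no_K24_FC_2side G_ch (lkV l1) (lkV l2) (lkV l3) (lkV l4) pA) U.
have [b' [c' [d' [[l1 l2 l3 l4 _] pm]]]] := K24_pick K vi.
have {}U : uniq ([:: x; y; v; b'; c'; d'] ++ A).
  apply: (uniq_le U) => z; have /permP/(_ (pred1 z)) := pm; cnt.
have /and3P[xv vy _] : lk x [:: v] y by [].
have vx : lk v [::] x by rewrite lk_nil adj_sym.
have {}vy : lk v [::] y by rewrite lk_nil.
leaf (no_K24_FC_4side G_ch vx vy l2 l3 l4 pA) U.
Qed.

Lemma K24_ear_end x y (a b c d f : G) m : K24_in x y a b c d ->
  f \in [:: y; a; b; c; d] -> lk x m f -> uniq ([:: x; y; a; b; c; d] ++ m) ->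
  (m = [::] -> ~~ K24_edge x y a b c d x f) -> False.
Proof.
move=> K; rewrite inE => /orP[/eqP->|fi] lm U nd.
  case: K => l1 l2 l3 l4 _; have om : odd (size m) by rewrite (lk_odd lm) -(lk_odd l1).
  leaf (no_K25 G_ch l1 l2 l3 l4 lm) U.
have [b' [c' [d' [[l1 l2 l3 l4 _] pm]]]] := K24_pick K fi.
have {}U : uniq ([:: x; y; f; b'; c'; d'] ++ m).
  apply: (uniq_le U) => z; have /permP/(_ (pred1 z)) := pm; cnt.
have /and3P[xf fy _] : lk x [:: f] y by [].
rewrite -!lk_nil in xf fy.
apply: (no_W G_ch colE xf lm l2 l3 fy) => //; first by ucnt U.
by case: m nd {lm U} => // /(_ erefl); rewrite /K24_edge fi !inE eqxx.
Qed.

Lemma K24_ear x y (a b c d e f : G) m : K24_in x y a b c d ->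
  e \in [:: x; y; a; b; c; d] -> f \in [:: x; y; a; b; c; d] -> e != f ->
  lk e m f -> uniq ([:: x; y; a; b; c; d] ++ m) ->
  (m = [::] -> ~~ K24_edge x y a b c d e f) -> False.
Proof.
move=> K; have K' := K24_in_rev K.
have C u v : K24_edge x y a b c d u v = K24_edge x y a b c d v u.
  by rewrite /K24_edge orbC.
have S u v : K24_edge y x a b c d u v = K24_edge x y a b c d u v.
  by rewrite /K24_edge !(inE, orbF) [(u == y) || _]orbC [(v == y) || _]orbC.
rewrite [e \in _]inE; case/orP=> [/eqP-> fi xf lm U nd|].
  apply: (K24_ear_end K _ lm U nd); move: fi xf; rewrite !inE => /orP[/eqP->|//].
  by rewrite eqxx.
rewrite [e \in _]inE; case/orP=> [/eqP-> fi xf lm U nd|].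
  apply: (K24_ear_end K' _ lm _ _).
  - move: fi xf; rewrite !inE => /orP[->//|/orP[/eqP->|->]]; by rewrite ?eqxx ?orbT.
  - by ucnt U.
  - by rewrite S.
move=> ei; rewrite [f \in _]inE; case/orP=> [/eqP-> xf lm U nd|].
  apply: (K24_ear_end K _ (lkV lm)); first by rewrite inE ei orbT.
    by ucnt U.
  by move=> /rev_nil/nd; rewrite C.
rewrite [f \in _]inE; case/orP=> [/eqP-> xf lm U nd|].
  apply: (K24_ear_end K' _ (lkV lm)); first by rewrite inE ei orbT.
    by ucnt U.
  by move=> /rev_nil/nd; rewrite S C.
(* Both ends lie on the side of four: [x], [y] and [e], [f] form a 4-cycle, [x] and [y] have two
   further common neighbors, and the ear links [e] to [f]. *)
move=> fi ef lm U _.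
have [c' [d' [[l1 l2 l3 l4 _] pm]]] := K24_pick2 K ei fi ef.
have {}U : uniq ([:: x; y; e; f; c'; d'] ++ m).
  apply: (uniq_le U) => z; have /permP/(_ (pred1 z)) := pm; cnt.
have /and3P[xe ey _] : lk x [:: e] y by [].
have /and3P[xf fy _] : lk x [:: f] y by [].
rewrite -!lk_nil in xe ey xf fy.
have om := lk_odd lm.
have := lk_odd xe; have := lk_odd xf; rewrite /= => o1 o2.
have {}om : odd (size m) by rewrite om; move: o1 o2; case: (col x) (col e) (col f) => [] [] [].
leaf (no_K4_doubled G_ch l3 lm xe xf (lkV ey) (lkV fy) l4) U.
Qed.

Definition VI_edge (a1 a2 b1 b2 a0 : G) p u v :=
  [|| (u \in [:: a1; a2; a0]) && (v \in [:: b1; b2]),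
      (v \in [:: a1; a2; a0]) && (u \in [:: b1; b2]) | edge_of a1 p a2 u v].

Lemma VI_edgeC a1 a2 b1 b2 a0 p u v : VI_edge a1 a2 b1 b2 a0 p u v = VI_edge a1 a2 b1 b2 a0 p v u.
Proof. by rewrite /VI_edge edge_ofC orbCA. Qed.

Lemma VI_in_swap_a (a1 a2 b1 b2 a0 : G) p : VI_in a1 a2 b1 b2 a0 p ->
  VI_in a2 a1 b1 b2 a0 (rev p).
Proof. by case=> -[l1 l2 l3 l4] l5 l6 U; split=> //; [exact: lkV|ucnt U]. Qed.

Lemma VI_in_swap_b (a1 a2 b1 b2 a0 : G) p : VI_in a1 a2 b1 b2 a0 p ->
  VI_in a1 a2 b2 b1 a0 p.
Proof. by case=> -[l1 l2 l3 l4] /lkV l5 l6 U; split=> //; ucnt U. Qed.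

Lemma VI_edge_swap_a a1 a2 b1 b2 a0 p u v :
  VI_edge a2 a1 b1 b2 a0 (rev p) u v = VI_edge a1 a2 b1 b2 a0 p u v.
Proof.
by rewrite /VI_edge edge_of_rev !inE [(u == a2) || _]orbCA [(v == a2) || _]orbCA.
Qed.

Lemma VI_edge_swap_b a1 a2 b1 b2 a0 p u v :
  VI_edge a1 a2 b2 b1 a0 p u v = VI_edge a1 a2 b1 b2 a0 p u v.
Proof. by rewrite /VI_edge !inE [(u == b2) || _]orbC [(v == b2) || _]orbC. Qed.

(** This theta graph spans all the vertices and contains an edge as one of its paths, so [theta_FC]
    forbids a further cycle at any vertex. *)
Lemma VI_theta (a1 a2 b1 b2 a0 : G) p : VI_in a1 a2 b1 b2 a0 p ->
  theta_in a2 b2 [::] [:: b1; a0] (rev p ++ [:: a1]).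
Proof.
case=> -[l1 l2 l3 l4] l5 l6 U; split; rewrite ?lk_nil //.
- have /and3P[x1 x2 _] : lk b1 [:: a0] b2 by [].
  by apply/and4P.
- by rewrite lk_cat -lk_rev l6 lk_nil.
- by ucnt U.
by slia.
Qed.

Lemma VI_FC (a1 a2 b1 b2 a0 v : G) p A : VI_in a1 a2 b1 b2 a0 p ->
  v \in a1 :: a2 :: b1 :: b2 :: a0 :: p -> pend v A FC ->
  uniq ((a1 :: a2 :: b1 :: b2 :: a0 :: p) ++ A) -> False.
Proof.
move=> V vi pA U.
have := theta_FC (VI_theta V) _ pA; rewrite /= => H; suff: false by [].
apply: H; last by ucnt U.
by apply: subset_count vi => z; cnt.
Qed.

Lemma adj_lk x y : adj x y -> lk x [::] y * lk y [::] x.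
Proof. by rewrite !lk_nil [adj y x]adj_sym. Qed.

Section VIEars.
Variables (a1 a2 b1 b2 a0 : G) (p m : seq G).
Hypothesis V : VI_in a1 a2 b1 b2 a0 p.
Hypothesis U : uniq ((a1 :: a2 :: b1 :: b2 :: a0 :: p) ++ m).
Notation edge := (VI_edge a1 a2 b1 b2 a0 p).

Let E11 : lk a1 [::] b1 * lk b1 [::] a1.
Proof. by case: V => -[*]; apply: adj_lk. Qed.
Let E12 : lk a1 [::] b2 * lk b2 [::] a1.
Proof. by case: V => -[*]; apply: adj_lk. Qed.
Let E21 : lk a2 [::] b1 * lk b1 [::] a2.
Proof. by case: V => -[*]; apply: adj_lk. Qed.
Let E22 : lk a2 [::] b2 * lk b2 [::] a2.
Proof. by case: V => -[*]; apply: adj_lk. Qed.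
Let E01 : lk a0 [::] b1 * lk b1 [::] a0.
Proof. by case: V => _ /and3P[*]; apply: adj_lk; rewrite // adj_sym. Qed.
Let E02 : lk a0 [::] b2 * lk b2 [::] a0.
Proof. by case: V => _ /and3P[*]; apply: adj_lk; rewrite // adj_sym. Qed.
Let lp : lk a1 p a2. Proof. by case: V. Qed.
Let lb1 : lk a1 [:: b1] a2. Proof. by rewrite (lk_cat a1 [::]) E11 E21. Qed.
Let lb2 : lk a1 [:: b2] a2. Proof. by rewrite (lk_cat a1 [::]) E12 E22. Qed.
Let la0 : lk b1 [:: a0] b2. Proof. by case: V. Qed.
Let la1 : lk b1 [:: a1] b2. Proof. by rewrite (lk_cat b1 [::]) E11 E12. Qed.
Let la2 : lk b1 [:: a2] b2. Proof. by rewrite (lk_cat b1 [::]) E21 E22. Qed.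
Let op : odd (size p).
Proof. by rewrite (lk_odd lp) -(lk_odd lb1). Qed.

Let ne u v : (m = [::] -> ~~ edge u v) -> edge u v -> 0 < size m.
Proof. by case: m => // H e; move: (H erefl); rewrite e. Qed.

Lemma VI_ear_a1b1 : lk a1 m b1 -> (m = [::] -> ~~ edge a1 b1) -> False.
Proof.
move=> lm nd; apply: (no_W G_ch colE E11.1 lm lp lb2 E21.2) => //; [ucnt U| |slia].
by apply: (ne nd); rewrite /VI_edge !inE !eqxx.
Qed.

Lemma VI_ear_a1a2 : lk a1 m a2 -> False.
Proof.
move=> lm; have om : odd (size m) by rewrite (lk_odd lm) -(lk_odd lb1).
leaf (no_K4_doubled G_ch lp la0 E11.1 E12.1 E21.1 E22.1 lm) U.
Qed.

Lemma VI_ear_b1b2 : lk b1 m b2 -> False.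
Proof.
move=> lm; have om : odd (size m) by rewrite (lk_odd lm) -(lk_odd la0).
leaf (no_K4_doubled G_ch la0 lp E11.2 E21.2 E12.2 E22.2 lm) U.
Qed.

Lemma VI_ear_b1a0 : lk b1 m a0 -> (m = [::] -> ~~ edge b1 a0) -> False.
Proof.
move=> lm nd; apply: (no_W G_ch colE E01.2 lm la1 la2 E02.1) => //; first by ucnt U.
by apply: (ne nd); rewrite /VI_edge !inE !eqxx !orbT.
Qed.

Lemma VI_ear_a1a0 : lk a1 m a0 -> False.
Proof.
move=> lm; have l1 : lk a1 [:: b1] a0 by rewrite (lk_cat a1 [::]) E11 E01.
have l2 : lk a1 (p ++ [:: a2]) b2 by rewrite lk_cat lp E22.
by apply: (no_W G_ch colE l1 lm E12.1 l2 E02.1); [ucnt U| slia |slia].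
Qed.

Lemma VI_ear_a1p p1 z p2 : p = p1 ++ z :: p2 -> lk a1 m z ->
  (m = [::] -> ~~ edge a1 z) -> False.
Proof.
move=> Ep lm /ne ned; have := lp; rewrite Ep lk_cat => /andP[l1 l2].
have := U; rewrite Ep => U'.
apply: (no_W G_ch colE l1 lm lb1 lb2 l2) => //; first by ucnt U'.
case: p1 Ep l1 U' => // Ep _ _; apply: ned.
by rewrite /VI_edge Ep edge_of_nil !orbT.
Qed.

Lemma VI_ear_b1p p1 z p2 : p = p1 ++ z :: p2 -> lk b1 m z -> False.
Proof.
move=> Ep lm; have := lp; rewrite Ep lk_cat => /andP[l1 l2].
have := U; rewrite Ep => U'.
have l3 : lk b1 (a1 :: p1) z by rewrite (lk_cat b1 [::]) E11 l1.
have l4 : lk b1 [:: a0; b2] a2 by rewrite (lk_cat b1 [::]) E01 (lk_cat a0 [::]) E02 E22.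
by apply: (no_W G_ch colE l3 lm E21.2 l4 l2) => //; ucnt U'.
Qed.

Lemma VI_ear_pp p1 z p2 w p3 : p = p1 ++ z :: p2 ++ w :: p3 -> lk z m w ->
  (m = [::] -> ~~ edge z w) -> False.
Proof.
move=> Ep lm /ne ned; have := lp; rewrite Ep !lk_cat => /and3P[l1 l2 l3].
have := U; rewrite Ep => U'.
apply: (no_N G_ch colE lm l2 (lkV lb1) (lkV lb2) l3 l1) => //; first by ucnt U'.
case: p2 Ep l2 U' => [|? ?] Ep _ _; last by slia.
rewrite addn0; apply: ned; rewrite /VI_edge; do 2!(apply/orP; right).
rewrite /edge_of; apply/orP; left; apply/stepsP; rewrite Ep.
by exists (a1 :: p1), (rcons p3 a2); rewrite /= rcons_cat.
Qed.

(** The branch vertices [a2], [b2], [a0], [z] span a subdivided complete graph whose link from [a2]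
    to [a0], through [b1], has length 2. This leaves one alternative of [K4], where [z] is adjacent
    to [a2] and the ear is an edge. *)
Lemma VI_ear_a0p_half p1 z p2 : p = p1 ++ z :: p2 -> lk a0 m z -> p2 = [::] /\ m = [::].
Proof.
move=> Ep lm; have := lp; rewrite Ep lk_cat => /andP[l1 l2].
have := U; rewrite Ep => U'.
have l3 : lk a2 [:: b1] a0 by rewrite (lk_cat a2 [::]) E21 E01.
have l4 : lk b2 (a1 :: p1) z by rewrite (lk_cat b2 [::]) E12 l1.
have := K4 G_ch colE E22.1 lm l3 (lkV l2) E02.2 l4; rewrite /= size_rev.
case; first by ucnt U'.
all: by move=> H; split; apply: size0nil; slia.
Qed.
End VIEars.

(** Used from both ends of [p], the previous restriction leaves only the missing edge, which would
    complete K_{3,3}. *)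
Lemma VI_ear_a0p (a1 a2 b1 b2 a0 : G) p m p1 z p2 : VI_in a1 a2 b1 b2 a0 p ->
  uniq ((a1 :: a2 :: b1 :: b2 :: a0 :: p) ++ m) ->
  p = p1 ++ z :: p2 -> lk a0 m z -> False.
Proof.
move=> V U Ep lm.
have [E2 Em] := VI_ear_a0p_half V U Ep lm.
have Er : rev p = rev p2 ++ z :: rev p1 by rewrite Ep rev_cat rev_cons cat_rcons.
have Ur : uniq ((a2 :: a1 :: b1 :: b2 :: a0 :: rev p) ++ m) by ucnt U.
have [E1 _] := VI_ear_a0p_half (VI_in_swap_a V) Ur Er lm.
have {}E1 := rev_nil E1; subst p1 p2 m p.
case: V => -[l1 l2 l3 l4] l5 l6 _.
have /and3P[x1 x2 _] : lk b1 [:: a0] b2 by [].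
have /and3P[x3 x4 _] : lk a1 [:: z] a2 by [].
rewrite [adj b1 a0]adj_sym in x1; rewrite [adj z a2]adj_sym in x4.
rewrite -!lk_nil in l1 l2 l3 l4 x1 x2 x3 x4.
leaf (no_K33 G_ch x1 x2 lm l1 l2 x3 l3 l4 x4) U.
Qed.

Lemma splitPr_ex (T : eqType) (s : seq T) (z : T) : z \in s -> exists s1 s2, s = s1 ++ z :: s2.
Proof. by case/splitPr=> s1 s2; exists s1, s2. Qed.

Section VIEar.
Variables (a1 a2 b1 b2 a0 : G) (p : seq G).
Hypothesis V : VI_in a1 a2 b1 b2 a0 p.

Let noear e f := forall m, uniq ((a1 :: a2 :: b1 :: b2 :: a0 :: p) ++ m) -> lk e m f ->
  (m = [::] -> ~~ VI_edge a1 a2 b1 b2 a0 p e f) -> False.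

Let noearC e f : noear e f -> noear f e.
Proof.
move=> H m U lm nd; apply: (H (rev m) _ (lkV lm)); first by ucnt U.
by move=> /rev_nil/nd; rewrite VI_edgeC.
Qed.

Lemma VI_noear e f : e \in a1 :: a2 :: b1 :: b2 :: a0 :: p ->
  f \in a1 :: a2 :: b1 :: b2 :: a0 :: p -> e != f -> noear e f.
Proof.
have Va := VI_in_swap_a V; have Vb := VI_in_swap_b V; have Vab := VI_in_swap_b Va.
have a1b1 : noear a1 b1 by move=> m U lm nd; apply: (VI_ear_a1b1 V U lm nd).
have a1b2 : noear a1 b2.
  by move=> m U lm nd; apply: (VI_ear_a1b1 Vb _ lm); [ucnt U|rewrite VI_edge_swap_b].
have a2b1 : noear a2 b1.
  by move=> m U lm nd; apply: (VI_ear_a1b1 Va _ lm); [ucnt U|rewrite VI_edge_swap_a].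
have a2b2 : noear a2 b2.
  by move=> m U lm nd; apply: (VI_ear_a1b1 Vab _ lm);
    [ucnt U|rewrite VI_edge_swap_b VI_edge_swap_a].
have a1a2 : noear a1 a2 by move=> m U lm nd; apply: (VI_ear_a1a2 V U lm).
have b1b2 : noear b1 b2 by move=> m U lm nd; apply: (VI_ear_b1b2 V U lm).
have b1a0 : noear b1 a0 by move=> m U lm nd; apply: (VI_ear_b1a0 V U lm nd).
have b2a0 : noear b2 a0.
  by move=> m U lm nd; apply: (VI_ear_b1a0 Vb _ lm); [ucnt U|rewrite VI_edge_swap_b].
have a1a0 : noear a1 a0 by move=> m U lm nd; apply: (VI_ear_a1a0 V U lm).
have a2a0 : noear a2 a0 by move=> m U lm nd; apply: (VI_ear_a1a0 Va _ lm); ucnt U.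
have a1p z : z \in p -> noear a1 z.
  by case/splitPr_ex=> p1 [p2 Ep] m U lm nd; apply: (VI_ear_a1p V U Ep lm nd).
have a2p z : z \in p -> noear a2 z.
  case/splitPr_ex=> p1 [p2 Ep] m U lm nd.
  apply: (VI_ear_a1p (p1 := rev p2) (p2 := rev p1) Va _ _ lm); first by ucnt U.
    by rewrite Ep rev_cat rev_cons cat_rcons.
  by rewrite VI_edge_swap_a.
have b1p z : z \in p -> noear b1 z.
  by case/splitPr_ex=> p1 [p2 Ep] m U lm nd; apply: (VI_ear_b1p V U Ep lm).
have b2p z : z \in p -> noear b2 z.
  by case/splitPr_ex=> p1 [p2 Ep] m U lm nd; apply: (VI_ear_b1p Vb _ Ep lm); ucnt U.
have a0p z : z \in p -> noear a0 z.
  by case/splitPr_ex=> p1 [p2 Ep] m U lm nd; apply: (VI_ear_a0p V U Ep lm).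
have pp z w : z \in p -> w \in p -> z != w -> noear z w.
  case/splitPr_ex=> p1 [p2 Ep]; rewrite Ep mem_cat inE => /or3P[wp|/eqP->|wp] zw.
  - case: (splitPr_ex wp) => s1 [s2 Es]; apply: noearC => m U lm nd.
    by apply: (VI_ear_pp V U _ lm nd); rewrite Ep Es -catA.
  - by rewrite eqxx in zw.
  case: (splitPr_ex wp) => s1 [s2 Es] m U lm nd.
  by apply: (VI_ear_pp V U _ lm nd); rewrite Ep Es.
rewrite !inE.
move=> /or4P[/eqP->|/eqP->|/eqP->|/or3P[/eqP->|/eqP->|ep]];
move=> /or4P[/eqP->|/eqP->|/eqP->|/or3P[/eqP->|/eqP->|fp]] ef;
  by [rewrite eqxx in ef|auto|apply: noearC; auto].
Qed.
End VIEar.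

End DenseCores.

(** * The two-core and the search for ears *)

Section Core.
Variable G : sgraph.
Implicit Types (x y z : G) (p q c d : seq G).

Lemma min_degree2P (S : {set G}) :
  reflect (forall x, x \in S -> exists y z,
     [/\ y \in S, z \in S, y != z, adj x y & adj x z])
    (min_degree2 (induced S)).
Proof.
apply: (iffP forallP) => [H x xS|H [x xS]].
  have /card_gt1P[[y yS] [[z zS] []]] := H (Sub x xS).
  by rewrite !inE => xy xz yz; exists y, z.
have [y [z [yS zS yz xy xz]]] := H x xS.
by apply/card_gt1P; exists (Sub y yS), (Sub z zS); rewrite !inE.
Qed.

Lemma two_core_max : min_degree2 (induced (two_core G)) /\
  forall S : {set G}, min_degree2 (induced S) -> #|S| <= #|two_core G|.
Proof.
rewrite /two_core; case: arg_maxnP => [|K mK max]; last by split.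
by apply/min_degree2P => x; rewrite inE.
Qed.

Lemma two_coreP x : x \in two_core G -> exists y z,
  [/\ y \in two_core G, z \in two_core G, y != z, adj x y & adj x z].
Proof. by move: x; apply/min_degree2P; case: two_core_max. Qed.

(** Minimum degree 2 survives unions, so a set of maximum size contains every such set. *)
Lemma sub_two_core (S : {set G}) : min_degree2 (induced S) -> S \subset two_core G.
Proof.
move=> mS; have [mK max] := two_core_max.
have : min_degree2 (induced (S :|: two_core G)).
  apply/min_degree2P => x; rewrite inE => /orP[/(min_degree2P _ mS)|/(min_degree2P _ mK)];
    by move=> [y [z [yS zS yz xy xz]]]; exists y, z; split=> //; rewrite inE ?yS ?zS ?orbT.
move=> /max le.
have /eqP -> : two_core G == S :|: two_core G by rewrite eqEcard subsetUr.
exact: subsetUl.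
Qed.

Hypothesis G_conn : connected G.

Lemma path_from_set (S : {pred G}) x p : x \in S -> path adj x p ->
  last x p \notin S -> exists x' p', [/\ x' \in S, path adj x' p',
    {in p', forall z, z \notin S}, last x' p' = last x p & p' != [::]].
Proof.
move=> xS; elim/last_ind: p => [|p z IH]; first by rewrite /= xS.
rewrite rcons_path last_rcons => /andP[pp lz] zS.
case: (boolP (last x p \in S)) => [lS|/(IH pp)[x' [p' [xS' pp' nS E _]]]].
  by exists (last x p), [:: z]; rewrite /= lz; split=> // w; rewrite inE => /eqP->.
exists x', (rcons p' z); rewrite rcons_path pp' E lz last_rcons; split=> //; last by case: p' {pp' nS E}.
by move=> w; rewrite mem_rcons inE => /orP[/eqP->|/nS].
Qed.

Definition no_ear (S : seq G) (h : rel G) :=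
  {subset two_core G <= S} /\ forall x y, x \in S -> y \in S -> adj x y -> h x y.

(** [h] records the edges already built. An ear with empty [m] is a chord and must be a new edge. *)
Definition open_ear (S : seq G) (h : rel G) := exists e f m,
  [/\ e \in S, f \in S, e != f, lk e m f &
      uniq (S ++ m) /\ (m = [::] -> ~~ h e f)].

Definition lol_ear (S : seq G) := exists v c d,
  [/\ v \in S, lol v c d & uniq (S ++ c ++ d)].

Lemma uniq_disj (S m : seq G) : uniq S -> uniq m -> {in m, forall z, z \notin S} ->
  uniq (S ++ m).
Proof. by move=> uS um H; rewrite cat_uniq uS um andbT; apply/hasPn. Qed.

(** The path is prolonged inside the two-core, where each vertex has a neighbor other than its
    predecessor, until it meets [S] or itself. The number of vertices bounds its length. *)
Lemma ear_from_path (S : seq G) h x p : uniq S -> x \in S -> path adj x p ->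
  uniq (x :: p) -> {in p, forall z, z \notin S} -> p != [::] ->
  last x p \in two_core G -> open_ear S h \/ lol_ear S.
Proof.
move=> uS xS; have [n] := ubnP (#|G| - size p); elim: n p => // n IH p lt.
case/lastP: p lt => // q y lt pp U nS _; rewrite last_rcons => yK.
have : exists z, [/\ z \in two_core G, adj y z & z != last x q].
  have [z1 [z2 [z1K z2K z12 a1 a2]]] := two_coreP yK.
  case: (eqVneq z1 (last x q)) => [E|]; last by exists z1.
  by exists z2; rewrite -E eq_sym z12.
move=> [z [zK yz zq]]; move: pp; rewrite rcons_path => /andP[pq qy].
have Uq : uniq (rcons q y) by case/andP: U.
case: (boolP (z \in S)) => zS.
  (* Back at the start: a lollipop with empty stem. Here [q] is not empty, as otherwise [z] would be
     the predecessor of [y]. *)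
  have [E|zx] := eqVneq z x.
    right; exists x, [::], (rcons q y); split=> //; last exact: uniq_disj.
    split=> //; first by rewrite /lk rcons_path rcons_path pq qy last_rcons -E.
    rewrite size_rcons; case: q zq {lt pq qy U nS Uq} => //=.
    by rewrite E eqxx.
  left; exists x, z, (rcons q y); split=> //; first by rewrite eq_sym.
    by rewrite /lk !rcons_path pq qy last_rcons.
  split; first exact: uniq_disj.
  by case: q {lt pq qy U nS zq Uq}.
have zx : z != x by apply: contraNneq zS => ->.
have zy : z != y by apply: contraTneq yz => ->; rewrite adj_irr.
case: (boolP (z \in rcons q y)) => zp.
  (* The path meets itself at [z]: its part up to [z] is the stem, the rest closes the cycle. *)
  right; move: zp; rewrite mem_rcons inE (negPf zy) /= => zp.
  case/splitPr: zp pq qy U nS zq Uq lt => p1 p2; rewrite cat_path last_cat /=.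
  move=> /and3P[p1p lz zp2] ly U nS zq Uq _.
  exists x, (rcons p1 z), (rcons p2 y).
  have E : rcons p1 z ++ rcons p2 y = rcons (p1 ++ z :: p2) y.
    by rewrite cat_rcons rcons_cat.
  split; rewrite ?E //; last exact: uniq_disj.
  split; rewrite ?E ?last_rcons //; first by rewrite rcons_path p1p.
    by rewrite /lk !rcons_path zp2 ly last_rcons.
  by rewrite size_rcons; case: p2 zq {lz zp2 ly U nS Uq E} => //=; rewrite eqxx.
apply: (IH (rcons (rcons q y) z)).
- have : size (x :: rcons q y) <= #|G| by rewrite -(card_uniqP U) max_card.
  move: lt; rewrite /= !size_rcons; move: #|G| (size q) => a b; clear; lia.
- by rewrite !rcons_path pq qy last_rcons.
- by rewrite -rcons_cons rcons_uniq inE negb_or zx zp.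
- by move=> w; rewrite mem_rcons inE => /orP[/eqP->|/nS].
- by case: (rcons q y).
- by rewrite last_rcons.
Qed.

Lemma ear_cases (S : seq G) h : uniq S -> S != [::] ->
  [\/ no_ear S h, open_ear S h | lol_ear S].
Proof.
move=> uS S0; have [x0 x0S] : exists x, x \in S.
  by case: S S0 {uS} => // x S _; exists x; rewrite mem_head.
case: (boolP [forall x, (x \in two_core G) ==> (x \in S)]) => [/forallP sub|].
  case: (boolP [forall x, forall y, [&& x \in S, y \in S & adj x y] ==> h x y]).
    move=> /forallP H; apply: Or31; split=> [x|x y xS yS xy].
      exact: implyP (sub x).
    by have /forallP/(_ y) := H x; rewrite xS yS xy.
  rewrite negb_forall => /existsP[x]; rewrite negb_forall => /existsP[y].
  rewrite negb_imply => /andP[/and3P[xS yS xy] nh]; apply: Or32.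
  exists x, y, [::]; rewrite lk_nil cats0; split=> //.
  by apply: contraTneq xy => ->; rewrite adj_irr.
rewrite negb_forall => /existsP[y]; rewrite negb_imply => /andP[yK yS].
have /andP[_ /forallP/(_ x0)/forallP/(_ y)/connectP[p pp Ey]] := G_conn.
have [|x [q [xS pq nS E q0]]] := path_from_set x0S pp; first by rewrite -Ey.
rewrite -Ey in E; case/shortenP: pq E nS q0 => q' pq' uq' sub {}E nS q0.
have lK : last x q' \in two_core G by rewrite E.
have n0 : q' != [::] by apply: contraNneq yS => q'0; rewrite -E q'0.
have nS' : {in q', forall z, z \notin S} by move=> z /sub /nS.
by case: (ear_from_path h uS xS pq' uq' nS' n0 lK); [apply: Or32|apply: Or33].
Qed.

End Core.

Lemma perm_count (T : eqType) (s1 s2 : seq T) :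
  (forall z, count_mem z s1 = count_mem z s2) -> perm_eq s1 s2.
Proof. by move=> H; apply/allP => z _ /=; rewrite H. Qed.

Ltac pcnt := apply: perm_count => ?; cnt.

Lemma count_remove (T : eqType) (s : seq T) x a : uniq s -> x \in s ->
  count_mem a [seq z <- s | z != x] + (x == a) = count_mem a s.
Proof.
move=> us xs; rewrite -(rem_filter x us) (permP (perm_to_rem xs) (pred1 a)) /=.
by rewrite addnC.
Qed.

(** * How a lollipop grows by one ear *)

Section Growth.
Variable G : sgraph.
Hypothesis G_ch : choosable 4 2 G.
Variable col : G -> bool.
Hypothesis colE : forall x y, adj x y -> col x != col y.
Implicit Types (x y z u v w e f s t : G) (p q c d m k A B : seq G).

Let lk_odd := lk_odd colE.

Lemma steps_path v c1 z c2 : (last v c1, z) \in steps (v :: c1 ++ z :: c2).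
Proof.
apply/stepsP; elim: c1 v => [|a c1 IH] v /=; first by exists [::], c2.
by have [s1 [s2 E]] := IH a; exists (v :: s1), s2; rewrite /= E.
Qed.

Lemma cyc_ear_theta x c e f m : lk x c x -> 1 < size c -> e \in x :: c ->
  f \in x :: c -> e != f -> lk e m f -> uniq (x :: c ++ m) ->
  (m = [::] -> ~~ edge_of x c x e f) ->
  exists x' y p q r, theta_in x' y p q r /\ perm_eq (x' :: y :: p ++ q ++ r) (x :: c ++ m).
Proof.
move=> lc sc.
have head f' m' : f' \in c -> lk x m' f' -> uniq (x :: c ++ m') ->
    (m' = [::] -> ~~ edge_of x c x x f') ->
    exists x' y p q r, theta_in x' y p q r /\ perm_eq (x' :: y :: p ++ q ++ r) (x :: c ++ m').
  move=> fc lm U nd; case/splitPr: fc lc sc U nd => c1 c2; rewrite lk_cat => /andP[l1 l2] sc U nd.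
  exists x, f', c1, (rev c2), m'; split; last by pcnt.
  split=> //; [exact: lkV|ucnt U|].
  have n1 : 0 < size c1 + size m'.
    by case: c1 m' nd {l1 l2 sc U lm} => // -[] // /(_ erefl); rewrite edge_of_nil.
  have n2 : 0 < size c2 + size m'.
    case: c2 m' nd {l1 l2 sc U lm n1} => // -[] // /(_ erefl) /negP[].
    by rewrite edge_ofC /edge_of; apply/orP; left; apply/stepsP; exists (x :: c1), [::]; rewrite /= rcons_cat.
  by rewrite !size_cat /= in sc; slia.
have mid e' f' m' d1 d2 d3 : c = d1 ++ e' :: d2 ++ f' :: d3 -> lk e' m' f' ->
    uniq (x :: c ++ m') -> (m' = [::] -> ~~ edge_of x c x e' f') ->
    exists x' y p q r, theta_in x' y p q r /\ perm_eq (x' :: y :: p ++ q ++ r) (x :: c ++ m').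
  move=> Ec; have := lc; rewrite Ec !lk_cat => /and3P[l1 l2 l3] lm U nd.
  exists e', f', d2, m', (rev d1 ++ x :: rev d3); split; last by pcnt.
  split=> //; [by rewrite lk_cat -!lk_rev l1|ucnt U|].
  suff n1 : 0 < size d2 + size m' by slia.
  case: d2 m' nd {l1 l2 l3 U lm Ec} => // -[] // /(_ erefl) /negP[].
  by rewrite /edge_of; apply/orP; left; apply/stepsP; exists (x :: d1), (rcons d3 x);
    rewrite /= rcons_cat.
have sw e' f' : (rev m = [::] -> ~~ edge_of x c x e' f') <-> (m = [::] -> ~~ edge_of x c x f' e').
  rewrite edge_ofC; split=> H E; apply: H; first by rewrite E.
  exact: rev_nil.
have pr : perm_eq (x :: c ++ rev m) (x :: c ++ m) by pcnt.
rewrite !inE => /orP[/eqP->|ec] /orP[/eqP->|fc] ef lm U nd.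
- by rewrite eqxx in ef.
- exact: (head f m fc lm U nd).
- have [|x' [y [p [q [r [T pm]]]]]] := head e (rev m) ec (lkV lm) _ (proj2 (sw _ _) nd).
    by rewrite (perm_uniq pr).
  by exists x', y, p, q, r; rewrite (perm_trans pm).
have [c1 [c2 Ec]] := splitPr_ex ec.
have : (f \in c1) || (f \in c2).
  by move: fc; rewrite Ec mem_cat inE eq_sym (negPf ef).
case/orP=> /splitPr_ex[d1 [d2 Ed]].
  have [||x' [y [p [q [r [T pm]]]]]] := mid f e (rev m) d1 d2 c2 _ (lkV lm) _ (proj2 (sw _ _) nd).
  - by rewrite Ec Ed -catA.
  - by rewrite (perm_uniq pr).
  by exists x', y, p, q, r; rewrite (perm_trans pm).
by apply: (mid e f m c1 d1 d2) => //; rewrite Ec Ed.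
Qed.

Definition lol_edge v c d u z :=
  [|| (u, z) \in steps (v :: c), (z, u) \in steps (v :: c) |
      edge_of (last v c) d (last v c) u z].

Lemma lol_edgeC v c d u z : lol_edge v c d u z = lol_edge v c d z u.
Proof. by rewrite /lol_edge edge_ofC orbCA. Qed.

(** In a star two lollipops share a root at the end of a stem [k]. In the two forms that follow, the
    stem leads to a cycle bearing a lollipop at another vertex [t], or to a theta graph. *)
Definition star_at v A := exists k c1 d1 c2 d2,
  [/\ path adj v k, lol (last v k) c1 d1, lol (last v k) c2 d2,
      uniq (v :: k ++ c1 ++ d1 ++ c2 ++ d2) & {subset k ++ c1 ++ d1 ++ c2 ++ d2 <= A}].

Definition chain_at v A := exists k p t q c1 d1,
  [/\ path adj v k, lk (last v k) p t /\ lk (last v k) q t, lol t c1 d1 /\ 0 < size p + size q,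
      uniq (v :: k ++ t :: p ++ q ++ c1 ++ d1) &
      {subset k ++ t :: p ++ q ++ c1 ++ d1 <= A}].

Definition theta_at v A := exists k x y p q r,
  let T := x :: y :: p ++ q ++ r in
  [/\ path adj v k, theta_in x y p q r, last v k \in T,
      uniq (v :: k ++ [seq z <- T | z != last v k]) &
      {subset k ++ [seq z <- T | z != last v k] <= A}].

Definition grown v A := [\/ star_at v A, chain_at v A | theta_at v A].

Lemma last_split v c e : e \in v :: c -> exists c1 c2, c = c1 ++ c2 /\ last v c1 = e.
Proof.
rewrite inE => /orP[/eqP->|/splitPr_ex[c1 [c2 ->]]]; first by exists [::], c.
by exists (rcons c1 e), c2; rewrite cat_rcons last_rcons.
Qed.

(** A second lollipop on the stem makes a star; on the cycle away from the stem it makes a chain. *)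
Lemma lol_lol_ear v c d e c2 d2 : lol v c d -> e \in v :: c ++ d -> lol e c2 d2 ->
  uniq (v :: c ++ d ++ c2 ++ d2) -> grown v (c ++ d ++ c2 ++ d2).
Proof.
move=> [pc ld sd u0]; rewrite -cat_cons mem_cat => /orP[ec|ed] le U.
  have [k [c1 [Ec Ee]]] := last_split ec; subst c e; apply: Or31.
  rewrite cat_path last_cat in pc ld; case/andP: pc => pk pc1.
  exists k, c1, d, c2, d2; split=> //; [|by ucnt U|by scnt].
  by split=> //; apply: (uniq_le U) => a; have := count_belast k v a; cnt.
apply: Or32; case/splitPr: ed ld sd u0 U => d1 d3; rewrite lk_cat => /andP[l1 l3] sd u0 U.
exists c, d1, e, (rev d3), c2, d2; split=> //; [|split=> //|by ucnt U|by scnt].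
  by split=> //; apply: lkV.
by rewrite size_cat /= in sd; slia.
Qed.

Lemma rev_conn_cnt v k a : count_mem a (rev (belast v k)) + (last v k == a) =
  (v == a) + count_mem a k.
Proof. by rewrite count_rev count_belast. Qed.

Lemma lol_open_ear v c d e f m : lol v c d -> e \in v :: c ++ d -> f \in v :: c ++ d ->
  e != f -> lk e m f -> uniq (v :: c ++ d ++ m) ->
  (m = [::] -> ~~ lol_edge v c d e f) -> grown v (c ++ d ++ m).
Proof.
move=> L; have [pc ld sd u0] := L.
(* The ear and the stem between its ends form a cycle, and the rest of the lollipop hangs at [f']: a
   chain. *)
have onpath e' f' m' c1 c2 : c = c1 ++ c2 -> last v c1 = e' -> f' \in c2 -> lk e' m' f' ->
    uniq (v :: c ++ d ++ m') -> (m' = [::] -> ~~ lol_edge v c d e' f') ->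
    grown v (c ++ d ++ m').
  move=> Ec Ee /splitPr_ex[k [c3 Ec2]] lm U nd; subst c2 c e'.
  move: pc; rewrite cat_path cat_path /= => /and4P[p1 p2 kf p3].
  apply: Or32; exists c1, k, f', m', c3, d; split=> //; [|split|by ucnt U|by scnt].
  - by rewrite lk_last p2 kf.
  - rewrite !last_cat /= in ld; split=> //.
    by ucnt U.
  case: k m' nd {p2 kf U lm ld sd u0 L} => // -[] // /(_ erefl) /negP[].
  by rewrite /lol_edge steps_path.
have oncycle e' f' m' : e' \in last v c :: d -> f' \in last v c :: d -> e' != f' ->
    lk e' m' f' -> uniq (v :: c ++ d ++ m') -> (m' = [::] -> ~~ lol_edge v c d e' f') ->
    grown v (c ++ d ++ m').
  move=> e'i f'i ef lm U nd; apply: Or33.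
  have U' : uniq (last v c :: d ++ m').
    by apply: (uniq_le U) => a; have := count_belast c v a; cnt.
  have [x [y [p [q [r [T pm]]]]]] : exists x y p q r, theta_in x y p q r /\
      perm_eq (x :: y :: p ++ q ++ r) (last v c :: d ++ m').
    apply: (cyc_ear_theta ld sd e'i f'i ef lm U').
    by move=> /nd; rewrite /lol_edge !negb_or => /and3P[].
  have UT : uniq (x :: y :: p ++ q ++ r) by rewrite (perm_uniq pm).
  have wT : last v c \in x :: y :: p ++ q ++ r by rewrite (perm_mem pm) mem_head.
  exists c, x, y, p, q, r; split=> //.
    apply: (uniq_le U) => a; have := count_remove a UT wT; have := permP pm (pred1 a).
    by have := count_belast c v a; cnt.
  apply: subset_count => a; have := count_remove a UT wT; have := permP pm (pred1 a).
  by have := count_belast c v a; cnt.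
(* The stem between [e'] and the cycle, traversed backwards and followed by the ear, is an ear of
   the cycle, so a theta graph arises. *)
have mixed e' f' m' : e' \in v :: c -> f' \in d -> lk e' m' f' ->
    uniq (v :: c ++ d ++ m') -> (m' = [::] -> ~~ lol_edge v c d e' f') ->
    grown v (c ++ d ++ m').
  move=> e'c f'd lm U nd; have [c1 [c2 [Ec Ee]]] := last_split e'c.
  have [w Ew] : exists w, w = last v c by exists (last v c).
  have := pc; rewrite Ec cat_path Ee => /andP[pc1 pc2].
  have Ew2 : last e' c2 = w by rewrite Ew Ec last_cat Ee.
  have [rp rl] := rev_conn pc2; rewrite Ew2 in rp rl.
  apply: Or33; rewrite -Ew in ld.
  have C1 a := count_belast c1 v a; have C2 a := rev_conn_cnt e' c2 a.
  have C3 a : count_mem a c = count_mem a c1 + count_mem a c2 by rewrite Ec count_cat.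
  rewrite Ee in C1; rewrite Ew2 in C2.
  have lm' : lk w (rev (belast e' c2) ++ m') f' by rewrite lk_path_cat rp rl.
  have U' : uniq (w :: d ++ rev (belast e' c2) ++ m').
    by apply: (uniq_le U) => a; move: (C1 a) (C2 a) (C3 a); cnt.
  have [x [y [p [q [r [T pm]]]]]] : exists x y p q r, theta_in x y p q r /\
      perm_eq (x :: y :: p ++ q ++ r) (w :: d ++ rev (belast e' c2) ++ m').
    apply: (cyc_ear_theta ld sd _ _ _ lm' U'); rewrite ?mem_head ?inE ?f'd ?orbT //.
      by apply: contraTneq U' => E; rewrite /= mem_cat E f'd.
    case: c2 Ew2 {Ec pc2 rp rl C2 C3 lm' U'} => [|b c2] /= Ew2.
      by rewrite -Ew2 => /nd; rewrite /lol_edge !negb_or -Ew -Ew2 => /and3P[].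
    by move=> /(congr1 size); rewrite size_cat size_rev.
  have UT : uniq (x :: y :: p ++ q ++ r) by rewrite (perm_uniq pm).
  have eT : last v c1 \in x :: y :: p ++ q ++ r.
    rewrite Ee (perm_mem pm) count1_mem; have := C2 e'; rewrite eqxx /= !count_cat; clear; lia.
  exists c1, x, y, p, q, r; split=> //.
    apply: (uniq_le U) => a; have := count_remove a UT eT; have := permP pm (pred1 a).
    by rewrite Ee; move: (C1 a) (C2 a) (C3 a); cnt.
  apply: subset_count => a; have := count_remove a UT eT; have := permP pm (pred1 a).
  by rewrite Ee; move: (C1 a) (C2 a) (C3 a); cnt.
have rv : grown v (c ++ d ++ rev m) -> grown v (c ++ d ++ m).
  have sub z : z \in c ++ d ++ rev m -> z \in c ++ d ++ m by rewrite !mem_cat mem_rev.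
  case=> [[k [c1 [d1 [c2 [d2 [h1 h2 h3 h4 h5]]]]]]|[k [p [t [q [c1 [d1 [h1 h2 h3 h4 h5]]]]]]]
    |[k [x [y [p [q [r [h1 h2 h3 h4 h5]]]]]]]].
  - by apply: Or31; exists k, c1, d1, c2, d2; split=> // z /h5/sub.
  - by apply: Or32; exists k, p, t, q, c1, d1; split=> // z /h5/sub.
  - by apply: Or33; exists k, x, y, p, q, r; split=> // z /h5/sub.
move=> ei fi ef lm U nd.
have Ur : uniq (v :: c ++ d ++ rev m) by ucnt U.
have ndr : rev m = [::] -> ~~ lol_edge v c d f e by move=> /rev_nil/nd; rewrite lol_edgeC.
move: ei; rewrite -cat_cons mem_cat => /orP[ei|ei].
  move: fi; rewrite -cat_cons mem_cat => /orP[fi|fi]; last exact: mixed U nd.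
  have [c1 [c2 [Ec Ee]]] := last_split ei.
  have /orP[{}fi|{}fi] : (f \in v :: c1) || (f \in c2).
      by rewrite -mem_cat cat_cons -Ec.
    have [c3 [c4 [Ec1 Ef]]] := last_split fi.
    apply: rv; apply: (onpath f e (rev m) c3 (c4 ++ c2)) => //; last exact: lkV.
      by rewrite Ec Ec1 catA.
    move: Ee; rewrite Ec1 last_cat Ef => Ee; rewrite mem_cat; apply/orP; left.
    by case: c4 Ee {Ec1} => [E|b c4 <-]; [rewrite -E eqxx in ef|rewrite /= mem_last].
  exact: (onpath e f m c1 c2).
move: fi; rewrite -cat_cons mem_cat => /orP[fi|fi].
  by apply: rv; apply: mixed Ur ndr => //; apply: lkV.
by apply: (oncycle e f) => //; rewrite inE ?ei ?fi orbT.
Qed.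

Lemma star_F4 v A : star_at v A -> pend v A F4.
Proof.
move=> [k [c1 [d1 [c2 [d2 [pk l1 l2 U sA]]]]]].
apply: (pend_sub sA); apply: (@pend_path _ _ _ _ _ [:: 1; 0; 2; 3]) => //; first by ucnt U.
rewrite catA; apply: (star_pend (lol_pend colE l1) (lol_pend colE l2)).
by apply: (uniq_le U) => a; have := count_belast k v a; cnt.
Qed.

Lemma conn_FC v k B : path adj v k -> pend v B FC -> uniq (v :: k ++ B) ->
  pend (last v k) (rev (belast v k) ++ B) FC.
Proof.
move=> pk pB U; have [rp rl] := rev_conn pk.
apply: (@pend_path _ _ _ _ _ [:: 3; 1; 2; 0]); rewrite ?rl //.
by apply: (uniq_le U) => a; have := rev_conn_cnt v k a; cnt.
Qed.

Lemma uniq_sub_cat v X A B : uniq (v :: X) -> {subset X <= A} ->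
  uniq (v :: A ++ B) -> uniq (v :: X ++ B).
Proof.
rewrite -!cat_cons !cat_uniq => uX sX /and3P[_ /hasPn nB uB].
rewrite uX uB andbT; apply/hasPn => z /nB; apply: contra.
by rewrite !inE => /orP[->//|/sX->]; rewrite orbT.
Qed.

(** The piece [B], seen through the stem, hangs at the first cycle like the lollipop beyond it.
    Hence that cycle is a 4-cycle and [chain_pend] applies. *)
Lemma chain_big v A B : chain_at v A -> pend v B FC -> uniq (v :: A ++ B) -> big v A.
Proof.
move=> [k [p [t [q [c1 [d1 [pk [lp lq] [l1 s0] U sA]]]]]]] pB UB.
have {UB}U2 := uniq_sub_cat U sA UB.
have Uk : uniq (v :: k ++ B) by ucnt U2.
have C a := rev_conn_cnt v k a.
have [] := cycle_FC_sizes G_ch colE lp lq (conn_FC pk pB Uk) (lol_pend colE l1) _ s0.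
  by apply: (uniq_le U2) => a; move: (C a); cnt.
move=> /size1[a Ea] /size1[b Eb]; subst p q.
refine (big_mono sA _); apply: big_path => //; first by ucnt U.
have Us : uniq (last v k :: t :: a :: b :: c1 ++ d1).
  by apply: (uniq_le U) => z; move: (C z); cnt.
by apply: Or31; apply: (chain_pend lp lq (lol_pend colE l1) Us).
Qed.

Definition has_theta := exists x y p q r, theta_in (G := G) x y p q r.

(** The piece [B], seen through the stem, forces the theta graph to be theta_{2,2,2}. *)
Lemma theta_big v A B : theta_at v A -> pend v B FC -> uniq (v :: A ++ B) -> big v A.
Proof.
move=> [k [x [y [p [q [r [pk T sT U sA]]]]]]] pB UB.
have {UB}U2 := uniq_sub_cat U sA UB.
have Uk : uniq (v :: k ++ B) by apply: (uniq_le U2) => a; cnt.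
have C a := rev_conn_cnt v k a.
have UT : uniq (x :: y :: p ++ q ++ r) by case: T.
have R a := count_remove a UT sT.
have /and3P[/eqP/size1[a Ea] /eqP/size1[b Eb] /eqP/size1[c Ec]] :
    [&& size p == 1, size q == 1 & size r == 1].
  apply: (theta_FC G_ch colE T sT (conn_FC pk pB Uk)).
  by apply: (uniq_le U2) => a; move: (C a) (R a); cnt.
subst p q r; case: T => l1 l2 l3 _ _.
refine (big_mono sA _); apply: big_path => //; first by case/andP: U.
exact: (theta222_big l1 l2 l3 UT sT).
Qed.

Lemma grown_big v A B : grown v A -> pend v B FC -> uniq (v :: A ++ B) -> big v A.
Proof.
by case=> [/star_F4 st _ _|ch pB U|th pB U]; [apply: Or33|apply: chain_big U|apply: theta_big U].
Qed.

Lemma grown_big_false v A B : grown v A -> big v B -> uniq (v :: A ++ B) -> False.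
Proof.
move=> g b U; apply: (big2_false G_ch (grown_big g (big_FC b) U) b U).
Qed.

(** Two ends or two middle vertices are computed patterns. An end and a middle vertex are adjacent
    on a 4-cycle, against [cycle_FC_sizes]. *)
Lemma theta222_FC2 x y (a b c : G) u w A B : lk x [:: a] y -> lk x [:: b] y ->
  lk x [:: c] y -> u \in [:: x; y; a; b; c] -> w \in [:: x; y; a; b; c] -> u != w ->
  pend u A FC -> pend w B FC -> uniq ([:: x; y; a; b; c] ++ A ++ B) -> False.
Proof.
have endmid x' y' (a' b' : G) A' B' : lk x' [:: a'] y' -> lk x' [:: b'] y' ->
    pend x' A' FC -> pend a' B' FC -> uniq ([:: x'; y'; a'; b'] ++ A' ++ B') -> False.
  move=> /and3P[xa ay _] /and3P[xb b'y _] pA pB U; rewrite /= in b'y.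
  have l1 : lk x' [::] a' by rewrite lk_nil.
  have l2 : lk x' [:: b'; y'] a' by rewrite /lk /= xb b'y adj_sym ay.
  have {}U : uniq (x' :: a' :: [::] ++ [:: b'; y'] ++ A' ++ B') by ucnt U.
  by have [] := cycle_FC_sizes G_ch colE l1 l2 pA pB U isT.
have midmid x' y' (a' b' c' : G) A' B' : lk x' [:: a'] y' -> lk x' [:: b'] y' ->
    lk x' [:: c'] y' ->
    pend a' A' FC -> pend b' B' FC -> uniq ([:: x'; y'; a'; b'; c'] ++ A' ++ B') -> False.
  move=> /and3P[xa ay _] /and3P[xb b'y _] l3 pA pB U.
  rewrite -!lk_nil in xa ay xb b'y.
  leaf (no_theta222_FC_mids G_ch (lkV xa) ay (lkV xb) b'y l3 pA pB) U.
move=> l1 l2 l3 ui wi uw pA pB U; have := lkV l1; have := lkV l2; have := lkV l3 => r3 r2 r1.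
move: ui uw pA; rewrite !inE => /or4P[|||/orP[]] /eqP-> uw pA;
  move: wi uw pB; rewrite !inE => /or4P[|||/orP[]] /eqP-> uw pB;
  rewrite ?eqxx // in uw.
all: try (leaf (no_theta222_FC_ends G_ch l1 l2 l3 pA pB) U).
all: try (leaf (no_theta222_FC_ends G_ch r1 r2 r3 pA pB) U).
all: first
 [ by apply: (endmid _ _ _ _ _ _ l1 l2 pA pB); ucnt U
 | by apply: (endmid _ _ _ _ _ _ l2 l1 pA pB); ucnt U
 | by apply: (endmid _ _ _ _ _ _ l3 l1 pA pB); ucnt U
 | by apply: (endmid _ _ _ _ _ _ r1 r2 pA pB); ucnt U
 | by apply: (endmid _ _ _ _ _ _ r2 r1 pA pB); ucnt U
 | by apply: (endmid _ _ _ _ _ _ r3 r1 pA pB); ucnt U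
 | by apply: (endmid _ _ _ _ _ _ l1 l2 pB pA); ucnt U
 | by apply: (endmid _ _ _ _ _ _ l2 l1 pB pA); ucnt U
 | by apply: (endmid _ _ _ _ _ _ l3 l1 pB pA); ucnt U
 | by apply: (endmid _ _ _ _ _ _ r1 r2 pB pA); ucnt U
 | by apply: (endmid _ _ _ _ _ _ r2 r1 pB pA); ucnt U
 | by apply: (endmid _ _ _ _ _ _ r3 r1 pB pA); ucnt U
 | by apply: (midmid _ _ _ _ _ _ _ l1 l2 l3 pA pB); ucnt U
 | by apply: (midmid _ _ _ _ _ _ _ l1 l3 l2 pA pB); ucnt U
 | by apply: (midmid _ _ _ _ _ _ _ l2 l1 l3 pA pB); ucnt U
 | by apply: (midmid _ _ _ _ _ _ _ l2 l3 l1 pA pB); ucnt U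
 | by apply: (midmid _ _ _ _ _ _ _ l3 l1 l2 pA pB); ucnt U
 | by apply: (midmid _ _ _ _ _ _ _ l3 l2 l1 pA pB); ucnt U].
Qed.
End Growth.

(** * Building the two-core by ears *)

Section Outcome.
Variable G : sgraph.
Implicit Types (x y z u v w e f s t : G) (p q c d m k A B : seq G).

Definition tripod_edge x y p q r v c d u z := theta_edge x y p q r u z || lol_edge v c d u z.
Definition dumb_edge v c0 c d u z := edge_of v c0 v u z || lol_edge v c d u z.
Definition square_edge u v (a b : G) c d c' d' y z :=
  [|| edge_of u [:: a; v; b] u y z, lol_edge u c d y z | lol_edge v c' d' y z].

Inductive outcome : Prop :=
| Out_tree x : {subset two_core G <= [:: x]} -> outcome
| Out_cycle x c : lk x c x -> 1 < size c -> uniq (x :: c) ->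
    no_ear (x :: c) (edge_of x c x) -> outcome
| Out_theta x y p q r : theta_in x y p q r ->
    no_ear (x :: y :: p ++ q ++ r) (theta_edge x y p q r) -> outcome
| Out_K24 x y (a b c d : G) : K24_in x y a b c d ->
    no_ear [:: x; y; a; b; c; d] (K24_edge x y a b c d) -> outcome
| Out_VI (a1 a2 b1 b2 a0 : G) p : VI_in a1 a2 b1 b2 a0 p ->
    no_ear (a1 :: a2 :: b1 :: b2 :: a0 :: p) (VI_edge a1 a2 b1 b2 a0 p) -> outcome
| Out_dumb v c0 c d : lk v c0 v -> 1 < size c0 -> lol v c d ->
    uniq (v :: c0 ++ c ++ d) -> no_ear (v :: c0 ++ c ++ d) (dumb_edge v c0 c d) -> outcome
| Out_theta_cycle x y (a1 a2 a3 : G) v c d : theta_in x y [:: a1] [:: a2] [:: a3] ->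
    v \in [:: x; y; a1; a2; a3] -> lol v c d -> uniq ([:: x; y; a1; a2; a3] ++ c ++ d) ->
    no_ear ([:: x; y; a1; a2; a3] ++ c ++ d)
      (tripod_edge x y [:: a1] [:: a2] [:: a3] v c d) -> outcome
| Out_square u v (a b : G) c d c' d' : lk u [:: a; v; b] u -> lol u c d -> lol v c' d' ->
    uniq ([:: u; v; a; b] ++ c ++ d ++ c' ++ d') ->
    no_ear ([:: u; v; a; b] ++ c ++ d ++ c' ++ d') (square_edge u v a b c d c' d') ->
    outcome.

Hypothesis G_ch : choosable 4 2 G.
Hypothesis G_conn : connected G.
Variable col : G -> bool.
Hypothesis colE : forall x y, adj x y -> col x != col y.
Let lk_odd := lk_odd colE.

(** Neither graph admits an ear of either kind, so each is the entire two-core. *)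
Lemma K24_or_VI_outcome : K24_or_VI G -> outcome.
Proof.
case=> [[x [y [a [b [c [d K]]]]]]|[a1 [a2 [b1 [b2 [a0 [p V]]]]]]].
  have U : uniq [:: x; y; a; b; c; d] by case: K.
  case: (ear_cases G_conn (K24_edge x y a b c d) U isT) => [|[e [f [m [ei fi ef lm [Um nd]]]]]
      |[v [c' [d' [vi L Um]]]]].
  - exact: Out_K24.
  - by case: (K24_ear G_ch colE K ei fi ef lm Um nd).
  by case: (K24_FC G_ch K vi (lol_pend colE L)).
have U : uniq (a1 :: a2 :: b1 :: b2 :: a0 :: p) by case: V.
case: (ear_cases G_conn (VI_edge a1 a2 b1 b2 a0 p) U isT) => [|[e [f [m [ei fi ef lm [Um nd]]]]]
    |[v [c' [d' [vi L Um]]]]].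
- exact: Out_VI.
- by case: (VI_noear G_ch colE V ei fi ef Um lm nd).
by case: (VI_FC G_ch colE V vi (lol_pend colE L)).
Qed.

Lemma lol_big_false v c d e c2 d2 B : lol v c d -> e \in v :: c ++ d -> lol e c2 d2 ->
  big v B -> uniq (v :: (c ++ d ++ c2 ++ d2) ++ B) -> False.
Proof.
move=> L ei L2 bB U; apply: (grown_big_false G_ch colE (lol_lol_ear colE L ei L2 _) bB U).
by ucnt U.
Qed.

Lemma open_big_false v c d e f m B : lol v c d -> e \in v :: c ++ d -> f \in v :: c ++ d ->
  e != f -> lk e m f -> (m = [::] -> ~~ lol_edge v c d e f) ->
  big v B -> uniq (v :: (c ++ d ++ m) ++ B) -> False.
Proof.
move=> L ei fi ef lm nd bB U.
apply: (grown_big_false G_ch colE (lol_open_ear colE L ei fi ef lm _ nd) bB U).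
by ucnt U.
Qed.

(** Once a lollipop hangs at [v], the theta graph is theta_{2,2,2} and big at [v], so the lollipop
    cannot grow; [theta222_FC2] excludes a second one elsewhere on the theta graph. *)
Lemma theta_outcome : has_theta G -> outcome.
Proof.
move=> [x [y [p [q [r T]]]]]; have U : uniq (x :: y :: p ++ q ++ r) by case: T.
case: (ear_cases G_conn (theta_edge x y p q r) U isT) => [|[e [f [m [ei fi ef lm [Um nd]]]]]
    |[v [c [d [vi L Um]]]]].
- exact: Out_theta.
- apply/K24_or_VI_outcome/(theta_ear G_ch colE T ei fi ef lm _ nd).
  by ucnt Um.
have /and3P[/eqP/size1[a Ea] /eqP/size1[b Eb] /eqP/size1[a3 Ec]] :
    [&& size p == 1, size q == 1 & size r == 1].
  by apply: (theta_FC G_ch colE T vi (lol_pend colE L)); ucnt Um.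
subst p q r; have [l1 l2 l3 _ _] := T.
have bv := theta222_big l1 l2 l3 U vi.
have R z := count_remove z U vi.
pose S := [:: x; y; a; b; a3] ++ c ++ d.
(* Continued inside the lollipop to its root [v], such an ear becomes an ear of the theta graph. *)
have mixed e f m : e \in [:: x; y; a; b; a3] -> e != v -> f \in c ++ d -> lk e m f ->
    uniq (S ++ m) -> outcome.
  move=> ei ev fi lm US; have [k [s [lk1 Uk pm]]] := lol_reach L fi.
  have P z := permP pm (pred1 z).
  apply/K24_or_VI_outcome/(theta_ear G_ch colE (m := m ++ f :: rev k) T ei vi ev).
  - by rewrite lk_cat lm -lk_rev.
  - by apply: (uniq_le US) => z; move: (P z); cnt.
  - by case: m {lm US}.
case: (ear_cases G_conn (S := S) (tripod_edge x y [:: a] [:: b] [:: a3] v c d) Um isT)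
  => [|[e [f [m [ei fi ef lm [US nd]]]]]|[e [c2 [d2 [ei L2 US]]]]].
- exact: Out_theta_cycle.
- have nd1 : m = [::] -> ~~ theta_edge x y [:: a] [:: b] [:: a3] e f.
    by move=> /nd; rewrite /tripod_edge negb_or => /andP[].
  have nd2 : m = [::] -> ~~ lol_edge v c d e f.
    by move=> /nd; rewrite /tripod_edge negb_or => /andP[].
  have USr : uniq (S ++ rev m) by ucnt US.
  move: (ei) (fi); rewrite ![_ \in S]mem_cat => /orP[eT|eL] /orP[fT|fL].
  + by apply/K24_or_VI_outcome/(theta_ear G_ch colE T eT fT ef lm _ nd1); ucnt US.
  + case: (eqVneq e v) => ev; last exact: mixed eT ev fL lm US.
    exfalso; apply: (open_big_false L _ _ ef lm nd2 bv).
    * by rewrite ev mem_head.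
    * by rewrite inE fL orbT.
    by apply: (uniq_le US) => z; move: (R z); cnt.
  + case: (eqVneq f v) => fv; last exact: mixed fT fv eL (lkV lm) USr.
    exfalso; apply: (open_big_false L _ _ ef lm nd2 bv).
    * by rewrite inE eL orbT.
    * by rewrite fv mem_head.
    by apply: (uniq_le US) => z; move: (R z); cnt.
  exfalso; apply: (open_big_false L _ _ ef lm nd2 bv).
  * by rewrite inE eL orbT.
  * by rewrite inE fL orbT.
  by apply: (uniq_le US) => z; move: (R z); cnt.
exfalso; case: (boolP (e \in v :: c ++ d)) => eL.
  apply: (lol_big_false L eL L2 bv).
  by apply: (uniq_le US) => z; move: (R z); cnt.
move: eL; rewrite inE negb_or => /andP[ev eL].
have eT : e \in [:: x; y; a; b; a3] by move: ei; rewrite mem_cat (negPf eL) orbF.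
apply: (theta222_FC2 G_ch colE l1 l2 l3 eT vi ev (lol_pend colE L2) (lol_pend colE L)).
by ucnt US.
Qed.

Lemma cyc_theta_outcome x c e f m : lk x c x -> 1 < size c -> e \in x :: c ->
  f \in x :: c -> e != f -> lk e m f -> uniq (x :: c ++ m) ->
  (m = [::] -> ~~ edge_of x c x e f) -> outcome.
Proof.
move=> lc sc ei fi ef lm U nd.
have [x' [y [p [q [r [T _]]]]]] := cyc_ear_theta colE lc sc ei fi ef lm U nd.
by apply: theta_outcome; exists x', y, p, q, r.
Qed.

(** Seen from [u], the 4-cycle with the lollipop at [v] is big, and symmetrically, so neither
    lollipop grows. An ear between different parts, completed inside the lollipops, is an ear of the
    4-cycle and yields a theta graph. *)
Lemma square_outcome u v (a b : G) c d c' d' : lk u [:: a; v; b] u -> lol u c d ->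
  lol v c' d' -> uniq ([:: u; v; a; b] ++ c ++ d ++ c' ++ d') -> outcome.
Proof.
move=> lC L L' U.
have mixed u0 v0 a0 b0 c0 d0 c1 d1 e f m : lk u0 [:: a0; v0; b0] u0 -> lol u0 c0 d0 ->
    lol v0 c1 d1 -> uniq ([:: u0; v0; a0; b0] ++ c0 ++ d0 ++ c1 ++ d1 ++ m) ->
    e \in c0 ++ d0 -> f \in [:: v0; a0; b0] ++ c1 ++ d1 -> lk e m f -> outcome.
  move=> lC0 L0 L1 U0 ei fi lm.
  have [k [s [lk1 _ pm]]] := lol_reach L0 ei; have P z := permP pm (pred1 z).
  move: fi; rewrite mem_cat => /orP[fi|fi].
    apply: (@cyc_theta_outcome u0 [:: a0; v0; b0] u0 f (k ++ e :: m)) => //.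
    - by rewrite mem_head.
    - by move: fi; rewrite !inE => /or3P[]/eqP->; rewrite eqxx ?orbT.
    - apply: contraTneq U0 => E; move: fi; rewrite -E !inE => /or3P[]/eqP E2;
        by rewrite /= E2 !inE eqxx ?orbT.
    - by rewrite lk_cat lk1.
    - by apply: (uniq_le U0) => z; move: (P z); cnt.
    - by case: k {lk1 pm P}.
  have [k' [s' [lk1' _ pm']]] := lol_reach L1 fi; have P' z := permP pm' (pred1 z).
  apply: (@cyc_theta_outcome u0 [:: a0; v0; b0] u0 v0 (k ++ e :: m ++ f :: rev k')) => //.
  - by rewrite mem_head.
  - by rewrite !inE eqxx !orbT.
  - by apply: contraTneq U0 => E; rewrite /= E !inE eqxx.
  - by rewrite lk_cat lk1 lk_cat lm -lk_rev.
  - by apply: (uniq_le U0) => z; move: (P z) (P' z); cnt.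
  - by case: k {lk1 pm P}.
have onlol u0 v0 a0 b0 c0 d0 c1 d1 : lk u0 [:: a0; v0; b0] u0 -> lol u0 c0 d0 ->
    lol v0 c1 d1 -> uniq ([:: u0; v0; a0; b0] ++ c0 ++ d0 ++ c1 ++ d1) ->
    big u0 (v0 :: a0 :: b0 :: c1 ++ d1).
  move=> lC0 L0 L1 U0; apply: Or31.
  have /and5P[ua av vb bu _] : lk u0 [:: a0; v0; b0] u0 by [].
  apply: (chain_pend (a := a0) (b := b0) _ _ (lol_pend colE L1)).
  - by rewrite (lk_cat u0 [::]) !lk_nil ua av.
  - by rewrite (lk_cat u0 [::]) !lk_nil [adj u0 b0]adj_sym bu adj_sym vb.
  by ucnt U0.
have lC' : lk v [:: b; u; a] v.
  have /and5P[ua av vb bu _] : lk u [:: a; v; b] u by [].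
  by apply/and5P.
have U' : uniq ([:: v; u; b; a] ++ c' ++ d' ++ c ++ d) by ucnt U.
have bu := onlol _ _ _ _ _ _ _ _ lC L L' U.
have bv := onlol _ _ _ _ _ _ _ _ lC' L' L U'.
pose S := [:: u; v; a; b] ++ c ++ d ++ c' ++ d'.
case: (ear_cases G_conn (S := S) (square_edge u v a b c d c' d') U isT)
  => [|[e [f [m [ei fi ef lm [US nd]]]]]|[e [c2 [d2 [ei L2 US]]]]].
- exact: (Out_square lC L L' U).
- have nd1 : m = [::] -> ~~ edge_of u [:: a; v; b] u e f.
    by move=> /nd; rewrite /square_edge !negb_or => /and3P[].
  have nd2 : m = [::] -> ~~ lol_edge u c d e f.
    by move=> /nd; rewrite /square_edge !negb_or => /and3P[].
  have nd3 : m = [::] -> ~~ lol_edge v c' d' e f.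
    by move=> /nd; rewrite /square_edge !negb_or => /and3P[].
  have USr : uniq (S ++ rev m) by ucnt US.
  have onC z : z \in [:: u; v; a; b] -> z \in u :: [:: a; v; b].
    by rewrite !inE => /or4P[]->; rewrite ?orbT.
  have inU z : z \in [:: u; v; a; b] -> z = u \/ z \in [:: v; a; b].
    by rewrite inE => /orP[/eqP->|]; [left|right].
  have inV z : z \in [:: u; v; a; b] -> z = v \/ z \in [:: u; b; a].
    by rewrite !inE => /or4P[]/eqP->; [right|left|right|right]; rewrite ?eqxx ?orbT.
  have bigU z w m0 : z \in c ++ d -> w \in u :: c ++ d -> z != w -> lk z m0 w ->
      uniq (S ++ m0) -> (m0 = [::] -> ~~ lol_edge u c d z w) -> outcome.
    move=> zi wi zw lm0 US0 nd0; exfalso.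
    apply: (open_big_false L _ wi zw lm0 nd0 bu); first by rewrite inE zi orbT.
    by ucnt US0.
  have bigV z w m0 : z \in c' ++ d' -> w \in v :: c' ++ d' -> z != w -> lk z m0 w ->
      uniq (S ++ m0) -> (m0 = [::] -> ~~ lol_edge v c' d' z w) -> outcome.
    move=> zi wi zw lm0 US0 nd0; exfalso.
    apply: (open_big_false L' _ wi zw lm0 nd0 bv); first by rewrite inE zi orbT.
    by ucnt US0.
  have mixU z w m0 : z \in c ++ d -> w \in [:: v; a; b] ++ c' ++ d' -> lk z m0 w ->
      uniq (S ++ m0) -> outcome.
    by move=> zi wi lm0 US0; apply: mixed lC L L' _ zi wi lm0; ucnt US0.
  have mixV z w m0 : z \in c' ++ d' -> w \in [:: u; b; a] ++ c ++ d -> lk z m0 w ->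
      uniq (S ++ m0) -> outcome.
    by move=> zi wi lm0 US0; apply: mixed lC' L' L _ zi wi lm0; ucnt US0.
  have fe : f != e by rewrite eq_sym.
  have nd2r : rev m = [::] -> ~~ lol_edge u c d f e.
    by move=> /rev_nil/nd2; rewrite lol_edgeC.
  have nd3r : rev m = [::] -> ~~ lol_edge v c' d' f e.
    by move=> /rev_nil/nd3; rewrite lol_edgeC.
  have inS z : z \in S -> [\/ z \in [:: u; v; a; b], z \in c ++ d | z \in c' ++ d'].
    rewrite /S [c ++ _]catA mem_cat [_ \in (c ++ d) ++ _]mem_cat => /or3P[]; by
      [apply: Or31|apply: Or32|apply: Or33].
  case: (inS e ei) => e1; case: (inS f fi) => f1.
  + by apply: (cyc_theta_outcome lC isT (onC _ e1) (onC _ f1) ef lm _ nd1); ucnt US.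
  + case: (inU e e1) => e2; first by apply: (bigU f e (rev m)) => //; [rewrite e2 mem_head|exact: lkV].
    by apply: (mixU f e (rev m)) => //; [rewrite mem_cat e2|exact: lkV].
  + case: (inV e e1) => e2; first by apply: (bigV f e (rev m)) => //; [rewrite e2 mem_head|exact: lkV].
    by apply: (mixV f e (rev m)) => //; [rewrite mem_cat e2|exact: lkV].
  + case: (inU f f1) => f2; first by apply: (bigU e f m) => //; rewrite f2 mem_head.
    by apply: (mixU e f m) => //; rewrite mem_cat f2.
  + by apply: (bigU e f m) => //; rewrite inE f1 orbT.
  + by apply: (mixU e f m) => //; rewrite mem_cat f1 orbT.
  + case: (inV f f1) => f2; first by apply: (bigV e f m) => //; rewrite f2 mem_head.
    by apply: (mixV e f m) => //; rewrite mem_cat f2.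
  + by apply: (mixV e f m) => //; rewrite mem_cat f1 orbT.
  by apply: (bigV e f m) => //; rewrite inE f1 orbT.
exfalso; case: (boolP (e \in u :: c ++ d)) => e1.
  by apply: (lol_big_false L e1 L2 bu); ucnt US.
case: (boolP (e \in v :: c' ++ d')) => e2.
  by apply: (lol_big_false L' e2 L2 bv); ucnt US.
have /and5P[ua av vb bu' _] : lk u [:: a; v; b] u by [].
(* The remaining roots are neighbors of [u] on the 4-cycle, while cycles can hang only at opposite
   vertices. *)
have : e \in [:: a; b].
  move: e1 e2 ei; rewrite /S !(inE, mem_cat) !negb_or.
  move=> /and3P[/negPf-> /negPf-> /negPf->] /and3P[/negPf-> /negPf-> /negPf->].
  by rewrite !orbF.
have pu := lol_pend colE L; have pe := lol_pend colE L2.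
rewrite !inE => /orP[]/eqP Ee; subst e.
  have l1 : lk u [::] a by rewrite lk_nil.
  have l2 : lk u [:: b; v] a by apply/and4P; rewrite adj_sym bu' adj_sym vb adj_sym av.
  have U1 : uniq (u :: a :: [::] ++ [:: b; v] ++ (c ++ d) ++ c2 ++ d2) by ucnt US.
  by have [] := cycle_FC_sizes G_ch colE l1 l2 pu pe U1 isT.
have l1 : lk u [::] b by rewrite lk_nil adj_sym.
have l2 : lk u [:: a; v] b by apply/and4P.
have U1 : uniq (u :: b :: [::] ++ [:: a; v] ++ (c ++ d) ++ c2 ++ d2) by ucnt US.
by have [] := cycle_FC_sizes G_ch colE l1 l2 pu pe U1 isT.
Qed.

Lemma two_lol_outcome u v p q c d c' d' : lk u p v -> lk u q v -> lol u c d ->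
  lol v c' d' -> uniq (u :: v :: p ++ q ++ c ++ d ++ c' ++ d') ->
  0 < size p + size q -> outcome.
Proof.
move=> lp lq L L' U s0.
have [] := cycle_FC_sizes G_ch colE lp lq (lol_pend colE L) (lol_pend colE L') _ s0.
  by ucnt U.
move=> /size1[a Ea] /size1[b Eb]; subst p q.
apply: (square_outcome (a := a) (b := b) _ L L'); last by ucnt U.
by rewrite (lk_cat u [:: a]) lp; apply: lkV lq.
Qed.

(** With [c0] also at [v], a star is refuted by [F4_FC_false]. A chain has a middle cycle with a
    lollipop on each side, one of them ending in [c0]. A theta graph is handled by
    [theta_outcome]. *)
Lemma grown_outcome v A c0 : grown v A -> lk v c0 v -> 1 < size c0 ->
  uniq (v :: A ++ c0) -> outcome.
Proof.
move=> g lc sc U; have L0 : lol v [::] c0 by split=> //; ucnt U.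
case: g => [/star_F4-/(_ _ colE) st|ch|[k [x [y [p [q [r [_ T _ _ _]]]]]]]].
- by case: (F4_FC_false G_ch st (lol_pend colE L0) U).
- case: ch => [k [p [t [q [c1 [d1 [pk [lp lq] [l1 s0] U1 sA]]]]]]].
  have U2 := uniq_sub_cat U1 sA U; have [rp rl] := rev_conn pk.
  have C z := rev_conn_cnt v k z.
  apply: (two_lol_outcome (c := rev (belast v k)) (d := c0) lp lq _ l1 _ s0).
    by split; rewrite ?rl //; apply: (uniq_le U2) => z; move: (C z); cnt.
  by apply: (uniq_le U2) => z; move: (C z); cnt.
by apply: theta_outcome; exists x, y, p, q, r.
Qed.

Lemma dumb_outcome v c0 c d : lk v c0 v -> 1 < size c0 -> lol v c d ->
  uniq (v :: c0 ++ c ++ d) -> outcome.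
Proof.
move=> lc sc L U; pose S := v :: c0 ++ c ++ d.
have mixed e f m : e \in c0 -> f \in c ++ d -> lk e m f -> uniq (S ++ m) -> outcome.
  move=> ei fi lm US; have [k [s [lk1 _ pm]]] := lol_reach L fi.
  have P z := permP pm (pred1 z).
  apply: (@cyc_theta_outcome v c0 e v (m ++ f :: rev k)) => //.
  - by rewrite inE ei orbT.
  - by rewrite mem_head.
  - by apply: contraTneq US => E; rewrite /S /= !mem_cat -E ei.
  - by rewrite lk_cat lm -lk_rev.
  - by apply: (uniq_le US) => z; move: (P z); cnt.
  by case: m {lm US}.
case: (ear_cases G_conn (S := S) (dumb_edge v c0 c d) U isT)
  => [|[e [f [m [ei fi ef lm [US nd]]]]]|[e [c2 [d2 [ei L2 US]]]]].
- exact: (Out_dumb lc sc L U).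
- have nd1 : m = [::] -> ~~ edge_of v c0 v e f.
    by move=> /nd; rewrite /dumb_edge negb_or => /andP[].
  have nd2 : m = [::] -> ~~ lol_edge v c d e f.
    by move=> /nd; rewrite /dumb_edge negb_or => /andP[].
  have onL : e \in v :: c ++ d -> f \in v :: c ++ d -> outcome.
    move=> e1 f1; apply: (grown_outcome (lol_open_ear colE L e1 f1 ef lm _ nd2) lc sc);
      by ucnt US.
  have onC : e \in v :: c0 -> f \in v :: c0 -> outcome.
    by move=> e1 f1; apply: (cyc_theta_outcome lc sc e1 f1 ef lm _ nd1); ucnt US.
  have inS z : z \in S -> [\/ z = v, z \in c0 | z \in c ++ d].
    rewrite inE mem_cat => /or3P[/eqP| |]; by [apply: Or31|apply: Or32|apply: Or33].
  have mH (T : seq G) : v \in v :: T by rewrite mem_head.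
  have mT z (T : seq G) : z \in T -> z \in v :: T by rewrite inE => ->; rewrite orbT.
  case: (inS e ei) => e1; case: (inS f fi) => f1.
  + by rewrite e1 f1 eqxx in ef.
  + by apply: onC; rewrite ?e1 ?mH ?mT.
  + by apply: onL; rewrite ?e1 ?mH ?mT.
  + by apply: onC; rewrite ?f1 ?mH ?mT.
  + by apply: onC; rewrite mT.
  + exact: mixed e1 f1 lm US.
  + by apply: onL; rewrite ?f1 ?mH ?mT.
  + by apply: (mixed f e (rev m)) => //; [exact: lkV|ucnt US].
  by apply: onL; rewrite mT.
case: (boolP (e \in v :: c ++ d)) => eL.
  by apply: (grown_outcome (lol_lol_ear colE L eL L2 _) lc sc); ucnt US.
have ec : e \in c0.
  move: ei; rewrite /S inE mem_cat => /or3P[/eqP E|//|e3]; case/negP: eL.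
    by rewrite E mem_head.
  by rewrite inE e3 orbT.
case/splitPr_ex: ec => p [q Ec]; subst c0; move: lc; rewrite lk_cat => /andP[lp lq].
apply: (two_lol_outcome lp (lkV lq) L L2); first by ucnt US.
by rewrite size_cat /= in sc; slia.
Qed.

Lemma cycle_outcome x c : lk x c x -> 1 < size c -> uniq (x :: c) -> outcome.
Proof.
move=> lc sc U; case: (ear_cases G_conn (edge_of x c x) U isT)
  => [|[e [f [m [ei fi ef lm [US nd]]]]]|[v [c2 [d2 [ei L US]]]]].
- exact: Out_cycle.
- exact: (cyc_theta_outcome lc sc ei fi ef lm US nd).
move: ei; rewrite inE => /orP[/eqP Ev|vi]; first by subst v; apply: (dumb_outcome lc sc L US).
case/splitPr_ex: vi => p [q Ec]; subst c; move: lc; rewrite lk_cat => /andP[lp lq].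
apply: (dumb_outcome (v := v) (c0 := q ++ x :: p) _ _ L).
- by rewrite lk_cat lq.
- by move: sc; rewrite !size_cat /= !addnS addnC.
by ucnt US.
Qed.

Lemma structure : outcome.
Proof.
have /andP[/card_gt0P[x0 _] _] := G_conn.
(* One vertex offers no two distinct ends, so a first ear is a lollipop. Its cycle is the new start
   and its stem is dropped. *)
case: (ear_cases G_conn (S := [:: x0]) (fun _ _ => false) isT isT)
  => [[sub _]|[e [f [m [ei fi ef lm [US nd]]]]]|[v [c [d [ei [pc ld sd U] _]]]]].
- exact: Out_tree sub.
- by move: ei fi ef; rewrite !inE => /eqP-> /eqP->; rewrite eqxx.
apply: (cycle_outcome ld sd).
by apply: (uniq_le U) => a; have := count_belast c v a; cnt.
Qed.
End Outcome.

Lemma steps_map (T U : eqType) (f : T -> U) s :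
  steps [seq f x | x <- s] = [seq (f xy.1, f xy.2) | xy <- steps s].
Proof.
by rewrite /steps behead_map; elim: s (behead s) => [|x s IH] [|y t] //=; rewrite IH.
Qed.

Lemma mem_steps_map (T U : eqType) (f : T -> U) s x y : injective f ->
  ((f x, f y) \in steps [seq f z | z <- s]) = ((x, y) \in steps s).
Proof.
move=> fI; rewrite steps_map -[(f x, f y)]/((fun xy => (f xy.1, f xy.2)) (x, y)).
by rewrite mem_map // => -[a b] [c d] [/fI-> /fI->].
Qed.

Lemma steps_cat (T : eqType) x (p : seq T) y q :
  steps (x :: p ++ y :: q) = steps (x :: p) ++ (last x p, y) :: steps (y :: q).
Proof.
rewrite /steps; elim: p x => //= z p IH x; congr cons; exact: IH.
Qed.

Lemma steps_mem (T : eqType) (s : seq T) x y : (x, y) \in steps s -> (x \in s) /\ (y \in s).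
Proof.
by case/stepsP=> s1 [s2 ->]; rewrite !mem_cat !inE !eqxx !orbT.
Qed.

Lemma map_nth_enum (T : Type) (x : T) s : [seq nth x s (nat_of_ord i) | i <- enum 'I_(size s)] = s.
Proof.
by rewrite -[RHS](mkseq_nth x) /mkseq -val_enum_ord -map_comp.
Qed.

(** * From vertex sequences to the model graphs *)

Section CoreShape.
Variable G : sgraph.
Implicit Types (x y z u v w e f s t : G) (p q c d m k : seq G).

Lemma edge_of_mem x p y u v : edge_of x p y u v ->
  (u \in x :: y :: p) /\ (v \in x :: y :: p).
Proof.
have M z : z \in x :: rcons p y -> z \in x :: y :: p by rewrite !(inE, mem_rcons).
by rewrite /edge_of => /orP[] /steps_mem[/M ? /M ?].
Qed.

Lemma path_steps x p u v : path adj x p -> (u, v) \in steps (x :: p) -> adj u v.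
Proof.
move=> pp /stepsP[[|a s1] [s2 /= [E1 E2]]].
  by move: pp; rewrite E1 E2 /= => /andP[].
by move: pp; rewrite E2 cat_path /= => /and4P[].
Qed.

Lemma edge_of_adj x p y u v : lk x p y -> edge_of x p y u v -> adj u v.
Proof.
by rewrite /edge_of => l /orP[/(path_steps l)|/(path_steps l)] //; rewrite adj_sym.
Qed.

Lemma lol_edge_adj v c d u w : lol v c d -> lol_edge v c d u w -> adj u w.
Proof.
case=> pc ld _ _ /or3P[/(path_steps pc)//|/(path_steps pc)|/(edge_of_adj ld)//].
by rewrite adj_sym.
Qed.

Lemma lol_edge_mem v c d u w : lol_edge v c d u w ->
  (u \in v :: c ++ d) /\ (w \in v :: c ++ d).
Proof.
have M z : z \in v :: c -> z \in v :: c ++ d.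
  by rewrite -cat_cons [in X in _ -> X]mem_cat => ->.
have M' z : z \in last v c :: last v c :: d -> z \in v :: c ++ d.
  rewrite !inE mem_cat orbA orbb => /orP[/eqP->|->]; last by rewrite !orbT.
  by have := mem_last v c; rewrite inE => /orP[->|->]; rewrite ?orbT.
by case/or3P=> [/steps_mem[/M ? /M ?]|/steps_mem[/M ? /M ?]|/edge_of_mem[/M' ? /M' ?]].
Qed.

(** Lets known parts of the two-core be enlarged by paths between them, without exhibiting a whole
    subgraph of minimum degree 2. *)
Lemma core_extend (S : {set G}) :
  (forall x, x \in S -> exists y z, [/\ y \in S :|: two_core G, z \in S :|: two_core G,
     y != z, adj x y & adj x z]) -> S \subset two_core G.
Proof.
move=> H; apply: subset_trans (subsetUl _ (two_core G)) (sub_two_core _).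
apply/min_degree2P => x; rewrite inE => /orP[/H//|/two_coreP[y [z [yK zK yz xy xz]]]].
by exists y, z; split; rewrite // inE ?yK ?zK orbT.
Qed.

Lemma inner_nbrs x p y z : lk x p y -> z \in p -> uniq p -> x \notin p -> y \notin p ->
  (x != y) || (1 < size p) ->
  exists a b, [/\ a \in x :: y :: p, b \in x :: y :: p, a != b, adj z a & adj z b].
Proof.
move=> + /splitPr_ex[p1 [p2 Ep]]; rewrite Ep lk_cat => /andP[l1 l2] U xp yp ne.
exists (last x p1), (head y p2); split.
- have := mem_last x p1; rewrite !inE mem_cat => /orP[->//|->]; by rewrite !orbT.
- by case: p2 {Ep l2 U xp yp ne} => [|b p2]; rewrite !inE ?mem_cat ?inE eqxx ?orbT.
- case: p2 l2 U xp yp ne {Ep} => [|b p2] /= _ U xp yp ne.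
    case/lastP: p1 {l1} U xp yp ne => [|p1 a] U xp yp; first by rewrite orbF.
    move=> _; rewrite last_rcons; apply: contraNneq yp => <-.
    by rewrite mem_cat mem_rcons mem_head.
  apply: contraTneq U => E; have := mem_last x p1; rewrite inE E => /orP[/eqP bx|bp].
    by move: xp; rewrite -bx mem_cat !inE eqxx !orbT.
  by rewrite cat_uniq; apply/negP => /and3P[_ /hasPn/(_ b)]; rewrite !inE eqxx orbT bp => /(_ isT).
- by move: l1; rewrite lk_last adj_sym => /andP[].
by case: p2 l2 {Ep U xp yp ne} => [|b p2] /andP[].
Qed.

Lemma path_core x p y : x \in two_core G -> y \in two_core G -> lk x p y ->
  uniq (x :: y :: p) -> {subset p <= two_core G}.
Proof.
move=> xK yK l /and3P[]; rewrite inE negb_or => /andP[xy xp] yp up z zp.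
suff /subsetP/(_ z) : [set z in p] \subset two_core G by rewrite inE; apply.
apply: core_extend => u; rewrite inE => ui.
have [|a [b [ai bi ab ua ub]]] := inner_nbrs l ui up xp yp; first by rewrite xy.
by exists a, b; split=> //; [move: ai|move: bi]; rewrite !inE => /or3P[/eqP->|/eqP->|->];
   rewrite ?xK ?yK ?orbT.
Qed.

Lemma cycle_core x c : lk x c x -> 1 < size c -> uniq (x :: c) -> {subset x :: c <= two_core G}.
Proof.
move=> l sc /andP[xc uc] z zi.
suff /subsetP/(_ z) : [set z in x :: c] \subset two_core G by rewrite inE; apply.
apply: core_extend => u; rewrite inE inE => /orP[/eqP->|ui].
  case: c l sc xc uc {zi} => // a c l sc xc uc; exists a, (last a c).
  split.
  - by rewrite !inE eqxx !orbT.
  - by have := mem_last a c; rewrite !inE => ->; rewrite orbT.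
  - case: c sc l xc uc => // b c _ _ _ /= /andP[ac _].
    by apply: contraNneq ac => E; rewrite {1}E mem_last.
  - by case/andP: l.
  by move: l; rewrite lk_last adj_sym => /andP[].
have [|a [b [ai bi ab ua ub]]] := inner_nbrs l ui uc xc xc; first by rewrite sc orbT.
by exists a, b; split=> //; [move: ai|move: bi]; rewrite !inE orbA orbb => ->.
Qed.

Lemma theta_core x y p q r : theta_in x y p q r ->
  {subset x :: y :: p ++ q ++ r <= two_core G}.
Proof.
move=> [lp lq lr U s].
have C : {subset x :: (p ++ y :: rev q) <= two_core G}.
  by apply: cycle_core; [rewrite lk_cat lp -lk_rev|slia|ucnt U].
have xK : x \in two_core G by apply: C; rewrite mem_head.
have yK : y \in two_core G by apply: C; rewrite !(inE, mem_cat) eqxx !orbT.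
have R := path_core xK yK lr.
move=> z; rewrite !(inE, mem_cat) => /or4P[/eqP->//|/eqP->//|zp|/orP[zq|zr]].
- by apply: C; rewrite inE mem_cat zp orbT.
- by apply: C; rewrite inE mem_cat inE mem_rev zq !orbT.
by apply: R zr; ucnt U.
Qed.

Lemma lol_core v c d : v \in two_core G -> lol v c d ->
  {subset v :: c ++ d <= two_core G}.
Proof.
move=> vK [pc ld sd U].
have C : {subset last v c :: d <= two_core G}.
  by apply: cycle_core => //; apply: (uniq_le U) => a; have := count_belast c v a; cnt.
have wK : last v c \in two_core G by apply: C; rewrite mem_head.
have P : {subset c <= two_core G}.
  case/lastP: c pc {ld} wK U {C} => // c w; rewrite rcons_path last_rcons => /andP[pc cw] wK U.
  have R : {subset c <= two_core G} by apply: (path_core vK wK); [rewrite lk_last pc|ucnt U].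
  by move=> z; rewrite mem_rcons inE => /orP[/eqP->|/R].
move=> z; rewrite inE mem_cat => /or3P[/eqP->//|/P//|zd].
by apply: C; rewrite inE zd orbT.
Qed.

Lemma core_setE (S : seq G) h : no_ear S h -> {subset S <= two_core G} -> S != [::] ->
  core_set G = [set x in S].
Proof.
move=> [sub _] sup S0.
have E : two_core G = [set x in S].
  by apply/setP => x; rewrite inE; apply/idP/idP => [/sub|/sup].
rewrite /core_set E ifN //; apply: contraNneq S0 => E0.
by case: S {sub sup E} E0 => // x S /setP/(_ x); rewrite !inE eqxx.
Qed.

Lemma iso_induced (S : {set G}) (H : sgraph) (f : H -> G) : injective f ->
  (forall x, (x \in S) = (x \in codom f)) -> {mono f : a b / adj a b} ->
  iso (induced S) H.
Proof.
move=> fI cod fM.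
have gP (x : induced S) : val x \in codom f by rewrite -cod; apply: valP.
have fS a : f a \in S by rewrite cod codom_f.
exists (fun w : induced S => iinv (gP w)) => [|a b]; last by rewrite -fM !f_iinv.
apply: (@Bijective _ _ _ (fun a => exist _ (f a) (fS a) : induced S)) => [w|a].
  by apply: val_inj; rewrite /= f_iinv.
by apply: fI; rewrite f_iinv.
Qed.

Lemma iso_graph_of (S : {set G}) (h : rel G) (T : finType) (r : rel T) (f : T -> G) :
  injective f -> (forall x, (x \in S) = (x \in codom f)) ->
  {in S &, forall x y, adj x y = h x y} ->
  (forall a b, h (f a) (f b) = r a b || r b a) -> iso (induced S) (graph_of r).
Proof.
move=> fI cod hE rE; apply: (iso_induced (f := f : graph_of r -> G)) => // a b.
rewrite [RHS]/((a != b) && (r a b || r b a)) -rE -hE ?cod ?codom_f //.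
by case: eqP => // ->; rewrite adj_irr.
Qed.

Lemma cycle_graph_iso (S : {set G}) x c n : (forall z, (z \in S) = (z \in x :: c)) ->
  uniq (x :: c) -> {in S &, forall u v, adj u v = edge_of x c x u v} ->
  n = size (x :: c) -> iso (induced S) (cycle_graph n).
Proof.
move=> SE U hE ->.
pose f (i : 'I_(size (x :: c))) := nth x (x :: c) i.
have fI : injective f.
  by move=> i j /eqP; rewrite nth_uniq // => /eqP/val_inj.
apply: (iso_graph_of (f := f) fI _ hE) => [z|i j].
  rewrite SE; apply/idP/codomP => [zi|[i ->]]; last by rewrite mem_nth.
  have iz : index z (x :: c) < size (x :: c) by rewrite index_mem.
  by exists (Ordinal iz); rewrite /f nth_index.
(* The closed sequence repeats [x] at its end, so the successor of its last proper position is
   position 0; this is the modulus in [cycle_graph]. *)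
suff St (i' j' : 'I_(size (x :: c))) : ((f i', f j') \in steps (x :: rcons c x)) =
    (val j' == i'.+1 %% size (x :: c)) by rewrite /edge_of !St.
have nE (k : nat) : k < size (x :: c) -> nth x (x :: rcons c x) k = nth x (x :: c) k.
  by move=> kc; rewrite -rcons_cons nth_rcons kc.
have nE1 (k : nat) : k < size (x :: c) ->
    nth x (x :: rcons c x) k.+1 = nth x (x :: c) (k.+1 %% size (x :: c)).
  move=> kc; move: (kc); rewrite leq_eqVlt => /orP[/eqP E|k1].
    by rewrite E modnn -rcons_cons nth_rcons -E ltnn eqxx.
  by rewrite modn_small // nE.
apply/stepsP/eqP => [[s1 [s2 E]]|E].
  have sz : size s1 < size (x :: c).
    by have := congr1 size E; rewrite size_cat /= size_rcons; lia.
  have := congr1 (fun w : seq G => nth x w (size s1)) E; rewrite nE // nth_cat ltnn subnn /= => E1.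
  have := congr1 (fun w : seq G => nth x w (size s1).+1) E.
  rewrite nE1 // nth_cat ltnNge leqnSn /= subSnn /= => E2.
  have Ei : val i' = size s1.
    by apply/eqP; rewrite -(nth_uniq x (ltn_ord i') sz U); apply/eqP; refine (esym E1).
  have m : (val i').+1 %% size (x :: c) < size (x :: c) by rewrite ltn_pmod.
  apply/eqP; rewrite -(nth_uniq x (ltn_ord j') m U); apply/eqP.
  by rewrite Ei; refine (esym E2).
exists (take i' (x :: rcons c x)), (drop i'.+2 (x :: rcons c x)).
have s1 : i' < size (x :: rcons c x) by rewrite /= size_rcons ltnW // ltnS.
have s2 : i'.+1 < size (x :: rcons c x) by rewrite /= size_rcons !ltnS; have := ltn_ord i'.
rewrite -{1}(cat_take_drop i' (x :: rcons c x)) (drop_nth x s1) (drop_nth x s2).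
by rewrite nE // nE1 // -E.
Qed.

(** Injectivity by counting: [f] reaches every element of [S] and has no more arguments than [S] has
    elements. *)
Lemma inj_of_codom (T : finType) (f : T -> G) (S : seq G) : uniq S ->
  (forall z, (z \in S) = (z \in codom f)) -> #|T| <= size S -> injective f.
Proof.
move=> uS sub le; apply/injectiveP; apply: leq_size_uniq uS _ _ => [z|].
  by rewrite sub.
by rewrite size_codom.
Qed.

Lemma seq_nth z0 (s : seq G) u : u \in s -> exists i : 'I_(size s), u = nth z0 s i.
Proof.
move=> us; have iu : index u s < size s by rewrite index_mem.
by exists (Ordinal iu); rewrite nth_index.
Qed.

Lemma theta_iso (S : {set G}) x y p q r : (forall z, (z \in S) = (z \in x :: y :: p ++ q ++ r)) ->
  uniq (x :: y :: p ++ q ++ r) -> {in S &, forall u v, adj u v = theta_edge x y p q r u v} ->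
  iso (induced S) (theta (size p).+1 (size q).+1 (size r).+1).
Proof.
move=> SE U hE.
pose V : finType := (bool + ('I_(size p) + 'I_(size q) + 'I_(size r)))%type.
pose f (w : V) : G := match w with
  | inl b => if b then y else x
  | inr (inl (inl i)) => nth x p i
  | inr (inl (inr i)) => nth x q i
  | inr (inr i) => nth x r i
  end.
have cod z : (z \in x :: y :: p ++ q ++ r) = (z \in codom f).
  apply/idP/codomP => [|[[[]|[[i|i]|i]] ->] /=].
  - rewrite !(inE, mem_cat) => /or4P[/eqP->|/eqP->|/(seq_nth x)[i ->]|
      /orP[/(seq_nth x)[i ->]|/(seq_nth x)[i ->]]].
    + by exists (inl false).
    + by exists (inl true).
    + by exists (inr (inl (inl i))).
    + by exists (inr (inl (inr i))).
    by exists (inr (inr i)).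
  - by rewrite !inE eqxx orbT.
  - by rewrite !inE eqxx.
  - by rewrite !(inE, mem_cat) mem_nth ?orbT.
  - by rewrite !(inE, mem_cat) mem_nth ?orbT.
  by rewrite !(inE, mem_cat) mem_nth ?orbT.
have fI : injective f.
  by apply: inj_of_codom U cod _; rewrite /V !card_sum card_bool !card_ord /= !size_cat !addnA.
apply: (iso_graph_of (f := f) fI _ hE) => [z|a b]; first by rewrite SE cod.
pose whole (s : seq V) := inl false :: rcons s (inl true) : seq V.
have E (s : seq G) (w : seq V) : [seq f i | i <- w] = s -> [seq f i | i <- whole w] = x :: rcons s y.
  by move=> <-; rewrite /whole /= map_rcons.
have Ep := E p [seq inr (inl (inl i)) | i <- enum 'I_(size p)].
have Eq := E q [seq inr (inl (inr i)) | i <- enum 'I_(size q)].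
have Er := E r [seq inr (inr i) | i <- enum 'I_(size r)].
rewrite /theta_edge /edge_of -Ep -?Eq -?Er.
- rewrite !(mem_steps_map _ _ _ fI) !mem_cat.
  by do 6!case: (_ \in _).
- by rewrite -map_comp map_nth_enum.
- by rewrite -map_comp map_nth_enum.
by rewrite -map_comp map_nth_enum.
Qed.

Lemma K24_iso (S : {set G}) x y (a b c d : G) :
  (forall z, (z \in S) = (z \in [:: x; y; a; b; c; d])) -> uniq [:: x; y; a; b; c; d] ->
  {in S &, forall u v, adj u v = K24_edge x y a b c d u v} ->
  iso (induced S) (complete_bipartite 2 4).
Proof.
move=> SE U hE.
pose f (w : 'I_2 + 'I_4) : G := match w with
  | inl i => nth x [:: x; y] i | inr i => nth x [:: a; b; c; d] i end.
have cod z : (z \in [:: x; y; a; b; c; d]) = (z \in codom f).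
  rewrite -[[:: x; y; a; b; c; d]]/([:: x; y] ++ [:: a; b; c; d]) mem_cat.
  apply/orP/codomP => [[/(seq_nth x)[i ->]|/(seq_nth x)[i ->]]|[[i|i] ->]].
  - by exists (inl i).
  - by exists (inr i).
  - by left; apply: mem_nth.
  by right; apply: mem_nth.
have fI : injective f.
  by apply: inj_of_codom U cod _; rewrite card_sum !card_ord.
apply: (iso_graph_of (f := f) fI _ hE) => [z|u v]; first by rewrite SE cod.
have /and3P[_ /hasPn D _] : [&& uniq [:: x; y], ~~ has (mem [:: x; y]) [:: a; b; c; d] &
    uniq [:: a; b; c; d]] by rewrite -cat_uniq.
have fl (i : 'I_2) : (f (inl i) \in [:: x; y]) * (f (inl i) \in [:: a; b; c; d] = false).
  have l : f (inl i) \in [:: x; y] by apply: mem_nth.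
  by split=> //; apply: contraTF l => /D.
have fr (i : 'I_4) : (f (inr i) \in [:: x; y] = false) * (f (inr i) \in [:: a; b; c; d]).
  have l : f (inr i) \in [:: a; b; c; d] by apply: mem_nth.
  by split=> //; apply: negbTE; apply: D.
by rewrite /K24_edge; case: u => i; case: v => j; rewrite ?fl ?fr.
Qed.

Lemma delete_edgeE (H : sgraph) (u v a b : H) : @adj (delete_edge u v) a b =
  adj a b && ~~ ((a == u) && (b == v) || (a == v) && (b == u)).
Proof.
have set2E (a' b' : H) : ([set a'; b'] == [set u; v]) =
    ((a' == u) && (b' == v) || (a' == v) && (b' == u)).
  rewrite eqEsubset !subUset !sub1set !inE ![u == _]eq_sym ![v == _]eq_sym.
  by case: (a' == u); case: (a' == v); case: (b' == u); case: (b' == v).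
rewrite /delete_edge /= /sym_rel /= !set2E [adj b a]adj_sym.
case: (eqVneq a b) => [->|_] /=; first by rewrite adj_irr.
by case: (adj a b) => //=; case: (a == u); case: (a == v); case: (b == u); case: (b == v).
Qed.

Section VIShape.
Variables (S : {set G}) (a1 a2 b1 b2 a0 w : G) (p : seq G).
Hypothesis SE : forall z, (z \in S) = (z \in a1 :: a2 :: b1 :: b2 :: a0 :: w :: p).
Hypothesis U : uniq (a1 :: a2 :: b1 :: b2 :: a0 :: w :: p).
Hypothesis hE : {in S &, forall u v, adj u v = VI_edge a1 a2 b1 b2 a0 (w :: p) u v}.
Variable D : rel ('I_3 + 'I_3).
Hypothesis DE : forall a b : 'I_3 + 'I_3, D a b =
  match a, b with
  | inl i, inr j | inr j, inl i => ~~ ((val i == 0) && ((val j == 0) || (val j == 1)))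
  | _, _ => false
  end.

Let V : finType := (('I_3 + 'I_3) + 'I_(size p))%type.
Let i0 : 'I_3 := ord0.
Let i1 : 'I_3 := lift ord0 ord0.
Let i2 : 'I_3 := ord_max.
Let new : seq V := inl (inl i0) :: rcons (map inr (enum 'I_(size p))) (inl (inr i1)).
Let r (X Y : V) := ((X, Y) \in steps new) ||
  match X, Y with inl x', inl y' => D x' y' | _, _ => false end.

Let f (z : V) : G := match z with
  | inl (inl i) => nth w [:: w; b1; b2] i
  | inl (inr i) => nth w [:: a0; a2; a1] i
  | inr i => nth w p i
  end.

(** The vertex [w] is the end of degree 2 of the subdivided edge from [w] to [a2], and [a0] is the
    vertex that [w] misses. [D] is known only through its values, which keeps the nested edge
    deletions out of the case analysis. *)
Lemma VI_iso_aux : iso (induced S) (graph_of r).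
Proof.
have cod z : (z \in a1 :: a2 :: b1 :: b2 :: a0 :: w :: p) = (z \in codom f).
  have -> : (z \in a1 :: a2 :: b1 :: b2 :: a0 :: w :: p) =
      [|| z \in [:: w; b1; b2], z \in [:: a0; a2; a1] | z \in p].
    by rewrite !inE; do 6!case: (z == _); rewrite ?orbT.
  apply/or3P/codomP => [[/(seq_nth w)[i ->]|/(seq_nth w)[i ->]|/(seq_nth w)[i ->]]|[[[i|i]|i] ->]].
  - by exists (inl (inl i)).
  - by exists (inl (inr i)).
  - by exists (inr i).
  - by apply: Or31; apply: mem_nth.
  - by apply: Or32; apply: mem_nth.
  by apply: Or33; apply: mem_nth.
have fI : injective f.
  by apply: inj_of_codom U cod _; rewrite card_sum card_sum !card_ord.
apply: (iso_graph_of (f := f) fI _ hE) => [z|X Y]; first by rewrite SE cod.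
have Es : w :: rcons p a2 = map f new.
  by rewrite /= map_rcons -map_comp map_nth_enum.
have fa1 : a1 = f (inl (inr i2)) by [].
have fa2 : a2 = f (inl (inr i1)) by [].
have fa0 : a0 = f (inl (inr i0)) by [].
have fb1 : b1 = f (inl (inl i1)) by [].
have fb2 : b2 = f (inl (inl i2)) by [].
have fw : w = f (inl (inl i0)) by [].
have St A B : ((f A, f B) \in steps (a1 :: rcons (w :: p) a2)) =
    (A == inl (inr i2)) && (B == inl (inl i0)) || ((A, B) \in steps new).
  rewrite rcons_cons -[steps _]/((a1, w) :: steps (w :: rcons p a2)) inE xpair_eqE Es.
  by rewrite (mem_steps_map _ _ _ fI) {1}fa1 {1}fw !(inj_eq fI).
have M (A : V) (t : seq V) : (f A \in map f t) = (A \in t) by rewrite mem_map.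
rewrite /VI_edge /edge_of !St /r.
have -> : [:: a1; a2; a0] = map f [:: inl (inr i2); inl (inr i1); inl (inr i0)].
  by [].
have -> : [:: b1; b2] = map f [:: inl (inl i1); inl (inl i2)].
  by [].
rewrite !M; case: (_ \in steps new); rewrite ?orbT //.
case: (_ \in steps new); rewrite ?orbT ?orbF //=.
case: X Y => [X|X] [Y|Y]; rewrite ?andbF //.
rewrite !DE.
by case: X Y => [[[|[|[|?]]] ?]|[[|[|[|?]]] ?]] [[[|[|[|?]]] ?]|[[|[|[|?]]] ?]].
Qed.
End VIShape.

Lemma K33_adj (a b : K33_minus_edge) : adj a b =
  match a, b with
  | inl i, inr j | inr j, inl i => ~~ ((i == ord0) && (j == ord0))
  | _, _ => false
  end.
Proof.
rewrite /K33_minus_edge delete_edgeE; case: a b => [i|i] [j|j];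
  by rewrite /= /sym_rel /= ?orbF ?andbF // [in RHS]andbC.
Qed.

Lemma VI_iso (S : {set G}) (a1 a2 b1 b2 a0 w : G) p :
  (forall z, (z \in S) = (z \in a1 :: a2 :: b1 :: b2 :: a0 :: w :: p)) ->
  uniq (a1 :: a2 :: b1 :: b2 :: a0 :: w :: p) ->
  {in S &, forall u v, adj u v = VI_edge a1 a2 b1 b2 a0 (w :: p) u v} ->
  exists u v : K33_minus_edge, [/\ adj u v, degree u = 2 &
     iso (induced S) (subdivide u v (size p))].
Proof.
move=> SE U hE; exists (inl ord0 : K33_minus_edge), (inr (lift ord0 ord0) : K33_minus_edge).
split; first by rewrite K33_adj.
  rewrite /degree.
  have -> : [set y : K33_minus_edge | adj (inl ord0 : K33_minus_edge) y] =
      [set (inr (lift ord0 ord0) : K33_minus_edge); (inr ord_max : K33_minus_edge)].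
    apply/setP => -[i|i]; rewrite !inE K33_adj //.
    by case: i => -[|[|[|]]].
  by rewrite cards2.
apply: (VI_iso_aux SE U hE (D := @adj (@delete_edge K33_minus_edge (inl ord0) (inr (lift ord0 ord0))))).
move=> x y; rewrite delete_edgeE K33_adj.
by case: x y => [[[|[|[|?]]] ?]|[[|[|[|?]]] ?]] [[[|[|[|?]]] ?]|[[|[|[|?]]] ?]].
Qed.
End CoreShape.

Lemma path_crossing (T : eqType) (e : rel T) (X : pred T) x p : path e x p -> X x ->
  ~~ X (last x p) -> exists a b, [/\ e a b, X a & ~~ X b].
Proof.
elim: p x => [|y p IH] x /=; first by move=> _ ->.
move=> /andP[xy pp] Xx; case: (boolP (X y)) => Xy; first exact: IH.
by exists x, y.
Qed.

(** * Nonseparable sets and blocks *)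

Section Blocks.
Variable G : sgraph.
Implicit Types (x y z u v w : G) (p : seq G) (A B S T : {set G}).

Lemma nonsep_sep A (X : pred G) c u w : nonseparable (induced A) ->
  u \in A -> w \in A -> X u -> ~~ X w -> u != c -> w != c ->
  (forall x y, x \in A -> y \in A -> X x -> ~~ X y -> adj x y -> x = c \/ y = c) -> False.
Proof.
move=> /andP[/andP[_ /forallP con] /forallP nc] uA wA Xu Xw uc wc H.
pose u' : induced A := Sub u uA; pose w' : induced A := Sub w wA.
have : exists2 p, path (fun a b : induced A => adj a b && ((val a != c) && (val b != c))) u' p &
    w' = last u' p.
  case: (boolP (c \in A)) => cA.
    pose c' : induced A := Sub c cA.
    have /connectP[p pp E] : connect [rel a b | [&& a != c', b != c' & adj a b]] u' w'.
      apply/negPn/negP => nco; case/negP: (nc c'); apply/existsP; exists u'.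
      apply/existsP; exists w'; have /forallP/(_ w') -> := con u'.
      by rewrite -!(inj_eq val_inj) /= uc wc.
    exists p => //.
    apply: sub_path pp => a b /= /and3P[ac bc ab].
    by rewrite ab -![val _ == c]/(val _ == val c') !(inj_eq val_inj) ac bc.
  have /forallP/(_ w')/connectP[p pp E] := con u'; exists p => //.
  apply: sub_path pp => a b /= ab; rewrite ab.
  by rewrite !(contraNneq _ cA) // => <-; apply: valP.
move=> [p pp E]; have [|a [b [/andP[ab /andP[ac bc]] Xa Xb]]] :=
  path_crossing (X := fun z : induced A => X (val z)) pp Xu; first by rewrite -E.
by case: (H (val a) (val b) (valP a) (valP b) Xa Xb ab) => E1; move: ac bc; rewrite E1 eqxx.
Qed.

Lemma nonsep_deg A x : nonseparable (induced A) -> 2 < #|A| -> x \in A ->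
  exists y z, [/\ y \in A, z \in A, y != z, adj x y & adj x z].
Proof.
move=> ns cA xA.
case: (boolP (1 < #|[set y in A | adj x y]|)) => [/card_gt1P[y [z []]]|].
  by rewrite !inE => /andP[yA xy] /andP[zA xz] yz; exists y, z.
rewrite -leqNgt => le1; exfalso.
have cx : 1 < #|A :\ x| by have := cardsD1 x A; rewrite xA; lia.
have [c [cA' cx' only]] : exists c, [/\ c \in A, c != x & forall y, y \in A -> adj x y -> y = c].
  case: (set_0Vmem [set y in A | adj x y]) => [E|[c cN]].
    have /card_gt0P[c] : 0 < #|A :\ x| by apply: ltnW.
    rewrite !inE => /andP[cx' cA']; exists c; split=> // y yA xy.
    by have := in_set0 y; rewrite -E inE yA xy.
  move: (cN); rewrite inE => /andP[cA' xc]; exists c; split=> //.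
    by apply: contraTneq xc => ->; rewrite adj_irr.
  move=> y yA xy; apply: (card_le1_eqP le1) => //; by rewrite inE yA.
have /card_gt0P[w] : 0 < #|A :\ x :\ c|.
  by have := cardsD1 c (A :\ x); rewrite !inE cx' cA'; lia.
rewrite !inE => /and3P[wc wx wA].
apply: (nonsep_sep (X := pred1 x) (c := c) ns xA wA) => //=.
  by rewrite eq_sym.
by move=> a b _ bA /eqP-> _ /only; auto.
Qed.

(** Blocks with a cycle can therefore be determined inside the two-core, ignoring the attached
    trees. *)
Lemma nonsep_core A : nonseparable (induced A) -> 2 < #|A| -> A \subset two_core G.
Proof.
move=> ns cA; apply: core_extend => x xA.
have [y [z [yA zA yz xy xz]]] := nonsep_deg ns cA xA.
by exists y, z; rewrite !inE yA zA.
Qed.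

Lemma walk_connect A (e : rel (induced A)) (P : pred G) (x y : induced A) p :
  (forall a b : induced A, P (val a) -> P (val b) -> adj (val a) (val b) -> e a b) ->
  path adj (val x) p -> last (val x) p = val y -> P (val x) ->
  all (fun z => (z \in A) && P z) p -> connect e x y.
Proof.
move=> He; elim: p x => [|z p IH] x /=; first by move=> _ /val_inj-> _ _; apply: connect0.
move=> /andP[xz pp] E Px /andP[/andP[zA Pz] al].
apply: connect_trans (connect1 (He x (Sub z zA) Px Pz xz)) _.
exact: IH.
Qed.

(** A witness that [A] stays connected without [v]: every other vertex walks to the common target
    [z]. *)
Definition hub A v z := [/\ z \in A, z != v & forall x, x \in A -> x != v ->
  exists p, [/\ path adj x p, last x p = z & all (fun y => (y \in A) && (y != v)) p]].

Lemma hub_connect A v z (vA : v \in A) (x y : induced A) : hub A v z ->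
  val x != v -> val y != v ->
  connect [rel a b : induced A | [&& a != Sub v vA, b != Sub v vA & adj a b]] x y.
Proof.
move=> [zA zv H]; set e := [rel a b : _ | _].
have se : connect_sym e.
  apply: sym_connect_sym => a b; rewrite /e /= andbCA; do 2!congr (_ && _).
  exact: adj_sym.
have C (w : induced A) : val w != v -> connect e w (Sub z zA).
  move=> wv; have [p [pp E al]] := H (val w) (valP w) wv.
  apply: (walk_connect (P := fun y => y != v) (y := Sub z zA : induced A) _ pp E wv al) => a b av bv ab.
  by rewrite /e /= -!(inj_eq val_inj) /= av bv.
by move=> xv yv; apply: connect_trans (C x xv) _; rewrite se; apply: C.
Qed.

Lemma hub_not_cut A v z (vA : v \in A) : hub A v z -> ~~ cutvertex (Sub v vA : induced A).
Proof.
move=> H; apply/negP => /existsP[x /existsP[y /and4P[xv yv _ /negP[]]]].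
by apply: (hub_connect _ H); [move: xv|move: yv]; rewrite -(inj_eq val_inj).
Qed.

Lemma nonsepI A : 2 < #|A| -> (forall v, v \in A -> exists z, hub A v z) ->
  nonseparable (induced A).
Proof.
move=> cA H; apply/andP; split; last first.
  by apply/forallP => -[v vA]; have [z hz] := H v vA; apply: (hub_not_cut vA hz).
apply/andP; split.
  have /card_gt0P[x xA] : 0 < #|A| by apply: leq_trans cA.
  by apply/card_gt0P; exists (Sub x xA).
apply/forallP => x; apply/forallP => y.
(* Connectedness itself also comes from a hub, at a third vertex different from [x] and [y]. *)
have /card_gt0P[v] : 0 < #|A :\ val x :\ val y|.
  have := cardsD1 (val x) A; have := cardsD1 (val y) (A :\ val x); lia.
rewrite !inE => /and3P[vy vx vA]; have [z hz] := H v vA.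
have : connect [rel a b : induced A | [&& a != Sub v vA, b != Sub v vA & adj a b]] x y.
  by apply: (hub_connect _ hz); rewrite eq_sym.
by apply: connect_sub => a b /= /and3P[_ _ ab]; apply: connect1.
Qed.

Lemma cyc_rot x (c : seq G) v : lk x c x -> v \in x :: c ->
  exists c', lk v c' v /\ perm_eq (v :: c') (x :: c).
Proof.
move=> l; rewrite inE => /orP[/eqP->|/splitPr_ex[c1 [c2 E]]]; first by exists c.
exists (c2 ++ x :: c1); move: l; rewrite E !lk_cat => /andP[-> ->]; split=> //.
by apply: perm_count => a; cnt.
Qed.

Lemma set_seq_card (s : seq G) : uniq s -> #|[set z in s]| = size s.
Proof. by move=> us; rewrite cardsE; apply/card_uniqP. Qed.

Lemma cycle_nonsep x (c : seq G) : lk x c x -> 1 < size c -> uniq (x :: c) ->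
  nonseparable (induced [set z in x :: c]).
Proof.
move=> l sc U; apply: nonsepI => [|v]; first by rewrite set_seq_card.
rewrite inE => vi; have [c' [l' pm]] := cyc_rot l vi.
have /andP[vc' uc'] : uniq (v :: c') by rewrite (perm_uniq pm).
have [w [c2 E]] : exists w c2, c' = rcons c2 w.
  have : size c' = size c by have /= [] := perm_size pm.
  by case/lastP: c' {l' pm vc' uc'} => [|c2 w] s; [rewrite -s in sc|exists w, c2].
have mem z : z \in c' -> z \in [set z in x :: c].
  by move=> zc; rewrite inE -(perm_mem pm) inE zc orbT.
exists w; split; first by apply: mem; rewrite E mem_rcons mem_head.
  by apply: contraNneq vc' => <-; rewrite E mem_rcons mem_head.
move=> z; rewrite inE -(perm_mem pm) inE => /orP[/eqP->|]; first by rewrite eqxx.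
move=> zc _; have [s1 [s2 E2]] := splitPr_ex zc; exists s2.
move: l'; rewrite lk_last E2 cat_path /= => /andP[/and3P[_ _ ->] _]; split=> //.
  by have := congr1 (last v) E; rewrite E2 last_cat last_rcons.
apply/allP => t ti; have tc : t \in c' by rewrite E2 mem_cat inE ti !orbT.
by rewrite mem //; apply: contraNneq vc' => <-.
Qed.

Lemma theta222_nonsep x y (a b c : G) : lk x [:: a] y -> lk x [:: b] y -> lk x [:: c] y ->
  uniq [:: x; y; a; b; c] -> nonseparable (induced [set z in [:: x; y; a; b; c]]).
Proof.
move=> /and3P[xa ay _] /and3P[xb bY _] /and3P[xc cy _] U; rewrite /= in ay bY cy.
pose A : {set G} := [set z in [:: x; y; a; b; c]]; rewrite -/A.
apply: nonsepI => [|v vA]; first by rewrite set_seq_card.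
have inA z : z \in [:: x; y; a; b; c] -> z \in A by rewrite /A inE.
have Ain z : z \in A -> z \in [:: x; y; a; b; c] by rewrite /A inE.
have [xA yA aA bA] : [/\ x \in A, y \in A, a \in A & b \in A].
  by split; apply: inA; rewrite !inE eqxx ?orbT.
have cA : c \in A by apply: inA; rewrite !inE eqxx ?orbT.
have /and5P[nx ny na nb _] : uniq [:: x; y; a; b; c] by [].
move: nx ny na nb; rewrite !inE !negb_or => /and4P[xy xa' xb' xc'] /and3P[ya yb yc] /andP[ab ac] bc.
have [ax ya' bx yb'] : [/\ adj a x, adj y a, adj b x & adj y b].
  by rewrite ![adj _ x]adj_sym ![adj y _]adj_sym.
have [cx yc'] : adj c x /\ adj y c by rewrite ![adj _ x]adj_sym ![adj y _]adj_sym.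
have ne (s t : G) : s != t -> (s != t) * (t != s) by rewrite [t == s]eq_sym => ->.
have N := (ne _ _ xy, ne _ _ xa', ne _ _ xb', ne _ _ xc', ne _ _ ya, ne _ _ yb, ne _ _ yc,
  ne _ _ ab, ne _ _ ac, ne _ _ bc).
have := Ain v vA; rewrite !inE => /or4P[|||/orP[]] /eqP->; [exists y|exists x|exists x|exists x|exists x];
  split; rewrite ?N //; move=> z zA; have := Ain z zA; rewrite !inE => /or4P[|||/orP[]] /eqP->;
  rewrite ?eqxx // => _;
  first [ by exists [::]
        | by exists [:: x]; rewrite /= ?ax ?bx ?cx ?xA ?N
        | by exists [:: y]; rewrite /= ?ay ?bY ?cy ?yA ?N
        | by exists [:: a; x]; rewrite /= ?ya' ?ax ?aA ?xA ?N
        | by exists [:: b; x]; rewrite /= ?yb' ?bx ?bA ?xA ?N ].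
Qed.

Lemma has_cycle_induced A x (c : seq G) : lk x c x -> 1 < size c -> uniq (x :: c) ->
  {subset x :: c <= A} -> has_cycle (induced A).
Proof.
move=> l sc U sub.
pose s : seq (induced A) := pmap insub (x :: c).
have E : map val s = x :: c.
  rewrite /s (pmap_filter (@insubK _ _ _)); apply/all_filterP/allP => z /sub zA.
  by rewrite insubT.
exists s; split; last by rewrite -(size_map val) E.
rewrite /ucycle -(map_inj_uniq val_inj) E U andbT.
move: l; rewrite /lk; case: s E => // x' s' [<- <-] /=.
by rewrite -map_rcons path_map.
Qed.

Lemma has_cycle_card A : has_cycle (induced A) -> 2 < #|A|.
Proof.
move=> [s [/andP[_ us] ss]]; apply: leq_trans ss _.
rewrite -(card_uniqP us) -(card_sig [in A]); exact: max_card.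
Qed.

Lemma cyclic_blocksI (Bs : seq {set G}) : uniq Bs ->
  (forall B, B \in Bs -> nonseparable (induced B) /\ has_cycle (induced B)) ->
  (forall A, nonseparable (induced A) -> 2 < #|A| -> exists2 B, B \in Bs & A \subset B) ->
  {in Bs &, forall B B', B \subset B' -> B = B'} -> cyclic_blocks Bs.
Proof.
move=> uB nB cl anti; split=> // B; split=> [Bi|[/maxsetP[ns mx] hc]].
  have [ns hc] := nB B Bi; split=> //; apply/maxsetP; split=> // A nA sBA.
  have c2 := leq_trans (has_cycle_card hc) (subset_leq_card sBA).
  have [B' B'i sAB'] := cl A nA c2.
  have E := anti B B' Bi B'i (subset_trans sBA sAB').
  by apply/eqP; rewrite eqEsubset sBA E sAB'.
have [B' B'i sBB'] := cl B ns (has_cycle_card hc).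
by rewrite -(mx B' (nB B' B'i).1 sBB').
Qed.

Lemma steps_index (T : eqType) (s : seq T) a b : uniq s -> (a, b) \in steps s ->
  index b s = (index a s).+1.
Proof.
move=> us /stepsP[s1 [s2 E]]; move: us; rewrite E => us.
have d (t1 t2 : seq T) (z : T) : uniq (t1 ++ z :: t2) -> index z (t1 ++ z :: t2) = size t1.
  rewrite cat_uniq => /and3P[_ /hasPn/(_ z (mem_head _ _)) nz _].
  by rewrite index_cat (negPf nz) /= eqxx addn0.
rewrite (d _ _ _ us); move: us; rewrite -cat_rcons => us.
by rewrite (d _ _ _ us) size_rcons.
Qed.

(** The root separates the lollipop from [T], and the end of the stem separates the cycle from the
    stem. *)
Lemma lol_sep T v (c d : seq G) A : nonseparable (induced A) -> 2 < #|A| ->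
  A \subset T :|: [set z in c ++ d] -> lol v c d ->
  (forall x y, x \in T -> y \in c ++ d -> adj x y -> x = v) ->
  {in v :: c ++ d &, forall x y, adj x y -> lol_edge v c d x y} ->
  A \subset T \/ A \subset [set z in last v c :: d].
Proof.
move=> ns cA /subsetP sA [pc ld sd U] H1 H2.
have wv : last v c \in v :: c by apply: mem_last.
have dis z : z \in v :: c -> z \in d -> False.
  move: U; rewrite -cat_cons cat_uniq => /and3P[_ /hasPn D _] zc zd.
  by have := D z zd; rewrite /= zc.
case: (boolP [exists u in A, u \in c ++ d]) => [/existsP[u /andP[uA ui]]|]; last first.
  rewrite negb_exists => /forallP N; left; apply/subsetP => z zA.
  by have := N z; rewrite zA /= => nz; have := sA z zA; rewrite !inE (negPf nz) orbF.
have vcd : v \notin c ++ d by case/andP: U.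
right; have sV : {subset A <= v :: c ++ d}.
  move=> z zA; rewrite inE; case: (boolP (z \in c ++ d)) => [_|nz]; first exact: orbT.
  rewrite orbF; apply/negPn/negP => zv.
  apply: (nonsep_sep (X := [in c ++ d]) (c := v) ns uA zA) => //.
    by apply: contraNneq vcd => <-.
  move=> x y xA yA xi yi xy; right; apply: (H1 y x) => //; last by rewrite adj_sym.
  by have := sA y yA; rewrite !inE (negPf yi) orbF.
case: (boolP [exists u in A, u \in d]) => [/existsP[t /andP[tA ti]]|].
  apply/subsetP => z zA; rewrite inE inE; apply/negPn/negP; rewrite negb_or => /andP[zw zd].
  apply: (nonsep_sep (X := [in d]) (c := last v c) ns tA zA) => //.
    by apply/negP => /eqP E; apply: (dis t); rewrite ?E // -E.
  move=> x y xA yA xi yi xy; right.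
  have := H2 x y (sV _ xA) (sV _ yA) xy; rewrite /lol_edge => /or3P[/steps_mem[xc _]|/steps_mem[_ xc]|].
  - by case: (dis x xc xi).
  - by case: (dis x xc xi).
  by move=> /edge_of_mem[_]; rewrite !inE orbA orbb => /orP[/eqP->//|yd]; rewrite yd in yi.
rewrite negb_exists => /forallP N; exfalso.
have sC : {subset A <= v :: c}.
  move=> z zA; have := N z; rewrite zA /= => nz.
  by have := sV z zA; rewrite -cat_cons mem_cat (negPf nz) orbF.
have uC : uniq (v :: c) by move: U; rewrite -cat_cons cat_uniq => /andP[].
(* Were [A] within the stem, its first vertex along the stem would have a single neighbor in [A],
   the next vertex. *)
case: (arg_minnP (fun z => index z (v :: c)) uA) => z zA min.
have [y1 [y2 [y1A y2A y12 zy1 zy2]]] := nonsep_deg ns cA zA.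
have ix y : y \in A -> adj z y -> index y (v :: c) = (index z (v :: c)).+1.
  move=> yA zy; have := H2 z y (sV _ zA) (sV _ yA) zy; rewrite /lol_edge => /or3P[|st|].
  - exact: steps_index.
  - by have := min y yA; rewrite (steps_index uC st) ltnn.
  move=> /edge_of_mem[]; rewrite !inE !orbA !orbb.
  move=> /orP[/eqP E1|zd]; last by case: (dis z (sC _ zA) zd).
  move=> /orP[/eqP E2|yd]; last by case: (dis y (sC _ yA) yd).
  by move: zy; rewrite E1 E2 adj_irr.
case/negP: y12; apply/eqP; apply: (index_inj v (sC _ y1A) (sC _ y2A)).
by rewrite (ix _ y1A zy1) (ix _ y2A zy2).
Qed.
End Blocks.

Lemma uniq_catP (T : eqType) (s1 s2 : seq T) z : uniq (s1 ++ s2) -> z \in s1 -> z \in s2 -> False.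
Proof.
by rewrite cat_uniq => /and3P[_ /hasPn D _] z1 z2; have := D z z2; rewrite /= z1.
Qed.

(** * The cases described by the core *)

Section Conclusions.
Variable G : sgraph.
Implicit Types (x y z u v w : G) (p q c d : seq G) (A B S T : {set G}).

Lemma no_ear_adj (S : seq G) h : no_ear S h ->
  (forall x y, x \in S -> y \in S -> h x y -> adj x y) ->
  {in S &, forall x y, adj x y = h x y}.
Proof.
by move=> [_ H1] H2 x y xS yS; apply/idP/idP; [apply: H1|apply: H2].
Qed.

Section Attach.
Variables (Ts : seq G) (v : G) (c d : seq G) (hT : rel G).
Hypothesis vT : v \in Ts.
Hypothesis L : lol v c d.
Hypothesis U : uniq (Ts ++ c ++ d).
Hypothesis hTm : forall x y, hT x y -> x \in Ts /\ y \in Ts.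
Hypothesis hE : {in Ts ++ c ++ d &, forall x y, adj x y = hT x y || lol_edge v c d x y}.

Let inT z : z \in Ts -> z \in Ts ++ c ++ d.
Proof. by rewrite [in X in _ -> X]mem_cat => ->. Qed.

Let inL z : z \in v :: c ++ d -> z \in Ts ++ c ++ d.
Proof.
by rewrite inE [in X in _ -> X]mem_cat => /orP[/eqP->|->]; rewrite ?vT ?orbT.
Qed.

Let both z : z \in Ts -> z \in v :: c ++ d -> z = v.
Proof.
by move=> zT; rewrite inE => /orP[/eqP//|zL]; case: (uniq_catP U zT zL).
Qed.

Lemma attach_core : {in Ts &, forall x y, adj x y = hT x y}.
Proof.
move=> x y xT yT; rewrite hE ?inT //; case hxy: (hT x y) => //=.
apply/negP => l; have [xL yL] := lol_edge_mem l.
by have := lol_edge_adj L l; rewrite (both xT xL) (both yT yL) adj_irr.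
Qed.

Lemma attach_cross x y : x \in Ts -> y \in c ++ d -> adj x y -> x = v.
Proof.
move=> xT yL; have yS : y \in Ts ++ c ++ d by rewrite inL // inE yL orbT.
rewrite (hE (inT xT) yS) => /orP[/hTm[_ yT]|/lol_edge_mem[xL _]]; last exact: both.
by case: (uniq_catP U yT yL).
Qed.

Lemma attach_lol : {in v :: c ++ d &, forall x y, adj x y -> lol_edge v c d x y}.
Proof.
move=> x y xL yL xy; have := xy; rewrite hE ?inL // => /orP[/hTm[xT yT]|//].
by move: xy; rewrite (both xT xL) (both yT yL) adj_irr.
Qed.

Lemma attach_cycle : {in last v c :: d &, forall x y,
  adj x y = edge_of (last v c) d (last v c) x y}.
Proof.
have [pc ld sd U0] := L.
have sub z : z \in last v c :: d -> z \in v :: c ++ d.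
  rewrite -cat_cons mem_cat inE => /orP[/eqP->|->]; last by rewrite orbT.
  by rewrite mem_last.
have D z : z \in last v c :: d -> z \in v :: c -> z = last v c.
  rewrite inE => /orP[/eqP//|zd] zc; rewrite -cat_cons in U0.
  by case: (uniq_catP U0 zc zd).
move=> x y xi yi; apply/idP/idP => [xy|]; last exact: edge_of_adj.
have := attach_lol (sub x xi) (sub y yi) xy.
rewrite /lol_edge => /or3P[/steps_mem[xc yc]|/steps_mem[yc xc]|//];
  by move: xy; rewrite (D x xi xc) (D y yi yc) adj_irr.
Qed.

Lemma attach_sep A : nonseparable (induced A) -> 2 < #|A| ->
  A \subset [set z in Ts ++ c ++ d] ->
  A \subset [set z in Ts] \/ A \subset [set z in last v c :: d].
Proof.
move=> ns cA sA; apply: (lol_sep ns cA _ L _ attach_lol).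
  by apply: subset_trans sA _; apply/subsetP => z; rewrite !inE mem_cat.
by move=> x y; rewrite inE; apply: attach_cross.
Qed.
End Attach.

Variable col : G -> bool.
Hypothesis colE : forall x y, adj x y -> col x != col y.
Hypothesis G_ch : choosable 4 2 G.

Lemma cycle_even x c : lk x c x -> 1 < size c ->
  exists2 s : nat, 0 < s & size (x :: c) = 2 * s.
Proof.
move=> l sc; have o := lk_odd colE l; rewrite eqxx in o.
exists (size c).+1./2; first by lia.
by rewrite /=; lia.
Qed.

Lemma cycle_shape S x c : lk x c x -> 1 < size c -> uniq (x :: c) ->
  (forall z, (z \in S) = (z \in x :: c)) ->
  {in x :: c &, forall u v, adj u v = edge_of x c x u v} ->
  exists2 s : nat, 0 < s & iso (induced S) (cycle_graph (2 * s)).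
Proof.
move=> l sc U SE hE; have [s s0 E] := cycle_even l sc; exists s => //.
apply: (cycle_graph_iso SE U) => [u v|]; last by rewrite E.
by rewrite !SE; apply: hE.
Qed.

Definition theta_concl S := 
  (exists s t : nat, [/\ 0 < s, 0 < t & iso (induced S) (theta 2 (2 * s) (2 * t))]) \/
  (exists s t : nat, [/\ 0 < s, 0 < t & iso (induced S) (theta 1 (2 * s + 1) (2 * t + 1))]).

Lemma theta_shape S x y p q r : theta_in x y p q r ->
  (forall z, (z \in S) = (z \in x :: y :: p ++ q ++ r)) ->
  {in x :: y :: p ++ q ++ r &, forall u v, adj u v = theta_edge x y p q r u v} ->
  theta_concl S.
Proof.
move=> T SE hE.
have [o2 o3 sz] := theta_in_sizes G_ch colE T.
(* The shortest path is moved to the front; it has one internal vertex if the lengths are even and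
   none if they are odd. *)
have main p' q' r' : theta_in x y p' q' r' ->
    (forall z, (z \in x :: y :: p' ++ q' ++ r') = (z \in x :: y :: p ++ q ++ r)) ->
    (forall u v, theta_edge x y p' q' r' u v = theta_edge x y p q r u v) ->
    odd (size q') = odd (size p') -> odd (size r') = odd (size p') ->
    size p' = odd (size p') :> nat -> theta_concl S.
  move=> T' mE eE oq or_ sp; have [_ _ _ U s0] := T'.
  have I : iso (induced S) (theta (size p').+1 (size q').+1 (size r').+1).
    apply: theta_iso U _ => [z|u v]; first by rewrite SE mE.
    by rewrite !SE eE; apply: hE.
  case O: (odd (size p')) in oq or_ sp.
    left; exists (size q').+1./2, (size r').+1./2; split; [lia|lia|].
    have -> : 2 * (size q').+1./2 = (size q').+1 by lia.
    have -> : 2 * (size r').+1./2 = (size r').+1 by lia.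
    by rewrite sp in I.
  right; exists (size q')./2, (size r')./2; rewrite sp /= in s0 I.
  split; [lia|lia|].
  have -> : 2 * (size q')./2 + 1 = (size q').+1 by lia.
  by have -> : 2 * (size r')./2 + 1 = (size r').+1 by lia.
have {}sz : [\/ size p = odd (size p) :> nat, size q = odd (size q) :> nat |
    size r = odd (size r) :> nat].
  rewrite -o2 -o3; move: sz; case: (odd (size p)) => /or3P[]/eqP->; by
    [apply: Or31|apply: Or32|apply: Or33].
case: sz => sz.
- exact: (main p q r).
- apply: (main q p r (theta_in_swap12 T)) => // [z|u v|].
  + by rewrite !(inE, mem_cat) [(z \in q) || _]orbCA.
  + exact: theta_edge_swap12.
  by rewrite -o3 o2.
apply: (main r p q (theta_in_swap12 (theta_in_swap23 T))) => // [z|u v|].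
- by rewrite !(inE, mem_cat) [(z \in r) || _]orbC -!orbA.
- by rewrite theta_edge_swap12 theta_edge_swap23.
by rewrite -o2 o3.
Qed.

Lemma theta_edge_mem x y p q r u v : theta_edge x y p q r u v ->
  u \in x :: y :: p ++ q ++ r /\ v \in x :: y :: p ++ q ++ r.
Proof.
by rewrite /theta_edge => /or3P[] /edge_of_mem[]; rewrite !(inE, mem_cat) =>
  /or3P[]-> /or3P[]->; rewrite ?orbT.
Qed.

Lemma theta_edge_adj x y p q r u v : theta_in x y p q r -> theta_edge x y p q r u v -> adj u v.
Proof. by case=> l1 l2 l3 _ _; rewrite /theta_edge => /or3P[]; apply: edge_of_adj. Qed.

Lemma tree_case x : connected G -> {subset two_core G <= [:: x]} ->
  iso (core G) (complete_graph 1).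
Proof.
move=> /andP[/card_gt0P[x0 _] _] sub.
have E0 : two_core G = set0.
  apply/setP => z; rewrite inE; apply/negP => /two_coreP[a [b [/sub aK /sub bK ab _ _]]].
  by move: aK bK ab; rewrite !inE => /eqP-> /eqP->; rewrite eqxx.
have [y Ey] : exists y, core_set G = [set y].
  rewrite /core_set E0 eqxx; case: pickP => [y _|/(_ x0)//]; by exists y.
rewrite /core Ey; apply: (iso_induced (f := fun _ : complete_graph 1 => y)) => [i j _|z|i j].
- by rewrite [i]ord1 [j]ord1.
- by rewrite inE; apply/eqP/codomP => [->|[i ->]//]; exists ord0.
by rewrite adj_irr [i]ord1 [j]ord1 adj_irr.
Qed.

Lemma cycle_case x c : lk x c x -> 1 < size c -> uniq (x :: c) ->
  no_ear (x :: c) (edge_of x c x) ->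
  exists s : nat, 0 < s /\ iso (core G) (cycle_graph (2 * s)).
Proof.
move=> l sc U ne; have E := core_setE ne (cycle_core l sc U) isT.
have [||s s0 I] := cycle_shape (S := core_set G) l sc U.
- by move=> z; rewrite E inE.
- by apply: (no_ear_adj ne) => u v _ _; apply: edge_of_adj.
by exists s.
Qed.

Lemma theta_case x y p q r : theta_in x y p q r ->
  no_ear (x :: y :: p ++ q ++ r) (theta_edge x y p q r) -> theta_concl (core_set G).
Proof.
move=> T ne; have E := core_setE ne (theta_core T) isT.
apply: (theta_shape T) => [z|]; first by rewrite E inE.
by apply: (no_ear_adj ne) => u v _ _; apply: theta_edge_adj.
Qed.

Lemma K24_case x y (a b c d : G) : K24_in x y a b c d ->
  no_ear [:: x; y; a; b; c; d] (K24_edge x y a b c d) ->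
  iso (core G) (complete_bipartite 2 4).
Proof.
move=> [l1 l2 l3 l4 U] ne.
have sup : {subset [:: x; y; a; b; c; d] <= two_core G}.
  have T1 : theta_in x y [:: a] [:: b] [:: c] by split=> //; ucnt U.
  have T2 : theta_in x y [:: a] [:: b] [:: d] by split=> //; ucnt U.
  have C1 := theta_core T1; have C2 := theta_core T2.
  move=> z zi; case: (eqVneq z d) => [->|zd]; first by apply: C2; rewrite !inE eqxx !orbT.
  by apply: C1; move: zi; rewrite !inE (negPf zd) orbF.
have E := core_setE ne sup isT.
have hA : forall u v, K24_edge x y a b c d u v -> adj u v.
  have ad u v : u \in [:: x; y] -> v \in [:: a; b; c; d] -> adj u v.
    move: l1 l2 l3 l4; rewrite /lk /= !andbT.
    move=> /andP[? ?] /andP[? ?] /andP[? ?] /andP[? ?].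
    by rewrite !inE => /orP[]/eqP-> /or4P[]/eqP->; rewrite // adj_sym.
  by move=> u v /orP[/andP[]|/andP[vi ui]]; [apply: ad|rewrite adj_sym; apply: ad].
apply: (@K24_iso G (core_set G) x y a b c d _ U) => [z|u v]; first by rewrite E inE.
rewrite !E !inE => ui vi; apply: (no_ear_adj ne); rewrite ?inE // => s t _ _; exact: hA.
Qed.

Lemma VI_case (a1 a2 b1 b2 a0 : G) p : VI_in a1 a2 b1 b2 a0 p ->
  no_ear (a1 :: a2 :: b1 :: b2 :: a0 :: p) (VI_edge a1 a2 b1 b2 a0 p) ->
  exists (u v : K33_minus_edge) (k : nat),
    [/\ adj u v, degree u = 2 & iso (core G) (subdivide u v (2 * k))].
Proof.
move=> V ne; have [[e11 e12 e21 e22] l0 lp U] := V.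
have sup : {subset a1 :: a2 :: b1 :: b2 :: a0 :: p <= two_core G}.
  have C := theta_core (VI_theta colE V).
  by move=> z zi; apply: C; move: z zi; scnt.
have E := core_setE ne sup isT.
have op : odd (size p).
  by rewrite (lk_odd colE lp); move: (colE e11) (colE e21); case: (col a1) (col a2) (col b1) => [] [] [].
case: p V ne lp U sup E op => // w p V ne lp U sup E op.
have hA u v : VI_edge a1 a2 b1 b2 a0 (w :: p) u v -> adj u v.
  have /and3P[e01 e02 _] : lk b1 [:: a0] b2 by [].
  have ad s t : s \in [:: a1; a2; a0] -> t \in [:: b1; b2] -> adj s t.
    rewrite adj_sym in e01.
    by rewrite !inE => /or3P[]/eqP-> /orP[]/eqP->.
  rewrite /VI_edge => /or3P[/andP[]|/andP[vi ui]|]; [exact: ad| |exact: edge_of_adj].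
  by rewrite adj_sym; apply: ad.
have [||u [v [uv du I]]] := @VI_iso G (core_set G) a1 a2 b1 b2 a0 w p _ U.
- by move=> z; rewrite E inE.
- move=> u v; rewrite !E => ui vi; rewrite inE in ui; rewrite inE in vi.
  by apply: (no_ear_adj ne) => // s t _ _; apply: hA.
(* The path has an odd number of internal vertices; its first one, [w], belongs to K_{3,3} minus an
   edge, so an even number of subdividing vertices remains. *)
exists u, v, (size p)./2; split=> //.
by have -> : 2 * (size p)./2 = size p by move: op => /=; lia.
Qed.
End Conclusions.

(** * The cases described by the blocks *)

Section BlockCases.
Variable G : sgraph.
Implicit Types (x y z u v w : G) (p q c d : seq G) (A B S T : {set G}).

(** Relative to a part [S] of the graph, so that lollipops can be attached one after another before
    [S] is known to contain the two-core. *)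
Definition cyclic_blocks_in (S : seq G) (Bs : seq {set G}) := [/\ uniq Bs,
  forall B, B \in Bs -> [/\ nonseparable (induced B), has_cycle (induced B) & {subset B <= S}],
  forall A, nonseparable (induced A) -> 2 < #|A| -> {subset A <= S} ->
    exists2 B, B \in Bs & A \subset B
  & {in Bs &, forall B B', B \subset B' -> B = B'}].

Lemma cyclic_blocks_in1 (S : seq G) : nonseparable (induced [set z in S]) ->
  has_cycle (induced [set z in S]) -> cyclic_blocks_in S [:: [set z in S]].
Proof.
move=> ns hc; split=> // [B|A _ _ sA|B B'].
- by rewrite inE => /eqP->; split=> // z; rewrite inE.
- by exists [set z in S]; rewrite ?mem_head //; apply/subsetP => z /sA; rewrite inE.
by rewrite !inE => /eqP-> /eqP->.
Qed.

Lemma cyclic_blocks_core (S : seq G) Bs : cyclic_blocks_in S Bs ->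
  {subset two_core G <= S} -> cyclic_blocks Bs.
Proof.
move=> [uB nB cov anti] sub; apply: cyclic_blocksI => // [B /nB[]//|A ns cA].
by apply: cov => // z zA; apply: sub; apply: (subsetP (nonsep_core ns cA)).
Qed.

Lemma cyclic_blocks_perm (Bs Bs' : seq {set G}) : perm_eq Bs Bs' -> cyclic_blocks Bs ->
  cyclic_blocks Bs'.
Proof.
by move=> pm [uB H]; split=> [|B]; rewrite -?(perm_uniq pm) // -(perm_mem pm).
Qed.

Section Attach.
Variables (Ts : seq G) (v : G) (c d : seq G) (hT : rel G).
Hypothesis vT : v \in Ts.
Hypothesis L : lol v c d.
Hypothesis U : uniq (Ts ++ c ++ d).
Hypothesis hTm : forall x y, hT x y -> x \in Ts /\ y \in Ts.
Hypothesis hE : {in Ts ++ c ++ d &, forall x y, adj x y = hT x y || lol_edge v c d x y}.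

Lemma attach_blocks Bs : cyclic_blocks_in Ts Bs ->
  cyclic_blocks_in (Ts ++ c ++ d) ([set z in last v c :: d] :: Bs).
Proof.
have [pc ld sd Uv] := L; set C := [set z in last v c :: d].
have Uc : uniq (last v c :: d).
  by apply: (uniq_le Uv) => a; have := count_belast c v a; cnt.
have hC : has_cycle (induced C).
  by apply: (has_cycle_induced ld sd Uc) => z; rewrite /C !inE.
have [w wd] : exists w, w \in d by case: d sd => // w d' _; exists w; rewrite mem_head.
have wT : w \notin Ts.
  by apply/negP => wT; apply: (uniq_catP U wT); rewrite mem_cat wd orbT.
move=> [uB nB cov anti].
have CB B : B \in Bs -> C \subset B -> False.
  move=> /nB[_ _ sB] /subsetP/(_ w); rewrite !inE wd orbT => /(_ isT) /sB.
  by rewrite (negPf wT).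
(* A vertex common to [Ts] and the new cycle can only be [v], so such a [B] would have at most one
   vertex. *)
have BC B : B \in Bs -> B \subset C -> False.
  move=> /nB[_ hB sB] /subsetP BC; have := has_cycle_card hB; rewrite ltnNge => /negP[].
  rewrite ltnW // ltnS -(cards1 v) subset_leq_card //; apply/subsetP => z zB.
  have zT := sB z zB; have := BC z zB; rewrite !inE => /orP[/eqP zl|zd].
    have := mem_last v c; rewrite -zl inE => /orP[//|zc].
    by case: (uniq_catP U zT); rewrite mem_cat zc.
  by case: (uniq_catP U zT); rewrite mem_cat zd orbT.
split.
- rewrite /= uB andbT; apply/negP => /CB; exact.
- move=> B; rewrite inE => /orP[/eqP->|/nB[ns hc sB]]; last first.
    by split=> // z /sB; rewrite [in X in _ -> X]mem_cat => ->.
  split=> //; first exact: cycle_nonsep.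
  move=> z; rewrite !inE => /orP[/eqP->|zd]; last by rewrite !mem_cat zd !orbT.
  by rewrite !mem_cat; have := mem_last v c; rewrite inE => /orP[/eqP->|->]; rewrite ?vT ?orbT.
- move=> A ns cA sA; have [|sAT|sAC] := attach_sep vT L U hTm hE ns cA.
  + by apply/subsetP => z /sA; rewrite inE.
  + have [|B Bi sB] := cov A ns cA; last by exists B; rewrite // inE Bi orbT.
    by move=> z /(subsetP sAT); rewrite inE.
  by exists C; rewrite ?mem_head.
move=> B B'; rewrite !inE => /orP[/eqP->|Bi] /orP[/eqP->|B'i] // s.
- by case: (CB B').
- by case: (BC B).
exact: anti.
Qed.

Lemma attach_first : exists2 y, y \in c ++ d & adj v y.
Proof.
have [pc ld sd _] := L; case: c pc ld => [|y c'] /= => [_|/andP[vy _] _]; last first.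
  by exists y; rewrite ?mem_head.
by case: d sd => // y d' _ /andP[vy _]; exists y; rewrite ?mem_head.
Qed.

Lemma attach_cut x : core_set G =i Ts ++ c ++ d -> x \in Ts -> adj v x ->
  v \in core_cutvertices G.
Proof.
move=> KE xT vx; have [y yi vy] := attach_first.
have inK z : z \in Ts -> z \in core_set G by rewrite KE mem_cat => ->.
have yK : y \in core_set G by rewrite KE mem_cat yi orbT.
have vK := inK v vT; have xK := inK x xT.
pose v' : core G := Sub v vK; pose x' : core G := Sub x xK; pose y' : core G := Sub y yK.
apply/imsetP; exists v' => //; rewrite inE; apply/existsP; exists x'; apply/existsP; exists y'.
have nv z : adj v z -> z != v by apply: contraTneq => ->; rewrite adj_irr.
rewrite -!(inj_eq val_inj) /= !nv //=; apply/andP; split.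
  apply: (@connect_trans _ _ v'); apply: connect1 => //.
  by rewrite /adj /= /induced_adj /= adj_sym.
apply/negP => /connectP[p pp E].
have [||s [t [/and3P[sv _ st] sT tT]]] := path_crossing (X := fun z : core G => val z \in Ts) pp.
- by [].
- by rewrite -E; apply/negP => yT; case: (uniq_catP U yT yi).
have ti : val t \in c ++ d by have := valP t; rewrite /= KE mem_cat (negPf tT).
by move: sv; rewrite -(inj_eq val_inj) /= (attach_cross vT U hTm hE sT ti st) eqxx.
Qed.

(** Vertices of the lollipop first walk back to the root [v], which is different from [w], and
    continue inside [Ts]. *)
Lemma attach_hub w z : w != v -> w \in Ts -> hub [set z in Ts] w z ->
  hub [set z in Ts ++ c ++ d] w z.
Proof.
move=> wv wT [zT zw H]; split=> //; first by move: zT; rewrite !inE mem_cat => ->.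
have {}H x : x \in Ts -> x != w -> exists p, [/\ path adj x p, last x p = z &
    all (fun y => (y \in [set z in Ts ++ c ++ d]) && (y != w)) p].
  move=> xT xw; have [|p [pp lp ap]] := H x _ xw; first by rewrite inE.
  exists p; split=> //; apply: sub_all ap => y /andP[yT ->].
  by move: yT; rewrite !inE mem_cat => ->.
move=> x; rewrite inE mem_cat => /orP[xT|xi] xw; first exact: H.
have [k [r [lkk _ pm]]] := lol_reach L xi; have [|p [pp lp ap]] := H v vT; first by rewrite eq_sym.
exists (rcons (rev k) v ++ p); rewrite cat_path last_cat last_rcons pp all_cat ap !andbT; split=> //.
  by rewrite -[path _ _ _]/(lk x (rev k) v) -lk_rev.
apply/allP => y; rewrite mem_rcons inE mem_rev => /orP[/eqP->|yk].
  by rewrite inE mem_cat vT eq_sym.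
have yi : y \in c ++ d by rewrite (perm_mem pm) mem_cat yk.
rewrite inE mem_cat yi orbT; apply/negP => /eqP yw.
by apply: (uniq_catP U wT); rewrite -yw.
Qed.
End Attach.

Variable col : G -> bool.
Hypothesis colE : forall x y, adj x y -> col x != col y.

Lemma lol_cycle_shape v c d : lol v c d ->
  {in last v c :: d &, forall x y, adj x y = edge_of (last v c) d (last v c) x y} ->
  exists2 s : nat, 0 < s & iso (induced [set z in last v c :: d]) (cycle_graph (2 * s)).
Proof.
move=> [pc ld sd Uv]; apply: (cycle_shape colE ld sd) => [|z]; last by rewrite inE.
by apply: (uniq_le Uv) => a; have := count_belast c v a; cnt.
Qed.

Lemma cycle_edge_mem v c x y : edge_of v c v x y -> x \in v :: c /\ y \in v :: c.
Proof. by move=> /edge_of_mem[]; rewrite !inE !orbA !orbb. Qed.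

Lemma dumb_case v c0 c d : lk v c0 v -> 1 < size c0 -> lol v c d ->
  uniq (v :: c0 ++ c ++ d) -> no_ear (v :: c0 ++ c ++ d) (dumb_edge v c0 c d) ->
  exists (s t : nat) (B1 B2 : {set G}),
    [/\ 0 < s, 0 < t, cyclic_blocks [:: B1; B2],
        iso (induced B1) (cycle_graph (2 * s)) & iso (induced B2) (cycle_graph (2 * t))].
Proof.
move=> l0 s0 L U ne.
have U0 : uniq (v :: c0) by ucnt U.
have vT : v \in v :: c0 by rewrite mem_head.
rewrite -cat_cons in U.
have hE : {in (v :: c0) ++ c ++ d &, forall x y,
    adj x y = edge_of v c0 v x y || lol_edge v c d x y}.
  apply: (no_ear_adj ne) => x y _ _ /orP[]; [exact: edge_of_adj|exact: lol_edge_adj].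
have hm := @cycle_edge_mem v c0.
have [s sp Is] := lol_cycle_shape L (attach_cycle vT L U hm hE).
have [|t tp It] := cycle_shape colE (S := [set z in v :: c0]) l0 s0 U0 _ (attach_core L U hE).
  by move=> z; rewrite inE.
exists s, t, [set z in last v c :: d], [set z in v :: c0]; split=> //.
apply: (cyclic_blocks_core (attach_blocks vT L U hm hE _) ne.1).
apply: cyclic_blocks_in1; first exact: cycle_nonsep.
by apply: (has_cycle_induced l0 s0 U0) => z; rewrite !inE.
Qed.

Lemma theta_cycle_case x y (a1 a2 a3 : G) v c d : theta_in x y [:: a1] [:: a2] [:: a3] ->
  v \in [:: x; y; a1; a2; a3] -> lol v c d -> uniq ([:: x; y; a1; a2; a3] ++ c ++ d) ->
  no_ear ([:: x; y; a1; a2; a3] ++ c ++ d) (tripod_edge x y [:: a1] [:: a2] [:: a3] v c d) ->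
  exists (s : nat) (B1 B2 : {set G}),
    [/\ 0 < s, cyclic_blocks [:: B1; B2], iso (induced B1) (theta 2 2 2)
      & iso (induced B2) (cycle_graph (2 * s))].
Proof.
move=> T vT L U ne; have [l1 l2 l3 U0 _] := T.
pose hT := theta_edge x y [:: a1] [:: a2] [:: a3].
have hE : {in [:: x; y; a1; a2; a3] ++ c ++ d &, forall x y,
    adj x y = hT x y || lol_edge v c d x y}.
  apply: (no_ear_adj ne) => s t _ _ /orP[]; [exact: theta_edge_adj|exact: lol_edge_adj].
have hm s t : hT s t -> s \in [:: x; y; a1; a2; a3] /\ t \in [:: x; y; a1; a2; a3].
  exact: theta_edge_mem.
have [s sp Is] := lol_cycle_shape L (attach_cycle vT L U hm hE).
exists s, [set z in [:: x; y; a1; a2; a3]], [set z in last v c :: d]; split=> //; last first.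
  apply: (@theta_iso G _ x y [:: a1] [:: a2] [:: a3]) => // [z|u w]; rewrite !inE //.
  by move=> ui wi; apply: (attach_core L U hE); rewrite !inE.
apply: (@cyclic_blocks_perm [:: _; _]); last first.
  apply: (cyclic_blocks_core (attach_blocks vT L U hm hE _) ne.1).
  apply: cyclic_blocks_in1; first exact: (theta222_nonsep l1 l2 l3).
  apply: (@has_cycle_induced G _ x [:: a1; y; a2]) => //.
  - by rewrite -[[:: a1; y; a2]]/([:: a1] ++ y :: [:: a2]) lk_cat l1 -[[:: a2]]/(rev [:: a2]) -lk_rev.
  - by ucnt U0.
  by move=> z zi; rewrite inE; move: z zi; scnt.
by rewrite -[[:: _; _]]/(rev [:: _; _]) perm_rev.
Qed.

(** The path starts with an edge of the first cycle, goes back along the stem to [u], crosses the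
    square through [a] to [v], and follows the other stem to an edge of the last cycle. *)
Lemma square_path u v (a b : G) c d c' d' : adj u a -> adj a v -> lol u c d -> lol v c' d' ->
  uniq ([:: u; v; a; b] ++ c ++ d ++ c' ++ d') ->
  path_through [set z in last u c :: d] [set z in [:: u; a; v; b]] [set z in last v c' :: d'].
Proof.
move=> ua av [pc ld sd _] [pc' ld' sd' _] U.
case: d ld sd U => // z1 d1 /andP[wz1 _] _ U.
case: d' ld' sd' U => // z2 d2 /andP[wz2 _] _ U.
have rE : rev (u :: c) = last u c :: rev (belast u c) by rewrite lastI rev_rcons.
have lE : last (last u c) (rev (belast u c)) = u.
  by rewrite -[LHS]/(last u (last u c :: _)) -rE rev_cons last_rcons.
exists z1, (rev (u :: c) ++ a :: (v :: c') ++ [:: z2]).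
exists (z1, last u c), (u, a), (last v c', z2); split.
- rewrite rE /= cat_path lE /= cat_path /= ua av pc' wz2 [adj z1 _]adj_sym wz1 /=.
  by rewrite rev_path !andbT; apply: sub_path pc => s t; rewrite adj_sym.
- by ucnt U.
- rewrite rE -[z1 :: _ ++ _]/([:: z1] ++ last u c :: rev (belast u c) ++ a :: (v :: c') ++ [:: z2]).
  rewrite (steps_cat z1 [::]) (steps_cat (last u c)) lE -cat_cons steps_cat.
  apply: (@cat_subseq _ [:: _] [:: _; _] [:: _]); first exact: subseq_refl.
  apply: subseq_trans (suffix_subseq _ _).
  apply: (@cat_subseq _ [:: _] [:: _] [:: _]); first exact: subseq_refl.
  exact: suffix_subseq.
by split; rewrite in_setX !inE /= ?eqxx ?orbT.
Qed.

Lemma square_case u v (a b : G) c d c' d' : lk u [:: a; v; b] u -> lol u c d -> lol v c' d' ->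
  uniq ([:: u; v; a; b] ++ c ++ d ++ c' ++ d') ->
  no_ear ([:: u; v; a; b] ++ c ++ d ++ c' ++ d') (square_edge u v a b c d c' d') ->
  exists (s t : nat) (B1 B2 B3 : {set G}),
    [/\ 0 < s, 0 < t, cyclic_blocks [:: B1; B2; B3],
        [/\ iso (induced B1) (cycle_graph (2 * s)),
            iso (induced B2) (cycle_graph 4)
          & iso (induced B3) (cycle_graph (2 * t))]
      & path_through B1 B2 B3 /\
        exists u v : G,
          [/\ B2 :&: core_cutvertices G = [set u; v], u != v & ~~ adj u v]].
Proof.
move=> l4 L L' U ne.
pose Q := [:: u; a; v; b].
pose h1 (x y : G) := edge_of u [:: a; v; b] u x y || lol_edge v c' d' x y.
have SE z : (z \in (Q ++ c' ++ d') ++ c ++ d) = (z \in [:: u; v; a; b] ++ c ++ d ++ c' ++ d').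
  by apply/idP/idP; move: z; scnt.
have U2 : uniq ((Q ++ c' ++ d') ++ c ++ d) by ucnt U.
have U1 : uniq (Q ++ c' ++ d') by ucnt U.
have UQ : uniq Q by ucnt U.
have hE2 : {in (Q ++ c' ++ d') ++ c ++ d &, forall x y, adj x y = h1 x y || lol_edge u c d x y}.
  move=> x y; rewrite !SE => xi yi.
  rewrite /h1 -orbA [lol_edge v _ _ _ _ || _]orbC; apply: (no_ear_adj ne) => // s t _ _.
  move=> /or3P[]; [exact: edge_of_adj|exact: lol_edge_adj|exact: lol_edge_adj].
have uQ : u \in Q by rewrite mem_head.
have vQ : v \in Q by rewrite !inE eqxx !orbT.
have uT : u \in Q ++ c' ++ d' by rewrite mem_cat uQ.
have hm : forall x y, edge_of u [:: a; v; b] u x y -> x \in Q /\ y \in Q.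
  exact: cycle_edge_mem.
have hm1 x y : h1 x y -> x \in Q ++ c' ++ d' /\ y \in Q ++ c' ++ d'.
  rewrite (mem_cat x Q) (mem_cat y Q) => /orP[/hm[-> ->]//|/lol_edge_mem[]].
  by rewrite (in_cons v _ x) (in_cons v _ y) => /orP[/eqP->|->] /orP[/eqP->|->]; rewrite ?vQ ?orbT.
have hE1 := attach_core L U2 hE2.
have [s sp Is] := lol_cycle_shape L (attach_cycle uT L U2 hm1 hE2).
have [t tp It] := lol_cycle_shape L' (attach_cycle vQ L' U1 hm hE1).
have IQ : iso (induced [set z in Q]) (cycle_graph 4).
  apply: (@cycle_graph_iso G _ u [:: a; v; b]) => // [z|x y]; rewrite !inE // => xi yi.
  by apply: (attach_core L' U1 hE1); rewrite !inE.
pose B1 := [set z in last u c :: d]; pose B3 := [set z in last v c' :: d'].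
have Bs : cyclic_blocks [:: B1; B3; [set z in Q]].
  apply: (cyclic_blocks_core (S := (Q ++ c' ++ d') ++ c ++ d)); last first.
    by move=> z /ne.1; rewrite SE.
  apply: (attach_blocks uT L U2 hm1 hE2); apply: (attach_blocks vQ L' U1 hm hE1).
  apply: cyclic_blocks_in1; first exact: cycle_nonsep.
  by apply: (has_cycle_induced l4 _ UQ) => // z; rewrite !inE.
have KE : core_set G =i (Q ++ c' ++ d') ++ c ++ d.
  have CQ := cycle_core l4 isT UQ.
  have C1 := lol_core (CQ u uQ) L; have C2 := lol_core (CQ v vQ) L'.
  move=> z; rewrite SE (core_setE ne) ?inE // => {}z zi.
  have : [|| z \in Q, z \in v :: c' ++ d' | z \in u :: c ++ d].
    by move: zi; rewrite -SE !mem_cat !(inE, mem_cat) => /orP[/or3P[->|->|->]|/orP[->|->]]; rewrite ?orbT.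
  by case/or3P => [/CQ|/C2|/C1].
have /and5P[ua av vb bu _] : [&& adj u a, adj a v, adj v b, adj b u & true] by [].
have va : adj v a by rewrite adj_sym.
have cu : u \in core_cutvertices G.
  by apply: (attach_cut uT L U2 hm1 hE2 KE _ ua); rewrite mem_cat !inE eqxx orbT.
(* [attach_cut] concerns the lollipop attached last, so for [v] the two lollipops are attached in
   the other order. *)
have SE' z : (z \in (Q ++ c ++ d) ++ c' ++ d') = (z \in (Q ++ c' ++ d') ++ c ++ d).
  by apply/idP/idP; move: z; scnt.
have vT' : v \in Q ++ c ++ d by rewrite mem_cat vQ.
pose h2 (x y : G) := edge_of u [:: a; v; b] u x y || lol_edge u c d x y.
have hm2 x y : h2 x y -> x \in Q ++ c ++ d /\ y \in Q ++ c ++ d.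
  rewrite (mem_cat x Q) (mem_cat y Q) => /orP[/hm[-> ->]//|/lol_edge_mem[]].
  by rewrite (in_cons u _ x) (in_cons u _ y) => /orP[/eqP->|->] /orP[/eqP->|->]; rewrite ?uQ ?orbT.
have hE2' : {in (Q ++ c ++ d) ++ c' ++ d' &, forall x y, adj x y = h2 x y || lol_edge v c' d' x y}.
  by move=> x y; rewrite !SE' => xi yi; rewrite hE2 // /h1 /h2 orbAC.
have U2' : uniq ((Q ++ c ++ d) ++ c' ++ d') by ucnt U.
exists s, t, B1, [set z in Q], B3; split=> //.
  by apply: cyclic_blocks_perm Bs; rewrite perm_cons (perm_catC [:: _] [:: _]).
split; last first.
  exists u, v; split; last 2 first.
  - by have /andP[] := UQ; rewrite !inE !negb_or => /and3P[].
  - apply/negP => /colE; have := colE ua; have := colE av.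
    by case: (col u) (col a) (col v) => [] [] [].
  have cv : v \in core_cutvertices G.
    apply: (attach_cut vT' L' U2' hm2 hE2' _ _ va) => [z|]; first by rewrite KE SE'.
    by rewrite mem_cat !inE eqxx orbT.
  (* A hub in the square extends over both lollipops, so [a] and [b] do not separate the core. *)
  have nocut w : hub [set z in Q] w u -> w != v -> w != u -> w \in Q -> w \notin core_cutvertices G.
    move=> h wv wu wQ; have h1' := attach_hub vQ L' U1 wv wQ h.
    have wT : w \in Q ++ c' ++ d' by rewrite mem_cat wQ.
    have [h2a h2b h2c] := attach_hub uT L U2 wu wT h1'.
    have hK : hub (core_set G) w u.
      have KS z : (z \in core_set G) = (z \in [set z in (Q ++ c' ++ d') ++ c ++ d]).
        by rewrite KE inE.
      split=> // [|x xK xw]; first by rewrite KS.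
      have [|p [pp lp ap]] := h2c x _ xw; first by rewrite -KS.
      by exists p; split=> //; apply: sub_all ap => z; rewrite KS.
    apply/imsetP => -[[w' wK]]; rewrite inE => cw E; rewrite /= in E.
    by move: cw; apply/negP; apply: (@hub_not_cut _ _ _ u wK); rewrite -E.
  have [na nb] : a \notin core_cutvertices G /\ b \notin core_cutvertices G.
    have /and5P[nu na' nv _ _] : uniq Q by [].
    move: nu na' nv; rewrite !inE !negb_or => /and3P[ua' uv' ub'] /andP[av' ab'] vb'.
    have ba : adj b v by rewrite adj_sym.
    have N := (ua', uv', ub', av', ab', vb', eq_sym a u, eq_sym a v, eq_sym b u, eq_sym b v, eq_sym b a).
    split; apply: nocut; rewrite ?N ?inE ?eqxx ?orbT //; split; rewrite ?N ?inE ?eqxx //.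
      move=> x; rewrite !inE => /or4P[]/eqP-> //; rewrite ?eqxx // => _.
      - by exists [::].
      - by exists [:: b; u]; rewrite /= vb bu !inE !eqxx !orbT !N.
      by exists [:: u]; rewrite /= bu !inE !eqxx !N.
    move=> x; rewrite !inE => /or4P[]/eqP-> //; rewrite ?eqxx // => _.
    - by exists [::].
    - by exists [:: u]; rewrite /= adj_sym ua !inE !eqxx !N.
    by exists [:: a; u]; rewrite /= va [adj a u]adj_sym ua !inE !eqxx !orbT !N.
  apply/setP => z; rewrite inE [z \in [set _; _]]inE !in_set1 inE; apply/andP/orP => [[]|].
    rewrite !inE => /or4P[]/eqP-> zc; rewrite ?eqxx; auto.
      by rewrite zc in na.
    by rewrite zc in nb.
  by move=> [/eqP->|/eqP->]; rewrite ?uQ ?vQ.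
exact: square_path.
Qed.
End BlockCases.

Theorem theorem15 (G : sgraph) (G_conn : connected G)
    (G_choosable : choosable 4 2 G) :
  [\/ iso (core G) (complete_graph 1),
      exists s : nat, 0 < s /\ iso (core G) (cycle_graph (2 * s)),
      exists s t : nat,
        [/\ 0 < s, 0 < t & iso (core G) (theta 2 (2 * s) (2 * t))]
    | exists s t : nat,
        [/\ 0 < s, 0 < t
          & iso (core G) (theta 1 (2 * s + 1) (2 * t + 1))]]
  \/
  (iso (core G) (complete_bipartite 2 4)
   \/
   exists (u v : K33_minus_edge) (k : nat),
     [/\ adj u v, degree u = 2
       & iso (core G) (subdivide u v (2 * k))])
  \/
  [\/ exists (s t : nat) (B1 B2 : {set G}),
        [/\ 0 < s, 0 < t, cyclic_blocks [:: B1; B2],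
            iso (induced B1) (cycle_graph (2 * s))
          & iso (induced B2) (cycle_graph (2 * t))],
      exists (s : nat) (B1 B2 : {set G}),
        [/\ 0 < s, cyclic_blocks [:: B1; B2],
            iso (induced B1) (theta 2 2 2)
          & iso (induced B2) (cycle_graph (2 * s))]
    | exists (s t : nat) (B1 B2 B3 : {set G}),
        [/\ 0 < s, 0 < t, cyclic_blocks [:: B1; B2; B3],
            [/\ iso (induced B1) (cycle_graph (2 * s)),
                iso (induced B2) (cycle_graph 4)
              & iso (induced B3) (cycle_graph (2 * t))]
          & path_through B1 B2 B3 /\
            exists u v : G,
              [/\ B2 :&: core_cutvertices G = [set u; v], u != v
                & ~~ adj u v]]].
Proof.

have [col colE] := choosable_bipartite G_choosable.
case: (structure G_choosable G_conn colE).
- by move=> x sub; left; apply: Or41; apply: (tree_case G_conn sub).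
- by move=> x c l sc U ne; left; apply: Or42; apply: (cycle_case colE l sc U ne).
- move=> x y p q r T ne; left.
  by case: (theta_case colE G_choosable T ne) => H; [apply: Or43|apply: Or44].
- by move=> x y a b c d K ne; right; left; left; apply: (K24_case K ne).
- by move=> a1 a2 b1 b2 a0 p V ne; right; left; right; apply: (VI_case colE V ne).
- move=> v c0 c d l s L U ne; right; right; apply: Or31.
  exact: (dumb_case colE l s L U ne).
- move=> x y a1 a2 a3 v c d T vT L U ne; right; right; apply: Or32.
  exact: (theta_cycle_case colE T vT L U ne).
move=> u v a b c d c' d' l L L' U ne; right; right; apply: Or33.
exact: (square_case colE l L L' U ne).
Qed.
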